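(* There is an extension $\{\mathbf{Q}_{p,q}:q\ge p\in T\}$ of $\{\mathbf{P}_{p,q}:q\ge p\in T\}$ to a Markov transition semigroup on $\mathscr{M}[0,\infty)$, which is given by $$\int_{\mathscr{M}[0,\infty)}e^{-\langle\nu,f\rangle}\mathbf{Q}_{p,q}(\eta,d\nu)=\exp\bigl\{-\mu(p,q]\,u_q(0,f)-\langle\eta,u_{p,q}(\cdot,f)\rangle\bigr\}$$ for $\eta\in\mathscr{M}[0,\infty)$ and $f\in B^+[0,\infty)$ with compact support.
   Context: ''Positive'' means nonnegative, ''increasing/decreasing'' are in the weak sense, $\int_a^b=\int_{(a,b]}$, $\int_a^\infty=\int_{(a,\infty)}$, $\langle\nu,f\rangle=\int f\,d\nu$. $B^+[0,\infty)$ is the set of bounded positive Borel functions on $[0,\infty)$; $D^+[0,\infty)$ is the space of positive càdlàg paths on $[0,\infty)$ with the Skorokhod topology; $\mathscr{M}[0,\infty)$ is the space of Radon measures on $[0,\infty)$ with the vague topology. $D^+[0,\infty)$ is embedded in $\mathscr{M}[0,\infty)$ by identifying the path $w$ with the measure $w(s)\,ds$. A branching mechanism is a function $\phi(\lambda)=b\lambda+\frac12\sigma^2\lambda^2+\int_0^\infty(e^{-z\lambda}-1+z\lambda)m(dz)$, $\lambda\ge0$, with constants $\sigma\ge0$, $b\in\mathbb{R}$, and $(z\wedge z^2)m(dz)$ a finite measure on $(0,\infty)$. Let $T\subset\mathbb{R}$ be an interval, and let $\{\phi_q:q\in T\}$ be an admissible family of branching mechanisms: $\phi_q$ has parameters $(b,m)=(b_q,m_q)$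 depending on $q$ (with $\sigma$ fixed), and for each $\lambda\ge 0$ the function $q\mapsto\phi_q(\lambda)$ is decreasing and continuously differentiable with $\zeta_q(\lambda):=-\frac{\partial}{\partial q}\phi_q(\lambda)=\beta_q\lambda+\int_0^\infty(1-e^{-z\lambda})n_q(dz)$, where $\beta_q\ge0$ and $n_q(dz)$ is a $\sigma$-finite kernel from $T$ to $(0,\infty)$ with $\sup_{p\le\theta\le q}[\beta_\theta+\int_0^\infty z\,n_\theta(dz)]<\infty$ for all $p\le q\in T$. Put $\phi_{p,q}=\phi_p-\phi_q$ for $p\le q$. Let $\mu$ be a positive right continuous increasing function on $T$, $\mu(p,q]=\mu(q)-\mu(p)$. For $f\in B^+[0,\infty)$ with compact support, $s\mapsto u_q(s,f)$ is the unique compactly supported bounded positive solution on $[0,\infty)$ of $u_q(s)+\int_s^\infty\phi_q(u_q(t))\,dt=\int_s^\infty f(t)\,dt$, and $u_{p,q}(s,f)=f(s)+\phi_{p,q}(u_q(s,f))$. $\{\mathbf{P}_{p,q}:q\ge p\in T\}$ is the inhomogeneous Markov transition semigroup on $D^+[0,\infty)$ determined by $\int_{D^+[0,\infty)}e^{-\int_0^\infty f(s)w(s)ds}\,\mathbf{P}_{p,q}(\rho,dw)=\exp\{-\mu(p,q]u_q(0,f)-\int_0^\infty u_{p,q}(s,f)\rho(s)\,ds\}$ for $\rho\in D^+[0,\infty)$ and all such $f$. (Equivalently, $\mathbf{P}_{p,q}(\rho,\cdot)$ is the law of $\rho+w$, where $w$ is a càdlàg inhomogeneous continuous-state branching process with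 immigration with branching mechanism $\phi_q$, immigration mechanism $\phi_{p,q}$, immigration rate $\rho$ and initial value $\mu(p,q]$.) *)

(* Defs.v *)
From HB Require Import structures.
From mathcomp Require Import all_boot all_order all_algebra.
From mathcomp Require Import all_classical all_reals all_analysis.
From mathcomp Require Import measurable_realfun.

Set Implicit Arguments.
Unset Strict Implicit.
Unset Printing Implicit Defensive.

Import Order.TTheory GRing.Theory Num.Theory.
Import numFieldNormedType.Exports.

Local Open Scope classical_set_scope.
Local Open Scope ring_scope.

(* A path on [0, oo) is a function on R that vanishes on (-oo, 0): this makes
   equality of elements of [cadlag R] the pointwise equality on [0, oo). *)
Record cadlag (R : realType) := Cadlag {
  path :> R -> R ;
  path_lt0 : forall s, s < 0 -> path s = 0 ;
  path_ge0 : forall s, 0 <= s -> 0 <= path s ;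
  path_right_continuous : forall s, 0 <= s -> path t @[t --> s^'+] --> path s ;
  path_left_limit : forall s, 0 < s -> cvg (path t @[t --> s^'-]) }.

Section cadlag_topology.
Variable R : realType.

HB.instance Definition _ := gen_eqMixin (cadlag R).
HB.instance Definition _ := gen_choiceMixin (cadlag R).

Let zero_path : cadlag R.
Proof.
by apply: (@Cadlag R (fun=> 0)) => // [s _|s _];
  [exact: cvg_cst | exact: is_cvg_cst].
Defined.

HB.instance Definition _ := isPointed.Build (cadlag R) zero_path.

(* increasing homeomorphisms of [0, oo) *)
Definition time_change (l : R -> R) : Prop :=
  {in `[0, +oo[ &, {homo l : s t / s < t}} /\ l @` `[0, +oo[%classic = `[0, +oo[%classic.

(* The neighbourhoods of the path x for the Skorokhod topology are generated by
   the sets [skorokhod_base x a e], see Ethier and Kurtz, Markov Processes,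
   Proposition 3.5.3 (c): x_n converges to x iff for all a there are time
   changes l_n with l_n(t) - t and x_n(t) - x(l_n(t)) converging to 0 uniformly
   on [0, a]. *)
Definition skorokhod_base (x : cadlag R) (a e : R) : set (cadlag R) :=
  [set y | exists2 l, time_change l &
    forall t, 0 <= t <= a -> `|l t - t| < e /\ `|y t - x (l t)| < e].

Definition skorokhod_open : set_system (cadlag R) :=
  [set A | forall x, A x ->
    exists a e, 0 < e /\ skorokhod_base x a e `<=` A].

Let skorokhod_openT : skorokhod_open setT.
Proof. by move=> x _; exists 0, 1. Qed.

Let skorokhod_openI : setI_closed skorokhod_open.
Proof.
move=> A B oA oB x [/oA[a [e [e0 xA]]] /oB[a' [e' [e'0 xB]]]].
exists (Num.max a a'), (Num.min e e'); split; first by rewrite lt_min e0.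
move=> y [l lT H]; split; [apply: xA|apply: xB]; exists l => // t /andP[t0 ta];
  have /H : 0 <= t <= Num.max a a' by rewrite t0 le_max ta ?orbT.
  by rewrite !lt_min => -[/andP[-> _] /andP[-> _]].
by rewrite !lt_min => -[/andP[_ ->] /andP[_ ->]].
Qed.

Let skorokhod_open_bigU (I : Type) (f : I -> set (cadlag R)) :
  (forall i, skorokhod_open (f i)) -> skorokhod_open (\bigcup_i f i).
Proof.
move=> of_ x [i _ /(of_ i)[a [e [e0 xf]]]]; exists a, e; split=> //.
by apply: subset_trans xf _; exact: bigcup_sup.
Qed.

HB.instance Definition _ := isOpenTopological.Build (cadlag R)
  skorokhod_openT skorokhod_openI skorokhod_open_bigU.

HB.instance Definition _ := @isMeasurable.Build (sigma_display (@open (cadlag R)))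
  (cadlag R) <<s @open (cadlag R) >>
  (@sigma_algebra0 _ setT _) (@sigma_algebraC _ _)
  (@sigma_algebra_bigcup _ setT _).

End cadlag_topology.

(* A Radon measure on [0, oo) is a Borel measure on R that does not charge
   (-oo, 0) and is finite on compact sets. A library measure is a function on
   all subsets of R; giving it the value 0 on non-Borel sets makes equality of
   elements of [radon R] the equality of measures. *)
Record radon (R : realType) := Radon {
  radon_measure :> {measure set R -> \bar R} ;
  radon_lt0 : radon_measure `]-oo, 0[%classic = 0%E ;
  radon_compact : forall a : R, (radon_measure `[0%R, a]%classic < +oo)%E ;
  radon_nonmeasurable : forall A, ~ measurable A -> radon_measure A = 0%E }.

Section radon_topology.
Variable R : realType.

HB.instance Definition _ := gen_eqMixin (radon R).
HB.instance Definition _ := gen_choiceMixin (radon R).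

Let zero_radon : radon R.
Proof. exact: (@Radon R mzero erefl (fun=> ltry 0) (fun _ _ => erefl)). Defined.

HB.instance Definition _ := isPointed.Build (radon R) zero_radon.

Definition pairing (nu : radon R) (f : R -> R) : R :=
  \int[nu]_(s in `[0, +oo[) f s.

Definition compact_support (f : R -> R) : Prop :=
  exists a, forall s, 0 <= s -> a < s -> f s = 0.

Definition vague_test (f : R -> R) : Prop :=
  {within `[0, +oo[%classic, continuous f} /\ compact_support f.

(* the vague topology: the coarsest one for which [pairing ^~ f] is continuous
   for every continuous compactly supported f on [0, oo) *)
HB.instance Definition _ := @isSubBaseTopological.Build (radon R)
  ((R -> R) * set R)%type
  [set fU : (R -> R) * set R | vague_test fU.1 /\ open fU.2]
  (fun fU => (pairing ^~ fU.1) @^-1` fU.2).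

HB.instance Definition _ := @isMeasurable.Build (sigma_display (@open (radon R)))
  (radon R) <<s @open (radon R) >>
  (@sigma_algebra0 _ setT _) (@sigma_algebraC _ _)
  (@sigma_algebra_bigcup _ setT _).

End radon_topology.

Section embedding.
Variable R : realType.
Variable w : cadlag R.

Let path_ge0_all s : 0 <= w s.
Proof.
by have [/path_ge0//|s0] := leP 0 s; rewrite path_lt0.
Qed.

Let path_rc s : w t @[t --> s^'+] --> w s.
Proof.
have [s0|s0] := leP 0 s; first exact: path_right_continuous.
rewrite (path_lt0 _ s0); apply: cvg_near_cst.
by near=> t; rewrite path_lt0//; near: t; exact: nbhs_right_lt.
Unshelve. all: by end_near. Qed.

Lemma measurable_path : measurable_fun setT w.
Proof.
pose g (k : nat) (s : R) : R := ((Num.floor (s * k.+1%:R) + 1)%:~R) / k.+1%:R.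
have g_gt k s : s < g k s <= s + k.+1%:R^-1.
  rewrite /g ltr_pdivlMr// floorD1_gt ler_pdivrMr//= mulrDl mulVf//.
  by rewrite rmorphD/= lerD2r floor_le.
apply: (@measurable_fun_cvg _ _ _ _ (fun k => w \o g k)).
  move=> k _ B mB; rewrite setTI.
  rewrite (_ : _ @^-1` B = \bigcup_(z in [set z : int |
      B (w ((z + 1)%:~R / k.+1%:R))])
      `[z%:~R / k.+1%:R, (z + 1)%:~R / k.+1%:R[%classic).
    rewrite bigcup_mkcond; apply: countable_bigcupT_measurable => [|z].
      exact: countableP.
    by case: ifP => // _; exact: measurable_itv.
  apply/seteqP; split => [s Bs|s [z Bz]] /=.
    exists (Num.floor (s * k.+1%:R)) => //=.
    by rewrite in_itv/= ler_pdivrMr// floor_le ltr_pdivlMr// floorD1_gt.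
  rewrite in_itv/= ler_pdivrMr// ltr_pdivlMr// => zs.
  by rewrite /g (@floor_def _ _ z).
move=> s _ /=.
have /cvg_at_rightP := @path_rc s; apply; split=> [k|]; first by have /andP[] := g_gt k s.
apply: (@squeeze_cvgr _ _ _ _ (fun=> s) (fun k => s + k.+1%:R^-1)).
- by near=> k; have /andP[/ltW -> ->] := g_gt k s.
- exact: cvg_cst.
- rewrite -[X in _ --> X]addr0; apply: cvgD; first exact: cvg_cst.
  exact: cvg_harmonic.
Unshelve. all: by end_near. Qed.

Lemma path_bounded (a : R) : exists C, forall s, s <= a -> w s <= C.
Proof.
have : compact `[0, a]%classic by exact: segment_compact.
move/compact_near_coveringP => /(_ R +oo (fun M s => w s <= M)) [].
  move=> s _.
  suff [C wC] : exists C, \forall t \near s, w t <= C.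
    exists ([set t | w t <= C], [set M | C <= M]) => /=.
      by split => //; exact: (nbhs_pinfty_ge (num_real C)).
    by move=> [t M] /= [tC CM]; exact: le_trans CM.
  have [l lP] : exists l, \forall t \near s^'-, w t <= l.
    have [s0|s0] := ltP 0 s.
      have /cvg_ex[l wl] := @path_left_limit _ w s s0.
      exists (l + 1); near=> t; rewrite -lerBlDl (le_trans (ler_norm _))//.
      by near: t; apply: cvgr_distC_le wl _ _.
    exists 0; near=> t; rewrite path_lt0//; apply: lt_le_trans s0.
    by near: t; exact: nbhs_left_lt.
  have rP : \forall t \near s^'+, w t <= w s + 1.
    near=> t; rewrite -lerBlDl (le_trans (ler_norm _))//.
    by near: t; apply: cvgr_distC_le (@path_rc s) _ _.
  exists (Num.max l (w s + 1)).
  move: lP rP; rewrite /at_left /at_right !near_withinE => lP rP.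
  near=> t; have [ts|st|->] := ltgtP t s; rewrite le_max.
  - by rewrite (near lP t).
  - by rewrite (near rP t) ?orbT.
  - by rewrite lerDl ler01 orbT.
move=> M [_ /(_ (Num.max M 0 + 1))].
move=> H; exists (Num.max M 0 + 1) => s sa.
have [s0|s0] := leP 0 s; last by rewrite path_lt0// addr_ge0// le_max lexx orbT.
apply: H; last by rewrite /= in_itv/= s0.
by rewrite (@le_lt_trans _ _ (Num.max M 0)) ?ltrDl// le_max lexx.
Unshelve. all: by end_near. Qed.

Definition path_mass (A : set R) : \bar R :=
  if `[< measurable A >]
  then (\int[@lebesgue_measure R]_(s in A) (w s)%:E)%E else 0%E.

Let path_mass0 : path_mass set0 = 0%E.
Proof. by rewrite /path_mass; case: asboolP => // _; rewrite integral_set0. Qed.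

Let path_mass_ge0 A : (0 <= path_mass A)%E.
Proof.
rewrite /path_mass; case: asboolP => // _.
by apply: integral_ge0 => s _; rewrite lee_fin.
Qed.

Let path_mass_sigma_additive : semi_sigma_additive path_mass.
Proof.
move=> F mF tF mUF; rewrite /path_mass asboolT// ge0_integral_bigcup//.
- under eq_fun do under eq_bigr do rewrite asboolT//.
  by apply: is_cvg_nneseries => k _ _; apply: integral_ge0 => s _; rewrite lee_fin.
- apply: measurable_funTS; apply/measurable_EFinP; exact: measurable_path.
- by move=> s _; rewrite lee_fin.
Qed.

HB.instance Definition _ := isMeasure.Build _ _ _ path_mass
  path_mass0 path_mass_ge0 path_mass_sigma_additive.

Let path_mass_lt0 : path_mass `]-oo, 0[%classic = 0%E.
Proof.
rewrite /path_mass asboolT; last exact: measurable_itv.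
by apply: integral0_eq => s; rewrite /= in_itv/= => /path_lt0 ->.
Qed.

Let path_mass_compact (a : R) : (path_mass `[0%R, a]%classic < +oo)%E.
Proof.
have [C wC] := path_bounded a.
rewrite /path_mass asboolT; last exact: measurable_itv.
apply: (@le_lt_trans _ _ (\int[@lebesgue_measure R]_(s in `[0%R, a]) (`|C|)%:E)%E).
  apply: ge0_le_integral => //.
  - by move=> s _; rewrite lee_fin.
  - apply: measurable_funTS; apply/measurable_EFinP; exact: measurable_path.
  - move=> s; rewrite /= in_itv/= => /andP[_ /wC sC].
    by rewrite lee_fin (le_trans sC)// ler_norm.
by rewrite integral_cst//= lebesgue_measure_itv/= lte_mul_pinfty//; case: ifP => // _;
  rewrite ltry.
Qed.

Let path_mass_nonmeasurable A : ~ measurable A -> path_mass A = 0%E.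
Proof. by move=> mA; rewrite /path_mass asboolF. Qed.

(* the measure w(s) ds *)
Definition radon_of_path : radon R :=
  Radon path_mass_lt0 path_mass_compact path_mass_nonmeasurable.

End embedding.

Section branching.
Variable R : realType.
Implicit Types (T : set R) (f u phi : R -> R) (mu : R -> R).

Definition branching_mechanism (b sigma : R) (m : {measure set R -> \bar R})
    (l : R) : R :=
  b * l + sigma ^+ 2 * l ^+ 2 / 2 +
  \int[m]_(z in `]0, +oo[) (expR (- (z * l)) - 1 + z * l).

Definition immigration_mechanism (beta : R) (n : {measure set R -> \bar R})
    (l : R) : R :=
  beta * l + \int[n]_(z in `]0, +oo[) (1 - expR (- (z * l))).

(* The derivative in q is taken within T, hence one-sided at the endpoints
   of T. *)
Record admissible T (sigma : R) (b : R -> R) (m : R -> {measure set R -> \bar R})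
    (beta : R -> R) (n : R -> {measure set R -> \bar R}) : Prop := {
  admissible_sigma : 0 <= sigma ;
  admissible_m : forall q, T q ->
    (\int[m q]_(z in `]0%R, +oo[) (Num.min z (z ^+ 2))%:E < +oo)%E ;
  admissible_decreasing : forall l p q, 0 <= l -> T p -> T q -> p <= q ->
    branching_mechanism (b q) sigma (m q) l <=
    branching_mechanism (b p) sigma (m p) l ;
  admissible_beta : forall q, T q -> 0 <= beta q ;
  admissible_n_kernel : forall A : set R, measurable A -> A `<=` `]0, +oo[%classic ->
    measurable_fun T (fun q => n q A) ;
  admissible_n_sigma_finite : forall q, T q ->
    sigma_finite (`]0, +oo[%classic : set R) (n q) ;
  admissible_derivative : forall l q, 0 <= l -> T q ->
    (branching_mechanism (b p) sigma (m p) l -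
     branching_mechanism (b q) sigma (m q) l) / (p - q)
      @[p --> within T q^'] --> - immigration_mechanism (beta q) (n q) l ;
  admissible_derivative_continuous : forall l, 0 <= l ->
    {within T, continuous (fun q => immigration_mechanism (beta q) (n q) l)} ;
  admissible_bounded : forall p q, T p -> T q -> p <= q ->
    (ereal_sup [set (beta t)%:E + \int[n t]_(z in `]0%R, +oo[) z%:E
               | t in `[p, q]] < +oo)%E }.

Definition right_continuous_increasing T mu : Prop :=
  [/\ forall q, T q -> 0 <= mu q,
      forall p q, T p -> T q -> p <= q -> mu p <= mu q &
      forall q, T q -> mu p @[p --> within T q^'+] --> mu q].

(* compactly supported functions in B^+[0, oo) *)
Definition bounded_positive_compact f : Prop :=
  [/\ measurable_fun (`[0, +oo[%classic : set R) f,
      forall s, 0 <= s -> 0 <= f s,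
      exists C, forall s, 0 <= s -> f s <= C &
      compact_support f].

Definition cumulant_solution phi f u : Prop :=
  bounded_positive_compact u /\
  forall s, 0 <= s ->
    u s + \int[@lebesgue_measure R]_(t in `]s, +oo[) phi (u t) =
    \int[@lebesgue_measure R]_(t in `]s, +oo[) f t.

Definition unique_cumulant_solution phi f u : Prop :=
  cumulant_solution phi f u /\
  forall v, cumulant_solution phi f v -> forall s, 0 <= s -> v s = u s.

Definition transition_semigroup (d : measure_display) (E : measurableType d)
    T (P : R -> R -> R.-pker E ~> E) : Prop :=
  (forall p x A, T p -> measurable A -> P p p x A = \d_x A) /\
  (forall p r q x A, T p -> T r -> T q -> p <= r -> r <= q -> measurable A ->
     P p q x A = (\int[P p r x]_y P r q y A)%E).

End branching.

(* Main.v *)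
(* For a step density [rho] the image of [P p q rho] under the embedding of paths
   into measures has the required Laplace functional. A Radon measure [eta] is the
   vague limit of step densities [rho_n], and for [f] continuous these Laplace
   functionals converge, because the Lipschitz continuity of [u q f] makes
   [upq p q f] continuous. A law with the limiting functional is found without
   metrizing the vague topology: on the Loeb space of the laws with parameters
   [rho_n], almost every sequence of measures is vaguely bounded along the
   ultrafilter, since the limiting functional at [x f] tends to [1] as [x] tends
   to [0]; hence it has a vague limit along the ultrafilter, and the law of this
   limit is [Q p q eta]. The formula passes to Borel functions [f] by a monotone
   class argument, the cumulant equation being stable under bounded pointwise
   convergence by Gronwall's lemma. Laplace functionals determine laws on the
   space of Radon measures, so that the semigroup property comes down to the flow
   identities [u r (upq r q f) = u q f] and [upq p r (upq r q f) = upq p q f],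
   which follow from the uniqueness of the solution of the cumulant equation. *)

Require Import Defs.
From HB Require Import structures.
From mathcomp Require Import all_boot all_order all_algebra.
From mathcomp Require Import all_classical all_reals all_analysis.
From mathcomp Require Import measurable_realfun.
From mathcomp Require Import lra ring.

Set Implicit Arguments.
Unset Strict Implicit.
Unset Printing Implicit Defensive.

Import Order.TTheory GRing.Theory Num.Theory.
Import numFieldNormedType.Exports.

Local Open Scope classical_set_scope.
Local Open Scope ring_scope.

(** * Monotone classes *)

(** The Borel sets of the vague topology are handled through a countable base: rational bounds on
    the pairings with tent functions. Hence they are generated by the pairings, and a statement
    about bounded Borel functions of a Radon measure reduces to the Laplace exponentials of the
    measure. Measurability of the embedding of paths, of the ultralimit and of the new kernels in
    [eta] is all obtained in this way. For the embedding this uses that the integral of [f w] is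
    Skorokhod continuous in [w], even for [f] merely Borel. For the ultralimit, whose values are
    picked pointwise by choice, it uses that its Laplace exponentials are standard parts of internal
    functions, hence Loeb measurable. Two features force the detour through continuous functions:
    vague convergence only sees continuous [f], and the Laplace formula is not linear in [f], so the
    usual monotone class theorem for vector spaces does not apply to it directly. That the new
    kernels extend the old ones is a uniqueness statement: both sides are laws on Radon measures
    with one Laplace functional. *)

Section layers.
Variable R : realType.

(** For [y] in [0,1] this is the floor of [K y] divided by [K], written as a sum over thresholds so
    that [layers K \o g] is a combination of indicators of superlevel sets of [g]. *)
Definition layers (K : nat) (y : R) : R :=
  \sum_(j < K) K%:R^-1 * (j.+1%:R / K%:R <= y)%R%:R.

Lemma layers_bounds (K : nat) (y : R) : (0 < K)%N -> 0 <= y <= 1 ->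
  layers K y <= y <= layers K y + K%:R^-1.
Proof.
move=> K0 /andP[y0 y1].
have K0' : 0 < K%:R :> R by rewrite ltr0n.
(* After multiplication by [K] the sum counts the integers from 1 to [K] that are at most [y K], and
   this number lies between [y K - 1] and [y K]. *)
have count_le (L : nat) (z : R) : 0 <= z -> \sum_(j < L) (j.+1%:R <= z)%R%:R <= z.
  move=> z0; elim: L => [|L IH]; first by rewrite big_ord0.
  rewrite big_ord_recr/=; have [Lz|zL] := leP L.+1%:R z; last by rewrite addr0.
  apply: le_trans Lz; rewrite -natr1 lerD2r.
  apply: (@le_trans _ _ (\sum_(j < L) 1)); last by rewrite sumr_const card_ord.
  by apply: ler_sum => j _; rewrite lern1 leq_b1.
have count_ge (L : nat) (z : R) : z <= L%:R ->
    z <= \sum_(j < L) (j.+1%:R <= z)%R%:R + 1.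
  elim: L => [|L IH] zL; first by rewrite big_ord0 add0r (le_trans zL).
  have [zL'|Lz] := leP z L%:R.
    apply: (le_trans (IH zL')); rewrite lerD2r big_ord_recr/= lerDl.
    by rewrite ler0n.
  rewrite big_ord_recr/= -[leLHS]add0r -lerBlDr.
  apply: (@le_trans _ _ (\sum_(j < L) 1)).
    by rewrite sumr_const card_ord; move: zL; rewrite -natr1; lra.
  rewrite -[leLHS]addr0 lerD ?ler0n//; apply: ler_sum => j _.
  rewrite (_ : _ <= z = true)//; apply: le_trans (ltW Lz).
  by rewrite ler_nat.
have -> : layers K y = (\sum_(j < K) (j.+1%:R <= y * K%:R)%R%:R) / K%:R.
  rewrite /layers mulr_suml; apply: eq_bigr => j _.
  by rewrite mulrC ler_pdivrMr.
rewrite -[X in _ / _ <= _ <= _ + X]mul1r -mulrDl ler_pdivrMr// ler_pdivlMr//.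
apply/andP; split; first by rewrite count_le// mulr_ge0// ltW.
by apply: count_ge; rewrite ler_piMl// ltW.
Qed.

Lemma cvg_layers (y : R) : 0 <= y <= 1 -> layers k.+1 y @[k --> \oo] --> y.
Proof.
move=> y01.
apply: (@squeeze_cvgr _ _ _ _ (fun k => y - k.+1%:R^-1) (fun=> y)).
- by near=> k; rewrite lerBlDr; have /andP[-> ->] := @layers_bounds k.+1 _ isT y01.
- rewrite -[X in _ --> X]subr0; apply: cvgB; first exact: cvg_cst.
  exact: cvg_harmonic.
- exact: cvg_cst.
Unshelve. all: by end_near. Qed.

End layers.

Section monotone_class.
Variable R : realType.

Definition bounded_cvg_closed (X : Type) (H : set (X -> R)) :=
  forall (f_ : nat -> X -> R) f C, (forall k, H (f_ k)) ->
    (forall k x, `|f_ k x| <= C) ->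
    (forall x, f_ k x @[k --> \oo] --> f x) -> H f.

Definition linear_closed (X : Type) (H : set (X -> R)) :=
  forall a f g, H f -> H g -> H (fun x => a * f x + g x).

Lemma linear_closed_sum (X : Type) (H : set (X -> R)) (I : Type) (r : seq I)
    (c : I -> R) (F : I -> X -> R) :
  linear_closed H -> H (fun=> 1) -> (forall i, H (F i)) ->
  H (fun x => \sum_(i <- r) c i * F i x).
Proof.
move=> lH H1 HF; elim: r => [|i r IH].
  (* [linear_closed] yields the zero function only as a combination of the constant 1 with
     itself. *)
  rewrite (_ : (fun=> _) = (fun x => -1 * 1 + 1)); last first.
    by apply/funext => x; rewrite big_nil mulN1r addNr.
  exact: lH.
rewrite (_ : (fun=> _) = (fun x => c i * F i x + \sum_(j <- r) c j * F j x)).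
  exact: lH.
by apply/funext => x; rewrite big_cons.
Qed.

(** The sets whose indicator is in [H] form a lambda-system, so they include all measurable sets; a
    bounded function, rescaled to take values in [0,1], is the bounded limit of its layers. *)
Lemma monotone_class d (X : measurableType d) (G : set (set X))
    (H : set (X -> R)) :
  setI_closed G -> @measurable _ X `<=` <<s G >> ->
  linear_closed H -> bounded_cvg_closed H -> H (fun=> 1) ->
  (forall A, G A -> H (\1_A)) ->
  forall f : X -> R, measurable_fun setT f -> (exists C : R, forall x, `|f x| <= C) -> H f.
Proof.
move=> GI mG lH bH H1 GH.
have mH E : measurable E -> H (\1_E).
  move=> /mG; apply: (@lambda_system_subset _ G GI setT [set A | H (\1_A)]) => //.
  split => //=.
  - by rewrite (_ : \1_setT = fun=> 1)//; apply/funext => x; rewrite indicT.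
  - move=> A B BA HA HB.
    rewrite /= (_ : \1_(A `\` B) = (fun x => -1 * \1_B x + \1_A x)); first exact: lH.
    apply/funext => x; rewrite mulN1r !indicE in_setD.
    have [xB|xB] := boolP (x \in B); last by rewrite andbT oppr0 add0r.
    by rewrite andbF (mem_set (BA _ (set_mem xB))) addNr.
  - move=> F ndF HF; apply: (bH (fun k => \1_(F k)) _ 1) => // [k x|x].
      by rewrite indicE ger0_norm ?ler0n// lern1 leq_b1.
    have [[i _ Fix]|nF] := pselect ((\bigcup_k F k) x).
      apply: cvg_near_cst; near=> k; rewrite !indicE !mem_set//; first by exists i.
      have /subsetPset : (F i <= F k)%O by apply: ndF; near: k; exact: nbhs_infty_ge.
      exact.
    apply: cvg_near_cst; near=> k; rewrite !indicE !memNset// => Fkx.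
    by apply: nF; exists k.
move=> f mf [C fC].
(* The bound is enlarged to [|C| + 1] so that the division by [2 C1] is legitimate. *)
have [C1 C10 fC1] : exists2 C1, 0 < C1 & forall x, 0 <= (f x + C1) / (2 * C1) <= 1.
  exists (`|C| + 1) => [|x]; first by rewrite ltr_wpDl.
  have C1 : 0 < `|C| + 1 by rewrite ltr_wpDl.
  have := fC x; rewrite ler_norml => /andP[f1 f2].
  have CC := ler_norm C.
  by rewrite divr_ge0 ?ler_pdivrMr ?mulr_gt0//=; lra.
pose g x := (f x + C1) / (2 * C1).
have mg : measurable_fun setT g.
  apply: measurable_funM => //; exact: measurable_funD.
have Hg : H g.
  apply: (bH (fun k x => layers k.+1 (g x)) _ 2) => [k|k x|x].
  - apply: linear_closed_sum => // j.
    rewrite (_ : (fun=> _) = \1_(g @^-1` `[j.+1%:R / k.+1%:R, +oo[%classic)).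
      by apply: mH; rewrite -[X in measurable X]setTI; exact: mg.
    by apply/funext => x; rewrite indicE; congr ((nat_of_bool _)%:R); apply/idP/idP => [?|];
      [apply/mem_set; rewrite /= in_itv/= andbT|
       move/set_mem; rewrite /= in_itv/= andbT].
  - have /andP[l1 l2] := @layers_bounds R k.+1 (g x) isT (fC1 x).
    have /andP[g1 g2] := fC1 x.
    have : 0 <= layers k.+1 (g x) :> R.
      by apply: sumr_ge0 => j _; rewrite mulr_ge0 ?invr_ge0.
    by move=> l0; rewrite ger0_norm// (le_trans l1)//; rewrite /g; lra.
  - exact/cvg_layers/fC1.
rewrite (_ : f = (fun x => (2 * C1) * g x + (- C1 * 1 + 0 * 1))).
  apply: (lH _ _ (fun=> _)) => //; apply: (lH _ (fun=> 1) (fun=> 0 * 1)) => //.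
  rewrite (_ : (fun=> 0 * 1) = (fun x : X => -1 * 1 + 1)); first exact: lH.
  by apply/funext => x; rewrite mul0r mulN1r addNr.
by apply/funext => x; rewrite /g; field; rewrite gt_eqF.
Unshelve. all: by end_near. Qed.

(* The bounded limits of elements of [V] form a vector space even though [C]
   need not: this is how identities that are not linear in [f] are extended. *)
Lemma bounded_cvg_closed_ext d (X : measurableType d) (G : set (set X))
    (V C : set (X -> R)) :
  setI_closed G -> @measurable _ X `<=` <<s G >> ->
  linear_closed V -> V (fun=> 1) ->
  (forall v, V v -> exists M : R, forall x, `|v x| <= M) ->
  (forall H, bounded_cvg_closed H -> V `<=` H -> forall A, G A -> H (\1_A)) ->
  bounded_cvg_closed C -> V `<=` C ->
  forall f : X -> R, measurable_fun setT f -> (exists M : R, forall x, `|f x| <= M) -> C f.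
Proof.
move=> GI mG lV V1 Vbd GV bC VC f mf Mf.
(* The smallest class that contains [V] and is closed under bounded limits. *)
pose B : set (X -> R) := [set f | forall H, bounded_cvg_closed H -> V `<=` H -> H f].
have bB : bounded_cvg_closed B.
  by move=> f_ f0 M Bf fM ff H bH VH; apply: (bH f_ _ M) => // k; exact: Bf.
have VB : V `<=` B by move=> g Vg H _; exact.
pose B0 : set (X -> R) := [set f | B f /\ exists M : R, forall x, `|f x| <= M].
(* Linearity of [B] is proved one argument at a time: with one summand fixed and bounded, the
   admissible other summands form a class closed under bounded limits. This is used first with the
   fixed summand in [V], then with it in [B]. *)
have B0Z a h : (exists N : R, forall x, `|h x| <= N) ->
    bounded_cvg_closed [set g | B (fun x => a * g x + h x)].
  move=> [N hN] f_ f0 M Bf fM ff /=.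
  apply: (bB (fun k x => a * f_ k x + h x) _ (`|a| * M + N)) => // [k x|x].
    by rewrite (le_trans (ler_normD _ _))// lerD// normrM ler_wpM2l.
  by apply: cvgD; [apply: cvgM; [exact: cvg_cst|exact: ff]|exact: cvg_cst].
have BV a g h : B g -> V h -> B (fun x => a * g x + h x).
  move=> Bg Vh; apply: (Bg [set g | B (fun x => a * g x + h x)]).
    by apply: B0Z; exact: Vbd Vh.
  by move=> v Vv /=; apply: VB; exact: lV.
suff [Bf _] : B0 f by exact: (Bf C).
apply: (@monotone_class _ _ G B0) => //.
- move=> a g h [Bg [M gM]] [Bh [N hN]]; split; last first.
    exists (`|a| * M + N) => x.
    by rewrite (le_trans (ler_normD _ _))// lerD// normrM ler_wpM2l.
  have := Bh [set h | B (fun x => 1 * h x + a * g x)].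
  rewrite /= (_ : (fun x => 1 * h x + a * g x) = (fun x => a * g x + h x)).
    apply.
      apply: B0Z; exists (`|a| * M) => x; by rewrite normrM ler_wpM2l.
    move=> v Vv /=; rewrite (_ : (fun=> _) = (fun x => a * g x + v x)).
      exact: BV.
    by apply/funext => x; rewrite mul1r addrC.
  by apply/funext => x; rewrite mul1r addrC.
- move=> f_ f0 M Bf fM ff; split.
    by apply: (bB f_ _ M) => // k; have [] := Bf k.
  exists M => x; rewrite -(cvg_lim _ (cvg_norm (ff x)))//; apply: limr_le.
    by apply/cvg_ex; exists `|f0 x|; exact: (cvg_norm (ff x)).
  exact: nearW.
- by split; [exact: VB|exists 1 => x; rewrite normr1].
- move=> A GA; split; first by move=> H bH VH; exact: (GV H).
  by exists 1 => x; rewrite indicE ger0_norm ?ler0n// lern1 leq_b1.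
Qed.

End monotone_class.

Lemma cvg_sumr (R : realType) (T I : Type) (F : set_system T) (r : seq I)
    (f : I -> T -> R) (l : I -> R) : Filter F ->
  (forall i, f i x @[x --> F] --> l i) ->
  \sum_(i <- r) f i x @[x --> F] --> \sum_(i <- r) l i.
Proof.
move=> FF fl; elim: r => [|i r IH].
  by rewrite big_nil; under eq_fun do rewrite big_nil; exact: cvg_cst.
by rewrite big_cons; under eq_fun do rewrite big_cons; exact: cvgD.
Qed.

Section bounded_integral.
Context d (X : measurableType d) (R : realType).

Lemma bounded_integrable (mu : {finite_measure set X -> \bar R}) (D : set X)
    (f : X -> R) (C : R) :
  measurable D -> measurable_fun D f -> (forall x, D x -> `|f x| <= C) ->
  mu.-integrable D (EFin \o f).
Proof.
move=> mD mf fC; apply: measurable_bounded_integrable => //.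
  by rewrite -ge0_fin_numE// fin_num_measure.
exists C; split; first exact: num_real.
by move=> M CM x Dx; apply: le_trans (ltW CM); exact: fC.
Qed.

Lemma Rintegral_sum_indic (mu : {finite_measure set X -> \bar R}) (K : nat)
    (c : R) (A : nat -> set X) : (forall j, measurable (A j)) ->
  \int[mu]_x (\sum_(j < K) c * \1_(A j) x) = \sum_(j < K) c * fine (mu (A j)).
Proof.
move=> mA.
have mI (j : nat) : measurable_fun setT (\1_(A j) : X -> R) by exact: measurable_indic.
have iI (j : nat) : mu.-integrable setT (EFin \o (\1_(A j) : X -> R)).
  apply: (@bounded_integrable _ _ _ 1) => // x _.
  by rewrite indicE ger0_norm ?ler0n// lern1 leq_b1.
elim: K => [|K IH].
  rewrite big_ord0; under eq_Rintegral do rewrite big_ord0.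
  by rewrite Rintegral_cst// mul0r.
under eq_Rintegral do rewrite big_ord_recr/=.
rewrite RintegralD//; first last.
- apply: (@bounded_integrable _ _ _ `|c|) => //; first exact: measurable_funM.
  move=> x _; rewrite normrM ler_piMr//.
  by rewrite indicE ger0_norm ?ler0n// lern1 leq_b1.
- apply: (@bounded_integrable _ _ _ (`|c| *+ K)) => //.
    by apply: measurable_sum => j; apply: measurable_funM.
  move=> x _; apply: le_trans (ler_norm_sum _ _ _) _.
  apply: le_trans (_ : \sum_(j < K) `|c| <= _).
    apply: ler_sum => j _; rewrite normrM ler_piMr//.
    by rewrite indicE ger0_norm ?ler0n// lern1 leq_b1.
  by rewrite sumr_const card_ord.
by rewrite IH big_ord_recr/= RintegralZl// /Rintegral integral_indic// setIT.
Qed.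

Lemma layersE (K : nat) (g : X -> R) (x : X) : layers K (g x) =
  \sum_(j < K) K%:R^-1 * \1_(g @^-1` `[j.+1%:R / K%:R, +oo[%classic) x.
Proof.
apply: eq_bigr => j _; rewrite indicE; congr (_ * (nat_of_bool _)%:R).
apply/idP/idP => [?|]; first by apply/mem_set; rewrite /= in_itv/= andbT.
by move/set_mem; rewrite /= in_itv/= andbT.
Qed.

Lemma le_Rintegral_dist (P : probability X R) (f g : X -> R) (C e : R) :
  measurable_fun setT f -> measurable_fun setT g ->
  (forall x, `|f x| <= C) -> (forall x, `|g x| <= C) ->
  (forall x, `|f x - g x| <= e) ->
  `|\int[P]_x f x - \int[P]_x g x| <= e.
Proof.
move=> mf mg fC gC fg.
have jf : P.-integrable setT (EFin \o f) by exact: bounded_integrable.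
have jg : P.-integrable setT (EFin \o g) by exact: bounded_integrable.
rewrite -RintegralB//.
have jfg : P.-integrable setT (EFin \o (fun x => f x - g x)).
  by apply: (@bounded_integrable _ _ _ e) => //; exact: measurable_funB.
apply: le_trans (le_normr_Rintegral _ _) _ => //.
rewrite (_ : e = \int[P]_x e); last first.
  by rewrite Rintegral_cst// [fine _](_ : _ = 1) ?mulr1// [X in fine X]probability_setT.
apply: le_Rintegral => //; last by apply: (@bounded_integrable _ _ _ `|e|).
apply: (@bounded_integrable _ _ _ e) => //; last by move=> x _; rewrite normr_id.
by apply: measurableT_comp => //; exact: measurable_funB.
Qed.

End bounded_integral.

(** * Loeb measures *)

Section ultrafilter.

Definition nat_ultra : set_system nat :=
  sval (cid (@ultraFilterLemma nat \oo _)).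

Lemma nat_ultraP : UltraFilter nat_ultra.
Proof. by rewrite /nat_ultra; case: cid => G []. Qed.

Lemma nat_ultra_free : \oo `<=` nat_ultra.
Proof. by rewrite /nat_ultra; case: cid => G []. Qed.

Global Instance nat_ultra_proper : ProperFilter nat_ultra.
Proof. exact: (@ultra_proper _ _ nat_ultraP). Qed.

Lemma nat_ultraN (A : set nat) : ~ nat_ultra A -> nat_ultra (~` A).
Proof. by case: (in_ultra_setVsetC A nat_ultraP). Qed.

Lemma ultra_fmap (T : Type) (f : nat -> T) : UltraFilter (f @ nat_ultra).
Proof.
split; first exact: fmap_proper_filter.
move=> G GF fG; apply/seteqP; split=> // A GA.
have [//|nA] := in_ultra_setVsetC (f @^-1` A) nat_ultraP.
have := fG (~` A) nA => GnA.
by have /filter_ex[x []] : G (A `&` ~` A) by exact: filterI.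
Qed.

Variable R : realType.
Implicit Types a : nat -> R.

(** Compactness of a segment, in its ultrafilter form. It lets every limit along [nat_ultra] exist
    without extracting subsequences. *)
Lemma is_cvg_ultra a (C : R) : (\forall n \near nat_ultra, `|a n| <= C) ->
  cvg (a @ nat_ultra).
Proof.
move=> aC.
have := @segment_compact R (- C) C; rewrite compact_ultra => /(_ (a @ nat_ultra)).
case.
- exact: ultra_fmap.
- by rewrite /nbhs/=; near do rewrite /= in_itv/= -ler_norml.
- by move=> l [_ al]; apply/cvg_ex; exists l.
Unshelve. all: by end_near. Qed.

Lemma cvg_ultra a (l : R) : a @ \oo --> l -> a @ nat_ultra --> l.
Proof. by move=> al A /al aA; exact: nat_ultra_free. Qed.

End ultrafilter.

Section loeb.
Context d (E : measurableType d) (R : realType) (P : nat -> probability E R).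

(** Plain sequences, with no quotient by the ultrafilter: membership in an internal set depends only
    on the class of a sequence anyway. *)
Definition ultrapower : Type := nat -> E.

HB.instance Definition _ := Pointed.on ultrapower.

Definition internal (A : nat -> set E) : set ultrapower :=
  [set w | \forall n \near nat_ultra, A n (w n)].

Definition internal_sets : set (set ultrapower) :=
  [set internal A | A in [set A | forall n, measurable (A n)]].

Lemma internalC A : ~` internal A = internal (fun n => ~` A n).
Proof.
apply/seteqP; split => w /=; first exact: nat_ultraN.
move=> wA wA'.
by have /filter_ex[x []] : nat_ultra ([set n | (~` A n) (w n)] `&`
  [set n | A n (w n)]) by exact: filterI.
Qed.

Lemma internalI A B : internal A `&` internal B = internal (fun n => A n `&` B n).
Proof.
apply/seteqP; split => w /=; first by case=> wA wB; exact: filterI.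
by move=> wAB; split; apply: filterS wAB => n [].
Qed.

Lemma internalU A B : internal A `|` internal B = internal (fun n => A n `|` B n).
Proof.
rewrite -[LHS]setCK setCU !internalC internalI internalC; congr internal.
by apply/funext => n; rewrite setCI !setCK.
Qed.

Lemma internal0 : internal (fun=> set0) = set0.
Proof. by apply/seteqP; split => w // /filter_ex[]. Qed.

(** Where [A n] and [B n] differ, [w n] is taken in exactly one of them, so that [w] separates the
    internal sets unless the sequences agree almost everywhere. Hence [loeb_content] does not depend
    on the representing sequence. *)
Lemma internal_inj A B : internal A = internal B ->
  \forall n \near nat_ultra, A n = B n.
Proof.
move=> AB; apply: contrapT => /nat_ultraN nAB.
have [w wP] : {w : nat -> E & forall n, A n <> B n -> ~ (A n (w n) <-> B n (w n))}.
  apply: (@choice _ _ (fun n x => A n <> B n -> ~ (A n x <-> B n x))) => n.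
  have [->|ABn] := pselect (A n = B n); first by exists point.
  have [x nx] : exists x, ~ (A n x <-> B n x).
    apply: contrapT => /forallNP H; apply: ABn; apply/seteqP.
    by split => x; have /contrapT[] := H x.
  by exists x.
have wAB : internal A w <-> internal B w by rewrite AB.
have [wA|nwA] := pselect (internal A w).
  have /filter_ex[n [[wAn wBn] /wP]] : nat_ultra (([set n | A n (w n)] `&`
    [set n | B n (w n)]) `&` ~` [set n | A n = B n]).
    by apply: filterI => //; apply: filterI => //; exact/wAB.
  by apply.
have nwB : ~ internal B w by move/wAB.
have /filter_ex[n [[wAn wBn] /wP]] : nat_ultra ((~` [set n | A n (w n)] `&`
    ~` [set n | B n (w n)]) `&` ~` [set n | A n = B n]).
  by apply: filterI => //; apply: filterI => //; exact: nat_ultraN.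
by apply.
Qed.

Lemma internal_sets0 : internal_sets set0.
Proof. by exists (fun=> set0) => //; exact: internal0. Qed.

Lemma internal_setsU : setU_closed internal_sets.
Proof.
move=> _ _ [A mA <-] [B mB <-]; rewrite internalU; exists (fun n => A n `|` B n) => //.
by move=> n; exact: measurableU.
Qed.

Lemma internal_setsC : setC_closed internal_sets.
Proof.
move=> _ [A mA <-]; rewrite internalC; exists (fun n => ~` A n) => //.
by move=> n; exact: measurableC.
Qed.

HB.instance Definition _ := @isAlgebraOfSets.Build default_measure_display ultrapower
  internal_sets internal_sets0 internal_setsU internal_setsC.

(* Countable saturation: on the coordinates [n] of [S k] the first [k] sets
   still intersect, and [w n] is taken in as many of them as possible. *)
Lemma saturation (A : nat -> nat -> set E) :
  (forall k, \bigcap_(i in `I_k) internal (A i) !=set0) ->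
  \bigcap_i internal (A i) !=set0.
Proof.
move=> fip.
(* The clause [k <= n] leaves finitely many [k] for each [n], so that a largest one exists; it holds
   for almost every [n] since the ultrafilter is free. *)
pose S k n := (k <= n)%N /\ (\bigcap_(i in `I_k) A i n) !=set0.
have US k : nat_ultra (S k).
  apply: filterI; first by apply: nat_ultra_free; exact: nbhs_infty_ge.
  have [w wA] := fip k.
  have : \forall n \near nat_ultra, (\bigcap_(i in `I_k) A i n) (w n).
    elim: k {wA} (fun i (ik : `I_k i) => wA i ik) => [|k IH] wA.
      by apply: filterE => n i.
    have h1 := wA k (ltnSn k).
    have h2 := IH (fun i ik => wA i (ltnW ik)).
    apply: filterS2 h1 h2 => n h1 h2 i; rewrite /= ltnS leq_eqVlt => /predU1P[->//|].
    exact: h2.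
  by apply: filterS => n; exists (w n).
have S0 n : S 0%N n by split => //; exists point.
have [w wP] : {w : nat -> E & forall n k, S k n -> (k <= n)%N ->
    (\bigcap_(i in `I_k) A i n) (w n)}.
  apply: (@choice _ _ (fun n x => forall k, S k n -> (k <= n)%N ->
    (\bigcap_(i in `I_k) A i n) x)) => n.
  pose p k := `[< S k n >].
  have p0 : exists k, p k by exists 0%N; exact/asboolP.
  have pn k : p k -> (k <= n)%N by move/asboolP => [].
  have [m /asboolP[mn [x xA]] mmax] := ex_maxnP p0 pn.
  exists x => k Sk _ i ik; apply: xA => /=.
  by apply: (leq_trans ik); apply: mmax; exact/asboolP.
exists w => i _; apply: filterS (US i.+1) => n Sn.
by apply: (wP n i.+1 Sn) => //=; case: Sn.
Qed.

Definition loeb_content (S : set ultrapower) : \bar R :=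
  if pselect (internal_sets S) is left h then
    (lim (fine (P n (sval (cid2 h) n)) @[n --> nat_ultra]))%:E else 0%E.

Lemma is_cvg_prob (A : nat -> set E) : (forall n, measurable (A n)) ->
  cvg (fine (P n (A n)) @[n --> nat_ultra]).
Proof.
move=> mA; apply: (@is_cvg_ultra _ _ 1); apply: filterE => n.
rewrite ger0_norm ?fine_ge0// -lee_fin fineK ?probability_le1//.
by rewrite fin_num_measure.
Qed.

Lemma loeb_contentE (A : nat -> set E) : (forall n, measurable (A n)) ->
  loeb_content (internal A) = (lim (fine (P n (A n)) @[n --> nat_ultra]))%:E.
Proof.
move=> mA; rewrite /loeb_content; case: pselect => [h|[]]; last by exists A.
case: cid2 => B mB /= BA; congr EFin.
apply: (@cvg_lim _ (@Rhausdorff R)).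
apply: cvg_trans (is_cvg_prob mA); apply: near_eq_cvg.
by apply: filterS (internal_inj BA) => n /= ->.
Qed.

Lemma loeb_content_ge0 S : (0 <= loeb_content S)%E.
Proof.
rewrite /loeb_content; case: pselect => // h; rewrite lee_fin.
case: cid2 => B mB /= _; apply: limr_ge; first exact: is_cvg_prob.
by apply: filterE => n; exact: fine_ge0.
Qed.

Lemma loeb_contentU S T : internal_sets S -> internal_sets T -> S `&` T = set0 ->
  loeb_content (S `|` T) = (loeb_content S + loeb_content T)%E.
Proof.
move=> [A mA <-] [B mB <-] AB0.
(* Disjoint internal sets are represented by sequences disjoint only on almost every coordinate;
   removing [A n] from [B n] makes them disjoint on all. *)
have BE : internal B = internal (fun n => B n `\` A n).
  rewrite [RHS](_ : _ = internal B `&` ~` internal A); last first.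
    by rewrite internalC internalI.
  by apply/esym/setIidPl => w Bw Aw; have : set0 w by rewrite -AB0.
have mBA n : measurable (B n `\` A n) by exact: measurableD.
rewrite BE internalU !loeb_contentE//; last by move=> n; exact: measurableU.
rewrite -EFinD; congr EFin; apply: (@cvg_lim _ (@Rhausdorff R)).
rewrite [X in X @ _ --> _](_ : _ =
    (fun n => fine (P n (A n)) + fine (P n (B n `\` A n)))); last first.
  apply/funext => n; rewrite measureU//; last by rewrite setDE setICA setICr setI0.
  by rewrite fineD ?fin_num_measure.
apply: cvgD; exact: is_cvg_prob.
Qed.

Lemma loeb_content0 : loeb_content set0 = 0%E.
Proof.
rewrite -internal0 loeb_contentE//; congr EFin.
under eq_fun do rewrite measure0; by apply: (@cvg_lim _ (@Rhausdorff R)); exact: cvg_cst.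
Qed.

Lemma loeb_content_sum (F : nat -> set ultrapower) n :
  (forall i, internal_sets (F i)) -> trivIset setT F ->
  loeb_content (\big[setU/set0]_(i < n) F i) = (\sum_(i < n) loeb_content (F i))%E.
Proof.
move=> mF tF; elim: n => [|n IH].
  by rewrite !big_ord0 loeb_content0.
rewrite !big_ord_recr/= loeb_contentU//; first by rewrite IH.
- elim: n {IH} => [|n IH]; first by rewrite big_ord0; exact: internal_sets0.
  by rewrite big_ord_recr/=; exact: internal_setsU.
- rewrite -bigcup_mkord; apply/seteqP; split => // w [[i /= ni Fiw] Fnw].
  by have iE := tF i n I I (ex_intro _ w (conj Fiw Fnw)); rewrite iE ltnn in ni.
Qed.

(** Only finite additivity is at stake: if no finite subfamily covered the union, which is internal,
    then saturation would give a point of the union outside every [F i]. So all but finitely many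
    [F i] are empty. *)
Lemma loeb_content_sigma_additive : semi_sigma_additive loeb_content.
Proof.
move=> F mF tF [B mB BE].
have [A AP] : {A : nat -> nat -> set E &
    forall i, (forall n, measurable (A i n)) /\ internal (A i) = F i}.
  apply: (@choice _ _ (fun i (A : nat -> set E) =>
    (forall n, measurable (A n)) /\ internal A = F i)) => i.
  by have [A mA AF] := mF i; exists A.
have [N NP] : exists N, \bigcup_i F i `<=` \bigcup_(i in `I_N) F i.
  apply: contrapT => /forallNP noN.
  have intC i : internal (fun n => B n `\` A i n) = (\bigcup_i F i) `\` F i.
    by rewrite -BE -(AP i).2 setDE internalC internalI.
  have [|w wC] := @saturation (fun i n => B n `\` A i n).
    move=> k; apply: contrapT => k0; apply: (noN k) => w wF.
    apply: contrapT => wk; apply: k0; exists w => i ik; rewrite intC; split => //.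
    by move=> Fiw; apply: wk; exists i.
  have [i _ Fiw] : (\bigcup_i F i) w by have := wC 0%N I; rewrite intC => -[].
  by have := wC i I; rewrite intC => -[_]; apply.
have F0 i : (N <= i)%N -> F i = set0.
  move=> Ni; apply/seteqP; split => // w Fiw.
  have [j /= jN Fjw] := NP w (ex_intro2 _ _ i I Fiw).
  have ji := tF j i I I (ex_intro _ w (conj Fjw Fiw)).
  by rewrite ji ltnNge Ni in jN.
have UFE n : (N <= n)%N -> \bigcup_i F i = \big[setU/set0]_(i < n) F i.
  move=> Nn; rewrite -bigcup_mkord; apply/seteqP; split => w.
    by move=> /NP[i /= iN Fiw]; exists i => //=; exact: leq_trans Nn.
  by move=> [i _ Fiw]; exists i.
apply: cvg_near_cst; near=> n.
rewrite big_mkord -loeb_content_sum// -UFE//; near: n; exact: nbhs_infty_ge.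
Unshelve. all: by end_near. Qed.

HB.instance Definition _ := isMeasure.Build _ ultrapower R loeb_content
  loeb_content0 loeb_content_ge0
  loeb_content_sigma_additive.

Definition loeb_measure := measure_extension loeb_content.

HB.instance Definition _ := Measure.on loeb_measure.

Lemma loeb_measureE (A : nat -> set E) : (forall n, measurable (A n)) ->
  loeb_measure (internal A) = (lim (fine (P n (A n)) @[n --> nat_ultra]))%:E.
Proof.
move=> mA; rewrite /loeb_measure /measure_extension/= measurable_mu_extE//.
  exact: loeb_contentE.
by exists A.
Qed.

Lemma internalT : internal (fun=> setT) = setT.
Proof. by apply/seteqP; split => // w _; exact: filterT. Qed.

Lemma loeb_measure_setT : loeb_measure setT = 1%E.
Proof.
rewrite -internalT loeb_measureE//; congr EFin.
under eq_fun do rewrite probability_setT; by apply: (@cvg_lim _ (@Rhausdorff R)); exact: cvg_cst.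
Qed.

HB.instance Definition _ := Measure_isProbability.Build _ _ _ loeb_measure
  loeb_measure_setT.

Definition loeb_space := g_sigma_algebraType (@measurable _ ultrapower).

Section expectation.
Variable g : E -> R.
Hypotheses (mg : measurable_fun setT g) (g01 : forall x, 0 <= g x <= 1).

(** The standard part of the internal function with constant sequence [g]. *)
Definition loeb_lift (w : ultrapower) : R := lim (g (w n) @[n --> nat_ultra]).

Lemma cvg_loeb_lift w : g (w n) @[n --> nat_ultra] --> loeb_lift w.
Proof.
apply: (@is_cvg_ultra _ _ 1); apply: filterE => n.
by have /andP[g0 g1] := g01 (w n); rewrite ger0_norm.
Qed.

Let level K j := g @^-1` `[j.+1%:R / K%:R, +oo[%classic.

Let m_level K j : measurable (level K j).
Proof. by rewrite -[X in measurable X]setTI; exact: mg. Qed.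

(** The lift of [layers K \o g]: a simple function over internal sets, whose integral is known from
    the values of the Loeb measure on these. *)
Let L K (w : ultrapower) : R :=
  \sum_(j < K) K%:R^-1 * \1_(internal (fun=> level K j)) w.

Let cvg_L K w : layers K (g (w n)) @[n --> nat_ultra] --> L K w.
Proof.
under eq_fun do rewrite layersE.
apply: cvg_sumr => j; apply: cvgM; first exact: cvg_cst.
have [h|h] := pselect (internal (fun=> level K j) w).
  apply: cvg_near_cst; apply: filterS (h) => n h'.
  by rewrite !indicE !mem_set.
apply: cvg_near_cst; have := h; move/nat_ultraN; apply: filterS => n h'.
by rewrite !indicE !memNset.
Qed.

Let L_dist K w : `|loeb_lift w - L K.+1 w| <= K.+1%:R^-1.
Proof.
have h : `|g (w n) - layers K.+1 (g (w n))| @[n --> nat_ultra] -->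
    `|loeb_lift w - L K.+1 w|.
  by apply: cvg_norm; exact: (cvgB (@cvg_loeb_lift w) (@cvg_L K.+1 w)).
rewrite -(cvg_lim _ h)//; apply: limr_le; first by apply/cvg_ex; eexists; exact: h.
apply: filterE => n; have /andP[l1 l2] := @layers_bounds R K.+1 _ isT (g01 (w n)).
by rewrite ger0_norm ?subr_ge0// lerBlDl.
Qed.

Let mL K : measurable_fun setT (L K : loeb_space -> R).
Proof.
apply: measurable_sum => j; apply: measurable_funM => //.
by apply: measurable_indic; apply: sub_sigma_algebra; exists (fun=> level K j).
Qed.

Let ler_invS (K : nat) : K.+1%:R^-1 <= 1 :> R.
Proof. by rewrite invf_le1// ler1n. Qed.

Let lift01 w : 0 <= loeb_lift w <= 1.
Proof.
apply/andP; split; [apply: limr_ge|apply: limr_le];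
  do [exact: cvg_loeb_lift|by apply: filterE => n; have /andP[] := g01 (w n)].
Qed.

Lemma measurable_loeb_lift : measurable_fun setT (loeb_lift : loeb_space -> R).
Proof.
apply: (@measurable_fun_cvg _ _ _ _ (fun K => L K.+1 : loeb_space -> R)) => //.
move=> w _; apply/cvgrPdist_le => e e0; near=> K.
apply: le_trans (L_dist K w) _; near: K.
by apply: filterS (near_infty_natSinv_lt (PosNum e0)) => K /ltW.
Unshelve. all: by end_near. Qed.

(** For layers the identity is the definition of the Loeb measure on internal level sets. Replacing
    [g] by its layers with [K+1] levels moves either side by at most [1/(K+1)]. *)
Lemma Rintegral_loeb_lift :
  \int[loeb_measure]_w loeb_lift w = lim (\int[P n]_x g x @[n --> nat_ultra]).
Proof.
have intg n : 0 <= \int[P n]_x g x <= 1.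
  have ig : (P n).-integrable setT (EFin \o g).
    apply: (@bounded_integrable _ _ _ _ _ _ 1) => // x _.
    by have /andP[g0 g1] := g01 x; rewrite ger0_norm.
  apply/andP; split; first by apply: Rintegral_ge0 => x _; have /andP[] := g01 x.
  rewrite [leRHS](_ : _ = \int[P n]_x 1); last first.
    by rewrite Rintegral_cst// mul1r [X in fine X]probability_setT.
  apply: le_Rintegral => //; last by move=> x _; have /andP[] := g01 x.
  by apply: (@bounded_integrable _ _ _ _ _ _ 1) => // x _; rewrite normr1.
have cg : \int[P n]_x g x @[n --> nat_ultra] --> lim (\int[P n]_x g x @[n --> nat_ultra]).
  apply: (@is_cvg_ultra _ _ 1); apply: filterE => n.
  by have /andP[? ?] := intg n; rewrite ger0_norm.
have cL K : \int[P n]_x layers K (g x) @[n --> nat_ultra] -->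
    \int[loeb_measure]_w L K w.
  rewrite [X in _ --> X](_ : _ = \sum_(j < K) K%:R^-1 *
      fine (loeb_measure (internal (fun=> level K j)))); last first.
    apply: (@Rintegral_sum_indic _ _ _ loeb_measure K K%:R^-1
      (fun j => internal (fun=> level K j))) => j; apply: sub_sigma_algebra.
    by exists (fun=> level K j).
  have intL n : \int[P n]_x layers K (g x) =
      \sum_(j < K) K%:R^-1 * fine (P n (level K j)).
    under eq_Rintegral do rewrite layersE.
    exact: (@Rintegral_sum_indic _ _ _ (P n) K K%:R^-1 (level K)).
  under eq_fun do rewrite intL.
  apply: cvg_sumr => j; apply: cvgM; first exact: cvg_cst.
  by rewrite loeb_measureE//; exact: is_cvg_prob.
have eps K : `|\int[loeb_measure]_w loeb_lift w -
    lim (\int[P n]_x g x @[n --> nat_ultra])| <= 2 * K.+1%:R^-1.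
  rewrite -(subrKA (\int[loeb_measure]_w L K.+1 w)) (le_trans (ler_normD _ _))//.
  rewrite mulr_natl mulr2n lerD//.
    (* The bound 2 holds since [L K.+1] is within 1 of the lift, which takes values in [0,1]. *)
    apply: (@le_Rintegral_dist _ _ _ _ _ _ 2) => // [|w|w].
    - exact: measurable_loeb_lift.
    - by have /andP[? ?] := lift01 w; rewrite ger0_norm//; lra.
    - have := L_dist K w; have := ler_invS K; have /andP[] := lift01 w.
      move: (L K.+1 w) (loeb_lift w) (K.+1%:R^-1) => l y k y0 y1.
      by rewrite !ler_norml => Ki /andP[d1 d2]; apply/andP; split; lra.
  have h : `|\int[P n]_x layers K.+1 (g x) - \int[P n]_x g x| @[n --> nat_ultra] -->
      `|\int[loeb_measure]_w L K.+1 w - lim (\int[P n]_x g x @[n --> nat_ultra])|.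
    exact: (cvg_norm (cvgB (cL K.+1) cg)).
  rewrite -(cvg_lim _ h)//; apply: limr_le; first by apply/cvg_ex; eexists; exact: h.
  apply: filterE => n; apply: (@le_Rintegral_dist _ _ _ _ _ _ 1) => //.
  - rewrite (_ : (fun=> _) = (fun x => \sum_(j < K.+1) K.+1%:R^-1 * \1_(level K.+1 j) x)).
      by apply: measurable_sum => j; apply: measurable_funM.
    by apply/funext => x; exact: layersE.
  - move=> x; have /andP[l1 l2] := @layers_bounds R K.+1 _ isT (g01 x).
    have /andP[g0 g1] := g01 x; rewrite ger0_norm ?(le_trans l1)//.
    by apply: sumr_ge0 => j _; rewrite mulr_ge0.
  - by move=> x; have /andP[g0 g1] := g01 x; rewrite ger0_norm.
  - move=> x; have /andP[l1 l2] := @layers_bounds R K.+1 _ isT (g01 x).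
    by rewrite ler0_norm ?subr_le0// opprB lerBlDl.
apply/eqP; rewrite -subr_eq0 -normr_le0; apply/ler_addgt0Pr => e e0; rewrite add0r.
near \oo => K; apply: le_trans (eps K) _; rewrite -ler_pdivlMl//.
near: K; have e2 : 0 < 2^-1 * e by rewrite mulr_gt0.
by apply: filterS (near_infty_natSinv_lt (PosNum e2)) => K /ltW.
Unshelve. all: by end_near. Qed.

End expectation.
End loeb.

(** * Integrals of functions with bounded support *)

Lemma Rdominated_cvg_ae d (X : measurableType d) (R : realType)
    (mu : {measure set X -> \bar R}) (D : set X) (f_ : nat -> X -> R)
    (f g : X -> R) : measurable D ->
  (forall k, measurable_fun D (f_ k)) -> measurable_fun D f ->
  {ae mu, forall x, D x -> f_ k x @[k --> \oo] --> f x} ->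
  mu.-integrable D (EFin \o g) ->
  (forall k x, D x -> `|f_ k x| <= g x) ->
  \int[mu]_(x in D) f_ k x @[k --> \oo] --> \int[mu]_(x in D) f x.
Proof.
move=> mD mf_ mf ff ig fg.
have [| | | | |jf _ h] := @dominated_convergence _ _ _ mu _ mD (fun k => EFin \o f_ k)
  (EFin \o f) (EFin \o g).
- by move=> k; exact/measurable_EFinP.
- exact/measurable_EFinP.
- apply: filterS ff => x ffx Dx; apply: cvg_EFin; [exact: nearW|exact: ffx].
- exact: ig.
- by apply: aeW => x k Dx; rewrite lee_fin; exact: fg.
apply: fine_cvg; rewrite fineK; first exact: h.
exact: integrable_fin_num.
Qed.

Lemma Rdominated_cvg d (X : measurableType d) (R : realType)
    (mu : {measure set X -> \bar R}) (D : set X) (f_ : nat -> X -> R)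
    (f g : X -> R) : measurable D ->
  (forall k, measurable_fun D (f_ k)) ->
  (forall x, D x -> f_ k x @[k --> \oo] --> f x) ->
  mu.-integrable D (EFin \o g) ->
  (forall k x, D x -> `|f_ k x| <= g x) ->
  \int[mu]_(x in D) f_ k x @[k --> \oo] --> \int[mu]_(x in D) f x.
Proof.
move=> mD mf_ ff; apply: Rdominated_cvg_ae => //; last exact: aeW.
exact: (measurable_fun_cvg mf_).
Qed.

Section bounded_on.
Context d (X : measurableType d) (R : realType) (mu : {measure set X -> \bar R}).
Variables (D K : set X) (C : R).
Hypotheses (mD : measurable D) (mK : measurable K) (Kfin : (mu K < +oo)%E).

Definition bounded_on (f : X -> R) := [/\ measurable_fun D f,
  forall x, D x -> `|f x| <= C & forall x, D x -> ~ K x -> f x = 0].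

Lemma bounded_on_le f : bounded_on f -> forall x, D x -> `|f x| <= `|C| * \1_K x.
Proof.
move=> [_ fC fK] x Dx; rewrite indicE; have [Kx|nKx] := pselect (K x).
  by rewrite mem_set// mulr1 (le_trans (fC _ Dx))// ler_norm.
by rewrite fK// normr0 mulr_ge0.
Qed.

Lemma bounded_on_indic_integrable :
  mu.-integrable D (EFin \o (fun x => `|C| * \1_K x)).
Proof.
apply/integrableP; split.
  by apply/measurable_EFinP; apply: measurable_funM => //; exact: measurable_indic.
rewrite (eq_integral (fun x => (`|C|%:E * (\1_K x)%:E)%E)); last first.
  by move=> x _; rewrite /= ger0_norm// mulr_ge0// indicE.
rewrite ge0_integralZl//; last by apply/measurable_EFinP; exact: measurable_indic.
rewrite integral_indic// lte_mul_pinfty//.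
by apply: le_lt_trans Kfin; apply: le_measure; rewrite ?inE//; exact: measurableI.
Qed.

Lemma bounded_on_integrable f : bounded_on f -> mu.-integrable D (EFin \o f).
Proof.
move=> fB; have [mf _ _] := fB.
apply: le_integrable bounded_on_indic_integrable => //.
  exact/measurable_EFinP.
move=> x Dx; rewrite /= lee_fin [leRHS]ger0_norm; first exact: bounded_on_le.
by rewrite mulr_ge0// indicE.
Qed.

Lemma bounded_on_cvg (f_ : nat -> X -> R) (f : X -> R) :
  (forall k, bounded_on (f_ k)) -> measurable_fun D f ->
  {ae mu, forall x, D x -> f_ k x @[k --> \oo] --> f x} ->
  \int[mu]_(x in D) f_ k x @[k --> \oo] --> \int[mu]_(x in D) f x.
Proof.
move=> fB mf ff; apply: (Rdominated_cvg_ae mD) => //.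
- by move=> k; have [] := fB k.
- exact: bounded_on_indic_integrable.
- by move=> k x Dx; exact: (bounded_on_le (fB k)).
Qed.

End bounded_on.

Section bounded_support.
Variable R : realType.
Implicit Types (f g : R -> R) (C a : R).

(** Bound and support are explicit so that they can be shared by all terms of a sequence; values off
    [0,oo) are ignored. *)
Definition bounded_support C a f := [/\ measurable_fun (`[0, +oo[%classic : set R) f,
  forall s, 0 <= s -> `|f s| <= C & forall s, 0 <= s -> a < s -> f s = 0].

Lemma bounded_positive_compactP f : bounded_positive_compact f <->
  (exists C a, bounded_support C a f) /\ (forall s, 0 <= s -> 0 <= f s).
Proof.
split=> [[mf f0 [C fC] [a fa]]|[[C [a [mf fC fa]]] f0]].
  by split => //; exists C, a; split => // s s0; rewrite ger0_norm ?fC ?f0.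
split => //; last by exists a.
by exists C => s s0; rewrite (le_trans (ler_norm _))// fC.
Qed.

Lemma bounded_supportD C a C' a' f g : bounded_support C a f ->
  bounded_support C' a' g ->
  bounded_support (C + C') (Num.max a a') (fun s => f s + g s).
Proof.
move=> [mf fC fa] [mg gC ga]; split; first exact: measurable_funD.
  by move=> s s0; rewrite (le_trans (ler_normD _ _))// lerD ?fC ?gC.
by move=> s s0; rewrite gt_max => /andP[/fa-> // /ga-> //]; rewrite addr0.
Qed.

Lemma bounded_supportZ k C a f : bounded_support C a f ->
  bounded_support (`|k| * C) a (fun s => k * f s).
Proof.
move=> [mf fC fa]; split; first exact: measurable_funM.
  by move=> s s0; rewrite normrM ler_wpM2l ?fC.
by move=> s s0 /fa -> //; rewrite mulr0.
Qed.

Lemma bounded_supportN C a f : bounded_support C a f ->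
  bounded_support C a (fun s => - f s).
Proof.
move=> [mf fC fa]; split; first exact: measurableT_comp.
  by move=> s s0; rewrite normrN fC.
by move=> s s0 /fa -> //; rewrite oppr0.
Qed.

Lemma bounded_supportB C a C' a' f g : bounded_support C a f ->
  bounded_support C' a' g ->
  bounded_support (C + C') (Num.max a a') (fun s => f s - g s).
Proof. by move=> fS /bounded_supportN; exact: bounded_supportD. Qed.

Lemma bounded_support_le C a C' a' f : C <= C' -> a <= a' ->
  bounded_support C a f -> bounded_support C' a' f.
Proof.
move=> CC aa [mf fC fa]; split => // s s0; first exact: le_trans (fC _ s0) CC.
by move=> ?; apply: fa => //; exact: le_lt_trans aa _.
Qed.

Lemma bounded_support_norm C a f : bounded_support C a f ->
  bounded_support C a (fun s => `|f s|).
Proof.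
move=> [mf fC fa]; split; first exact: measurableT_comp.
  by move=> s s0; rewrite normr_id fC.
by move=> s s0 /fa -> //; rewrite normr0.
Qed.

Lemma bounded_support_cvg C a (f_ : nat -> R -> R) f :
  (forall k, bounded_support C a (f_ k)) ->
  (forall s, 0 <= s -> f_ k s @[k --> \oo] --> f s) -> bounded_support C a f.
Proof.
move=> fS ff; split.
- apply: (@measurable_fun_cvg _ _ _ _ f_); first by move=> k; have [] := fS k.
  by move=> s; rewrite /= in_itv/= andbT; exact: ff.
- move=> s s0; rewrite -(cvg_lim _ (cvg_norm (ff s s0)))//; apply: limr_le.
    by apply/cvg_ex; exists `|f s|; exact: (cvg_norm (ff s s0)).
  by apply: nearW => k; have [_ + _] := fS k; exact.
- move=> s s0 sa; rewrite -(cvg_lim _ (ff s s0))//.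
  rewrite (_ : (fun k => _) = fun=> 0) ?lim_cst//.
  by apply/funext => k; have [_ _] := fS k; exact.
Qed.

Lemma bounded_support_on (D : set R) C a f : D `<=` (`[0, +oo[%classic : set R) ->
  measurable D -> bounded_support C a f -> bounded_on D `[0, a]%classic C f.
Proof.
move=> D0 mD [mf fC fa]; split.
- exact: measurable_funS mf.
- by move=> s /D0; rewrite /= in_itv/= andbT; exact: fC.
- move=> s /D0; rewrite /= !in_itv/= andbT => s0; rewrite s0/= => /negP.
  by rewrite -ltNge; exact: fa.
Qed.

Lemma lebesgue_locally_finite a : (@lebesgue_measure R `[0%R, a]%classic < +oo)%E.
Proof. by rewrite /= lebesgue_measure_itv/=; case: ifP => _; rewrite ?ltry. Qed.

Lemma lebesgue_bounded_support_integrable (D : set R) C a f :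
  measurable D -> D `<=` (`[0, +oo[%classic : set R) -> bounded_support C a f ->
  (@lebesgue_measure R).-integrable D (EFin \o f).
Proof.
move=> mD D0 fS.
apply: (@bounded_on_integrable _ _ _ (@lebesgue_measure R) D `[0, a]%classic C) => //.
  exact: lebesgue_locally_finite.
exact: (bounded_support_on D0 mD fS).
Qed.

(** Convergence almost everywhere is what Skorokhod approximation gives, since it fails at the jumps
    of the limit path. *)
Lemma lebesgue_bounded_support_cvg (D : set R) C a (f_ : nat -> R -> R) f :
  measurable D -> D `<=` (`[0, +oo[%classic : set R) ->
  (forall k, bounded_support C a (f_ k)) -> measurable_fun D f ->
  {ae @lebesgue_measure R, forall s, D s -> f_ k s @[k --> \oo] --> f s} ->
  \int[@lebesgue_measure R]_(s in D) f_ k s @[k --> \oo] -->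
  \int[@lebesgue_measure R]_(s in D) f s.
Proof.
move=> mD D0 fS mf.
apply: (@bounded_on_cvg _ _ _ (@lebesgue_measure R) D `[0, a]%classic C) => //.
  exact: lebesgue_locally_finite.
by move=> k; exact: (bounded_support_on D0 mD (fS k)).
Qed.

End bounded_support.

Section pairing.
Variable R : realType.
Implicit Types (f g : R -> R) (C a : R) (nu : radon R).

Lemma pairing_integrable nu C a f : bounded_support C a f ->
  nu.-integrable (`[0, +oo[%classic : set R) (EFin \o f).
Proof.
move=> fS; apply: (@bounded_on_integrable _ _ _ nu _ `[0, a]%classic C) => //.
  exact: radon_compact.
exact: bounded_support_on.
Qed.

Lemma eq_pairing nu f g : (forall s, 0 <= s -> f s = g s) ->
  pairing nu f = pairing nu g.
Proof.
by move=> fg; apply: eq_Rintegral => s; rewrite inE/= in_itv/= andbT; exact: fg.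
Qed.

Lemma pairingD nu C a C' a' f g : bounded_support C a f ->
  bounded_support C' a' g ->
  pairing nu (fun s => f s + g s) = pairing nu f + pairing nu g.
Proof.
by move=> fS gS; rewrite /pairing RintegralD//;
  [exact: pairing_integrable fS|exact: pairing_integrable gS].
Qed.

Lemma pairingZ nu k C a f : bounded_support C a f ->
  pairing nu (fun s => k * f s) = k * pairing nu f.
Proof. by move=> fS; rewrite /pairing RintegralZl//; exact: pairing_integrable fS. Qed.

Lemma pairingB nu C a C' a' f g : bounded_support C a f ->
  bounded_support C' a' g ->
  pairing nu (fun s => f s - g s) = pairing nu f - pairing nu g.
Proof.
by move=> fS gS; rewrite /pairing RintegralB//;
  [exact: pairing_integrable fS|exact: pairing_integrable gS].
Qed.

Lemma pairing_ge0 nu f : (forall s, 0 <= s -> 0 <= f s) -> 0 <= pairing nu f.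
Proof.
by move=> f0; apply: Rintegral_ge0 => s; rewrite /= in_itv/= andbT; exact: f0.
Qed.

Lemma le_pairing nu C a C' a' f g : bounded_support C a f ->
  bounded_support C' a' g -> (forall s, 0 <= s -> f s <= g s) ->
  pairing nu f <= pairing nu g.
Proof.
move=> fS gS fg; apply: le_Rintegral => //; first exact: pairing_integrable fS.
  exact: pairing_integrable gS.
by move=> s; rewrite /= in_itv/= andbT; exact: fg.
Qed.

Lemma ler_norm_pairing nu C a f : bounded_support C a f ->
  `|pairing nu f| <= pairing nu (fun s => `|f s|).
Proof. by move=> fS; apply: le_normr_Rintegral => //; exact: pairing_integrable fS. Qed.

Lemma pairing_cvg nu C a (f_ : nat -> R -> R) f :
  (forall k, bounded_support C a (f_ k)) ->
  (forall s, 0 <= s -> f_ k s @[k --> \oo] --> f s) ->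
  pairing nu (f_ k) @[k --> \oo] --> pairing nu f.
Proof.
move=> fS ff; have [mf _ _] := bounded_support_cvg fS ff.
apply: (@bounded_on_cvg _ _ _ nu _ `[0, a]%classic C) => //.
- exact: radon_compact.
- by move=> k; exact: bounded_support_on.
- by apply: aeW => s; rewrite /= in_itv/= andbT; exact: ff.
Qed.

Lemma bounded_support_sum (I : Type) (r : seq I) (c : I -> R) (F : I -> R -> R) C a :
  (forall i, bounded_support C a (F i)) ->
  exists C', bounded_support C' a (fun s => \sum_(i <- r) c i * F i s).
Proof.
move=> FS; elim: r => [|i r [C' IH]].
  exists 0; rewrite (_ : (fun=> _) = fun=> 0) //.
    by split => // s _; rewrite normr0.
  by apply/funext => s; rewrite big_nil.
exists (`|c i| * C + C').
rewrite (_ : (fun=> _) = (fun s => c i * F i s + \sum_(j <- r) c j * F j s)).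
  by rewrite -[a]maxxx; apply: bounded_supportD => //; exact: bounded_supportZ.
by apply/funext => s; rewrite big_cons.
Qed.

Lemma pairing_sum nu (I : Type) (r : seq I) (c : I -> R) (F : I -> R -> R) C a :
  (forall i, bounded_support C a (F i)) ->
  pairing nu (fun s => \sum_(i <- r) c i * F i s) =
  \sum_(i <- r) c i * pairing nu (F i).
Proof.
move=> FS; elim: r => [|i r IH].
  rewrite big_nil (@eq_pairing _ _ (fun=> 0)); last by move=> s _; rewrite big_nil.
  by rewrite /pairing Rintegral_cst// mul0r.
rewrite big_cons -IH -(@pairingZ _ _ C a)//.
have [C' rS] := bounded_support_sum r c FS.
rewrite -(pairingD _ (bounded_supportZ (c i) (FS i)) rS).
by apply: eq_pairing => s _; rewrite big_cons.
Qed.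

(* Riemann sums along a partition of unity [F] with [F i] concentrated near [x i]. *)
Lemma pairing_partition nu (I : Type) (r : seq I) (x : I -> R) (F : I -> R -> R)
    C a f C' (e : R) (N : R) :
  bounded_support C a f ->
  (forall i, bounded_support C' N (F i)) ->
  (forall i s, 0 <= s -> 0 <= F i s) ->
  (forall s, 0 <= s <= a -> \sum_(i <- r) F i s = 1) ->
  (forall i s, 0 <= s -> F i s != 0 -> `|f s - f (x i)| <= e) ->
  `|pairing nu f - \sum_(i <- r) f (x i) * pairing nu (F i)| <=
  e * \sum_(i <- r) pairing nu (F i).
Proof.
move=> fS FS F0 F1 fF.
have [C2 sS] := bounded_support_sum r (f \o x) FS.
have [C3 tS] := bounded_support_sum r (fun=> e) FS.
rewrite -(pairing_sum _ _ (f \o x) FS) -(pairingB _ fS sS) mulr_sumr.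
rewrite -(pairing_sum _ _ (fun=> e) FS).
have dS := bounded_supportB fS sS.
rewrite (le_trans (ler_norm_pairing _ dS))//.
apply: (le_pairing _ (bounded_support_norm dS) tS) => s s0 /=.
have FfF i : `|f s - f (x i)| * F i s <= e * F i s.
  have [->|Fi] := eqVneq (F i s) 0; first by rewrite !mulr0.
  by rewrite ler_wpM2r ?F0 ?fF.
apply: (@le_trans _ _ (\sum_(i <- r) `|f s - f (x i)| * F i s)); last first.
  by apply: ler_sum => i _.
(* On [0,a] because the [F i] sum to 1 there, and beyond [a] because [f s] vanishes. *)
rewrite (_ : f s - _ = \sum_(i <- r) (f s - f (x i)) * F i s); last first.
  under [RHS]eq_bigr do rewrite mulrBl.
  rewrite sumrB -mulr_sumr; congr (_ - _).
  have [sa|sa] := leP s a; first by rewrite F1 ?s0// mulr1.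
  by have [_ _ fa] := fS; rewrite fa// mul0r.
apply: le_trans (ler_norm_sum _ _ _) _; apply: ler_sum => i _.
by rewrite normrM [X in _ * X]ger0_norm ?F0.
Qed.

Lemma bounded_support_indic (a : R) : bounded_support 1 a (\1_`[0, a]%classic : R -> R).
Proof.
split; first exact: measurable_indic.
  by move=> s _; rewrite indicE ger0_norm ?ler0n// lern1 leq_b1.
move=> s s0 sa; rewrite indicE memNset//= in_itv/= s0/=.
by apply/negP; rewrite -ltNge.
Qed.

(** Compactness of [0, a+1] gives a uniform modulus there, and beyond it [f] vanishes. *)
Lemma vague_test_unif f : vague_test f -> forall e : R, 0 < e ->
  exists2 d : R, 0 < d & forall s t, 0 <= s -> 0 <= t -> `|s - t| < d ->
    `|f s - f t| <= e.
Proof.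
move=> [cf [a fa]] e e0.
have : compact `[0, a + 1]%classic by exact: segment_compact.
move/compact_near_coveringP => /(_ R 0^'+ (fun d s => 0 <= s ->
  forall t, 0 <= t -> `|s - t| < d -> `|f s - f t| <= e)) [].
  move=> s; rewrite /= in_itv/= => /andP[s0 _].
  have /subspace_continuousP/(_ s) := cf.
  rewrite /= in_itv/= s0 => /(_ isT)/cvgrPdist_lt/(_ (e / 2)).
  rewrite divr_gt0// => /(_ isT); rewrite near_withinE => -[d /= d0 dP].
  exists (ball s (d / 2), [set d' | d' < d / 2]) => /=.
    split; first by apply: nbhsx_ballx; rewrite divr_gt0.
    by apply: nbhs_right_lt; rewrite divr_gt0.
  move=> [x d'] /= [sx dd] x0 t t0 xt.
  have fx : `|f s - f x| < e / 2.
    apply: dP; last by rewrite /= in_itv/= x0.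
    by apply: lt_trans sx _; rewrite ltr_pdivrMr// ltr_pMr// ltr1n.
  have ft : `|f s - f t| < e / 2.
    apply: dP; last by rewrite /= in_itv/= t0.
    rewrite /= (splitr d) -(subrKA x) (le_lt_trans (ler_normD _ _))// ltrD//.
    exact: lt_trans xt dd.
  rewrite (splitr e) -(subrKA (f s)) (le_trans (ler_normD _ _))// lerD//.
    by rewrite distrC ltW.
  exact: ltW.
move=> d0 /= d00 H.
(* The minimum with 1 handles [s > a + 1]: then [t > a] too, and both values are 0. *)
exists (Num.min (d0 / 2) 1) => [|s t s0 t0]; first by rewrite lt_min divr_gt0/=.
rewrite lt_min => /andP[st st1].
have [sa|sa] := leP s (a + 1); last first.
  have ta : a < t by move: st1; rewrite ltr_norml => /andP[? ?]; lra.
  have sa' : a < s by lra.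
  by rewrite (fa s)// (fa t)// subrr normr0 ltW.
apply: (H (d0 / 2)) => //=; rewrite ?in_itv/= ?s0// ?divr_gt0//.
by rewrite sub0r normrN gtr0_norm ?divr_gt0// ltr_pdivrMr// ltr_pMr// ltr1n.
Qed.

Lemma vague_test_bounded f : vague_test f -> exists C a, bounded_support C a f.
Proof.
move=> fV; have [cf [a fa]] := fV.
have mf : measurable_fun (`[0, +oo[%classic : set R) f.
  exact: subspace_continuous_measurable_fun.
have : compact (f @` `[0, `|a|]).
  apply: continuous_compact; last exact: segment_compact.
  by apply: continuous_subspaceW cf => s; rewrite /= !in_itv/= => /andP[->].
move/compact_bounded => [M [_ MP]].
exists (`|M| + 1), a; split => // s s0.
have [sa|sa] := leP s `|a|.
  apply: (MP (`|M| + 1)); first by rewrite (le_lt_trans (ler_norm _))// ltrDl.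
  by exists s => //=; rewrite in_itv/= s0.
by rewrite fa ?normr0 ?addr_ge0//; exact: le_lt_trans (ler_norm _) sa.
Qed.

End pairing.

(** * Borel sets for the vague topology *)

Section clamp.
Variable R : realType.

Definition clamp (x : R) : R := Num.max 0 (Num.min x 1).

Lemma clamp01 x : 0 <= clamp x <= 1.
Proof. by rewrite le_max lexx ge_max ler01 ge_min lexx orbT. Qed.

Lemma clamp_le0 x : x <= 0 -> clamp x = 0.
Proof. by move=> x0; rewrite /clamp; apply/max_idPl; rewrite ge_min x0. Qed.

Lemma clamp_ge1 x : 1 <= x -> clamp x = 1.
Proof. by move=> x1; rewrite /clamp (min_idPr _)// (max_idPr _). Qed.

Lemma le_clamp : {homo clamp : x y / x <= y}.
Proof.
move=> x y xy; rewrite /clamp ge_max !le_max lexx/=.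
by rewrite le_min !ge_min xy lexx !orbT.
Qed.

Lemma continuous_clamp : continuous clamp.
Proof.
move=> x.
have : {for x, continuous ((cst 0 : R -> R^o) \max ((id : R -> R^o) \min cst 1))}.
  apply: continuous_max; first exact: cst_continuous.
  by apply: continuous_min; [exact: cvg_id|exact: cst_continuous].
exact.
Qed.

(** Ramps of slope [k] starting at [x] and at [y]. A ramp is 0 at its starting point, so the limit
    is the indicator of an interval open on the left and closed on the right. *)
Lemma cvg_clamp_indic (x y : R) : x <= y -> forall s,
  clamp (k%:R * (s - x)) - clamp (k%:R * (s - y)) @[k --> \oo] -->
  (\1_(`]x, y]%classic) s : R).
Proof.
have large (d : R) : 0 < d -> \forall k \near \oo, 1 <= k%:R * d.
  move=> d0; near=> k; rewrite -ler_pdivrMr// mul1r.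
  by near: k; exact: nbhs_infty_ger.
have small (k : nat) (d : R) : d <= 0 -> clamp (k%:R * d) = 0.
  by move=> d0; rewrite clamp_le0// mulr_ge0_le0.
move=> xy s; apply: cvg_near_cst; rewrite indicE.
have [sx|xs] := leP s x.
  near=> k; rewrite !small ?subr_le0 ?subrr//; last exact: le_trans xy.
  by rewrite memNset//= in_itv/= ltNge sx.
have [sy|ys] := leP s y.
  near=> k; rewrite (small _ (s - y)) ?subr_le0// subr0 clamp_ge1; last first.
    by near: k; apply: large; rewrite subr_gt0.
  by rewrite mem_set//= in_itv/= xs.
near=> k; rewrite !clamp_ge1 ?subrr.
- by rewrite memNset//= in_itv/= (leNgt s) ys andbF.
- by near: k; apply: large; rewrite subr_gt0.
- by near: k; apply: large; rewrite subr_gt0.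
Unshelve. all: by end_near. Qed.

(** [C] is not supposed linear; the linear structure is that of the bounded continuous functions.
    Left-open intervals are the pi-system, their indicators being bounded limits of differences of
    ramps. *)
Lemma Borel_extension (C : set (R -> R)) : bounded_cvg_closed C ->
  (forall v : R -> R, continuous v -> (exists M : R, forall x, `|v x| <= M) -> C v) ->
  forall f : R -> R, measurable_fun setT f ->
    (exists M : R, forall x, `|f x| <= M) -> C f.
Proof.
move=> bC CV.
pose V : set (R -> R) := [set v : R -> R | continuous v /\ exists M : R, forall x, `|v x| <= M].
apply: (@bounded_cvg_closed_ext R _ _ (@ocitv R) V).
- exact: ocitvI.
- by [].
- move=> a f g [cf [M fM]] [cg [N gN]]; split.
    by move=> x; apply: cvgD; [apply: cvgM; [exact: cvg_cst|exact: cf]|exact: cg].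
  exists (`|a| * M + N) => x.
  by rewrite (le_trans (ler_normD _ _))// lerD// normrM ler_wpM2l.
- by split; [exact: cst_continuous|exists 1 => x; rewrite normr1].
- by move=> v [].
- move=> H bH VH _ [[x y] _ <-] /=.
  have [xy|yx] := leP x y; last first.
    rewrite set_itv_ge; last by rewrite bnd_simp -leNgt ltW.
    rewrite indic0; apply: VH; split; first exact: cst_continuous.
    by exists 0 => z; rewrite normr0.
  apply: (bH (fun k s => clamp (k%:R * (s - x)) - clamp (k%:R * (s - y))) _ 1).
  + move=> k; apply: VH.
    have B s : `|clamp (k%:R * (s - x)) - clamp (k%:R * (s - y))| <= 1.
      have /andP[a0 a1] := clamp01 (k%:R * (s - x)).
      have /andP[b0 b1] := clamp01 (k%:R * (s - y)).
      by rewrite ler_norml; apply/andP; split; lra.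
    split; last by exists 1.
    have cc (z : R) : continuous (fun s : R => clamp (k%:R * (s - z))).
      move=> s; apply: continuous_cvg; first exact: continuous_clamp.
      apply: cvgM; first exact: cvg_cst.
      by apply: cvgB; [exact: cvg_id|exact: cvg_cst].
    by move=> s; apply: cvgB; exact: cc.
  + move=> k s.
    have /andP[a0 a1] := clamp01 (k%:R * (s - x)).
    have /andP[b0 b1] := clamp01 (k%:R * (s - y)).
    by rewrite ler_norml; apply/andP; split; lra.
  + exact: cvg_clamp_indic.
- exact: bC.
- by move=> v [cv vM]; exact: CV.
Qed.

Definition cutoff (a s : R) : R := 1 - clamp (s - a).

Lemma cutoff01 a s : 0 <= cutoff a s <= 1.
Proof. by have /andP[? ?] := clamp01 (s - a); rewrite /cutoff subr_ge0 lerBlDr lerDl; apply/andP. Qed.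

Lemma cutoff1 a s : s <= a -> cutoff a s = 1.
Proof. by move=> sa; rewrite /cutoff clamp_le0 ?subr0// subr_le0. Qed.

Lemma cutoff0 a s : a + 1 <= s -> cutoff a s = 0.
Proof. by move=> sa; rewrite /cutoff clamp_ge1 ?subrr// lerBrDl. Qed.

Lemma continuous_cutoff a : continuous (cutoff a).
Proof.
move=> s; apply: cvgB; first exact: cvg_cst.
apply: continuous_cvg; first exact: continuous_clamp.
by apply: cvgB; [exact: cvg_id|exact: cvg_cst].
Qed.

Lemma vague_test_cutoff (v : R -> R) a : continuous v ->
  vague_test (fun s => v s * cutoff a s).
Proof.
move=> cv; split.
  by apply: continuous_subspaceT => s; apply: cvgM; [exact: cv|exact: continuous_cutoff].
by exists (a + 1) => s s0 /ltW sa; rewrite cutoff0 ?mulr0.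
Qed.

Lemma bounded_support_cutoff (f : R -> R) (C a : R) : measurable_fun setT f ->
  (forall s, `|f s| <= C) -> bounded_support C (a + 1) (fun s => f s * cutoff a s).
Proof.
move=> mf fC; split.
- apply: measurable_funTS; apply: measurable_funM => //.
  by apply: continuous_measurable_fun; exact: continuous_cutoff.
- move=> s _; have /andP[c0 c1] := cutoff01 a s.
  by rewrite normrM (ger0_norm c0) (le_trans _ (fC s))// ler_piMr.
- by move=> s _ /ltW sa; rewrite cutoff0 ?mulr0.
Qed.

End clamp.

(** * Tent functions and a countable base of the vague topology *)

Section hats.
Variable R : realType.

(** The piecewise linear tent of height 1 at [i/(k+1)] that vanishes at distance [1/(k+1)] from it;
    as a difference of two ramps it makes sums over [i] telescope. *)
Definition hat (k i : nat) (s : R) : R :=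
  clamp (s * k.+1%:R - i%:R + 1) - clamp (s * k.+1%:R - i%:R).

Lemma hat_ge0 k i s : 0 <= hat k i s.
Proof. by rewrite subr_ge0 le_clamp// lerDl. Qed.

Lemma hat_eq0 k i s : 1 <= `|s * k.+1%:R - i%:R| -> hat k i s = 0.
Proof.
rewrite /hat; set y := _ - _; have [y0|y0] := leP 0 y.
  by rewrite ger0_norm// => y1; rewrite (clamp_ge1 y1) clamp_ge1 ?subrr// lerDr.
rewrite ltr0_norm// => y1; have y1' : y + 1 <= 0 by lra.
by rewrite !clamp_le0 ?subr0// ltW.
Qed.

Lemma hat_support k i s : hat k i s != 0 -> `|s - i%:R / k.+1%:R| < k.+1%:R^-1.
Proof.
apply: contra_neqT; rewrite -leNgt => h; apply: hat_eq0.
rewrite -[i%:R](@divfK _ k.+1%:R) ?pnatr_eq0// -mulrBl normrM normr_nat.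
by rewrite -ler_pdivrMr ?ltr0n// div1r.
Qed.

Lemma sum_hatE k (M : nat) s :
  \sum_(0 <= i < M) hat k i s =
  clamp (s * k.+1%:R + 1) - clamp (s * k.+1%:R - M%:R + 1).
Proof.
rewrite (@telescope_sumr_eq _ 0 M (fun i => - clamp (s * k.+1%:R - i%:R + 1)))//.
  by rewrite opprK addrC subr0.
move=> i _; rewrite /hat opprK [RHS]addrC; congr (_ - clamp _).
by rewrite -natr1; lra.
Qed.

Lemma sum_hat k (M : nat) s : 0 <= s -> s * k.+1%:R <= M%:R ->
  \sum_(0 <= i < M.+1) hat k i s = 1.
Proof.
move=> s0 sM; rewrite sum_hatE clamp_ge1 ?clamp_le0 ?subr0//.
  by rewrite -natr1; lra.
by rewrite lerDr mulr_ge0.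
Qed.

Lemma continuous_hat k i : continuous (hat k i).
Proof.
have c (y : R) : continuous (fun s : R => clamp (s * k.+1%:R - i%:R + y)).
  move=> s; apply: continuous_cvg; first exact: continuous_clamp.
  apply: cvgD; last exact: cvg_cst.
  apply: cvgB; last exact: cvg_cst.
  by apply: cvgM; [exact: cvg_id|exact: cvg_cst].
rewrite (_ : hat k i = (fun s : R => clamp (s * k.+1%:R - i%:R + 1) -
  clamp (s * k.+1%:R - i%:R + 0))); last by apply/funext => s; rewrite addr0.
by move=> s; apply: cvgB; exact: c.
Qed.

Lemma bounded_support_hat k i (N : R) : (i.+1%:R <= N * k.+1%:R) ->
  bounded_support 1 N (hat k i).
Proof.
move=> iN; split.
- by apply: measurable_funTS; apply: continuous_measurable_fun; exact: continuous_hat.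
- move=> s _; rewrite ger0_norm ?hat_ge0//.
  have /andP[? ?] := clamp01 (s * k.+1%:R - i%:R).
  have /andP[? ?] := clamp01 (s * k.+1%:R - i%:R + 1).
  by rewrite /hat; lra.
- move=> s s0 Ns; apply: hat_eq0; rewrite ler_normr; apply/orP; left.
  rewrite lerBrDr addrC natr1 (le_trans iN)// ler_wpM2r// ltW//.
Qed.

Lemma vague_test_hat k i : vague_test (hat k i).
Proof.
split; first exact/continuous_subspaceT/continuous_hat.
exists (i.+1%:R) => s s0 si.
have [_ _] : bounded_support 1 i.+1%:R (hat k i); last exact.
by apply: bounded_support_hat; rewrite ler_peMr// ler1n.
Qed.

End hats.

Section vague_base.
Variable R : realType.
Implicit Types (nu : radon R) (f : R -> R).

(** An entry [(k, i, q, q')] bounds the pairing with [hat k i] by rationals, so there are countably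
    many boxes; [vague_boxP] shows that they form a base. *)
Definition vague_box (s : seq (nat * nat * rat * rat)) : set (radon R) :=
  [set nu | forall x, x \in s ->
    ratr x.1.2 < pairing nu (hat x.1.1.1 x.1.1.2) < ratr x.2].

Lemma vague_box_cat s t : vague_box (s ++ t) = vague_box s `&` vague_box t.
Proof.
apply/seteqP; split => [nu h|nu [hs ht] x].
  by split => x xs; apply: h; rewrite mem_cat xs ?orbT.
by rewrite mem_cat => /orP[/hs|/ht].
Qed.

Lemma vague_box_near nu0 k M (e : R) : 0 < e -> exists2 s, vague_box s nu0 &
  forall nu, vague_box s nu -> forall i, (i < M)%N ->
    `|pairing nu (hat k i) - pairing nu0 (hat k i)| < e.
Proof.
move=> e0; elim: M => [|M [s s0 sP]]; first by exists [::].
have lt1 : pairing nu0 (hat k M) - e < pairing nu0 (hat k M) by rewrite ltrBlDr ltrDl.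
have lt2 : pairing nu0 (hat k M) < pairing nu0 (hat k M) + e by rewrite ltrDl.
have [q] := rat_in_itvoo lt1; rewrite in_itv/= => /andP[q1 q2].
have [q'] := rat_in_itvoo lt2; rewrite in_itv/= => /andP[q1' q2'].
exists ((k, M, q, q') :: s).
  by move=> x; rewrite inE => /predU1P[->/=|]; [rewrite q2|exact: s0].
move=> nu h i; rewrite ltnS leq_eqVlt => /predU1P[->|iM].
  have /= := h (k, M, q, q') (mem_head _ _) => /andP[h1 h2].
  by rewrite ltr_norml; apply/andP; split; lra.
by apply: sP => // x xs; apply: h; rewrite inE xs orbT.
Qed.

(** On a fine mesh [f] is uniformly close to a combination of finitely many tents, so [nu] pairs
    with [f] almost as [nu0] does once it is close to [nu0] on these tents. The two approximation
    errors and the difference of the Riemann sums amount to at most [e/2]. *)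
Lemma vague_box_test nu0 f (e : R) : vague_test f -> 0 < e ->
  exists2 s, vague_box s nu0 &
    forall nu, vague_box s nu -> `|pairing nu f - pairing nu0 f| < e.
Proof.
move=> fV e0; have [C [a0 fS0]] := vague_test_bounded fV.
pose a : R := `|a0|.
have fS : bounded_support `|C| a f.
  by apply: bounded_support_le fS0; exact: ler_norm.
(* All tents used below live in [0, a+2], so that [S] bounds the sum of their pairings with
   [nu0]. *)
pose S : R := pairing nu0 (\1_`[0, a + 2]%classic : R -> R).
have S0 : 0 <= S by apply: pairing_ge0 => s _; rewrite indicE.
(* The tents have total pairing at most [S] with [nu0] and at most [S + 1] with [nu], whence
   [2 S + 1]. *)
have w0 : 0 < e / 4 / (2 * S + 1) by rewrite divr_gt0// ?divr_gt0//; lra.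
have [d d0 dP] := vague_test_unif fV w0.
have [k kd] : exists k, k.+1%:R^-1 < d.
  have [k _ /(_ k (leqnn k))] := near_infty_natSinv_lt (PosNum d0).
  by exists k.
pose M := (Num.truncn (a * k.+1%:R)).+1.
have k0 : 0 < k.+1%:R :> R by rewrite ltr0n.
have aM : a * k.+1%:R < M%:R.
  by rewrite /M truncnS_gt.
have Ma : M%:R <= a * k.+1%:R + 1.
  by rewrite /M -natr1 lerD2r truncn_le// mulr_ge0// /a.
(* Capping the index by [M] gives one support bound for all natural [i]. *)
have HS i : bounded_support 1 (a + 2) (hat k (minn i M) : R -> R).
  apply: bounded_support_hat; apply: (@le_trans _ _ M.+1%:R).
    by rewrite ler_nat ltnS geq_minr.
  rewrite -natr1 mulrDl; have : 1 <= k.+1%:R :> R by rewrite ler1n.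
  by move: Ma; lra.
(* The first entry keeps the sum of the [M+1] pairings with [nu] below [S + 1]; the second keeps the
   Riemann sums of [nu] and [nu0] within [e/4]. *)
pose d' := Num.min (M.+1%:R^-1) (e / 4 / (M.+1%:R * (`|C| + 1))).
have MC0 : 0 < M.+1%:R * (`|C| + 1) by rewrite mulr_gt0// ltr_wpDl.
have d'0 : 0 < d' by rewrite lt_min invr_gt0 ltr0n/= !divr_gt0.
have [s s0 sP] := vague_box_near nu0 k M.+1 d'0.
exists s => // nu snu.
have {sP}sP i : `|pairing nu (hat k (minn i M)) -
    pairing nu0 (hat k (minn i M))| < d'.
  by apply: sP => //; rewrite ltnS geq_minr.
pose F (i : nat) : R -> R := hat k (minn i M).
have part (nu' : radon R) : `|pairing nu' f - \sum_(i < M.+1) f (i%:R / k.+1%:R) * pairing nu' (F i)|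
    <= e / 4 / (2 * S + 1) * \sum_(i < M.+1) pairing nu' (F i).
  apply: (@pairing_partition _ _ _ _ (fun i : 'I_M.+1 => i%:R / k.+1%:R)
    (fun i : 'I_M.+1 => F i) `|C| a f 1 _ (a + 2)) => //.
  - by move=> i; exact: HS.
  - by move=> i t _; exact: hat_ge0.
  - move=> t /andP[t0 ta].
    rewrite -(@sum_hat _ k M t)//; last first.
      by rewrite (le_trans _ (ltW aM))// ler_wpM2r.
    rewrite big_mkord; apply: eq_bigr => i _.
    by rewrite /F (minn_idPl _)// -ltnS.
  - move=> i t t0; rewrite /F (minn_idPl _) -1?ltnS// => /hat_support h.
    by apply: dP; rewrite ?divr_ge0//; exact: lt_trans h kd.
have sumS : \sum_(i < M.+1) pairing nu0 (F i) <= S.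
  rewrite (_ : \sum_(i < M.+1) _ = pairing nu0 (fun s => \sum_(i < M.+1) 1 * F i s)).
    have [C' SS] := bounded_support_sum (index_enum 'I_M.+1) (fun=> 1)
      (fun i : 'I_M.+1 => HS i).
    apply: (le_pairing _ SS (bounded_support_indic (a + 2))) => t t0.
    have [ta|ta] := leP t (a + 2); last first.
      by have [_ _ ->//] := SS; rewrite indicE.
    rewrite indicE mem_set ?mulr1/= ?in_itv/= ?t0//.
    apply: (@le_trans _ _ (\sum_(0 <= i < M.+1) hat k i t)).
      rewrite big_mkord; apply: ler_sum => i _.
      by rewrite /F (minn_idPl _) ?mul1r// -ltnS.
    rewrite sum_hatE.
    have /andP[? _] := clamp01 (t * k.+1%:R - M.+1%:R + 1).
    have /andP[_ ?] := clamp01 (t * k.+1%:R + 1).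
    by lra.
  rewrite (pairing_sum nu0 (index_enum 'I_M.+1) (fun=> 1) (fun i : 'I_M.+1 => HS i)).
  by apply: eq_bigr => i _; rewrite mul1r.
have sumS' : \sum_(i < M.+1) pairing nu (F i) <= S + 1.
  apply: (@le_trans _ _ (\sum_(i < M.+1) (pairing nu0 (F i) + M.+1%:R^-1))).
    apply: ler_sum => i _; rewrite -lerBlDl ltW// (le_lt_trans (ler_norm _))//.
    by apply: lt_le_trans (sP i) _; rewrite ge_min lexx.
  rewrite big_split/= lerD//= sumr_const card_ord -[_ *+ _]mulr_natr mulVf ?pnatr_eq0//.
have diff : `|\sum_(i < M.+1) f (i%:R / k.+1%:R) * pairing nu (F i) -
    \sum_(i < M.+1) f (i%:R / k.+1%:R) * pairing nu0 (F i)| <= e / 4.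
  rewrite -sumrB (le_trans (ler_norm_sum _ _ _))//.
  apply: (@le_trans _ _ (\sum_(i < M.+1) (`|C| + 1) * (e / 4 / (M.+1%:R * (`|C| + 1))))).
    apply: ler_sum => i _; rewrite -mulrBr normrM ler_pM//.
      have [_ fC _] := fS; rewrite (le_trans (fC _ _)) ?divr_ge0// lerDl//.
    by apply/ltW/(lt_le_trans (sP i)); rewrite ge_min lexx orbT.
  rewrite sumr_const card_ord -[_ *+ _]mulr_natr le_eqVlt; apply/orP; left.
  by apply/eqP; field; rewrite nat1r pnatr_eq0/= gt_eqF// ltr_wpDl.
have := part nu; have := part nu0.
set A := \sum_(i < M.+1) _ in diff *; set B := \sum_(i < M.+1) _ in diff *.
move=> h0 h.
have h0' : `|pairing nu0 f - B| <= e / 4 / (2 * S + 1) * S.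
  by apply: le_trans h0 _; rewrite ler_wpM2l// ltW.
have h' : `|pairing nu f - A| <= e / 4 / (2 * S + 1) * (S + 1).
  by apply: le_trans h _; rewrite ler_wpM2l// ltW.
have wS : e / 4 / (2 * S + 1) * S + e / 4 / (2 * S + 1) * (S + 1) = e / 4.
  by field; lra.
move: h0' h' diff; rewrite !ler_norml ltr_norml => /andP[? ?] /andP[? ?] /andP[? ?].
by apply/andP; split; lra.
Qed.

(** The sets containing a box around [nu] form a filter, so it is enough that subbasic
    neighbourhoods belong to it, and this is [vague_box_test]. *)
Lemma vague_boxP (U : set (radon R)) nu : open U -> U nu ->
  exists2 s, vague_box s nu & vague_box s `<=` U.
Proof.
move=> [D' D'P <-] [A D'A Anu].
have [E EP AE] := D'P _ D'A.
pose F := [set B : set (radon R) | exists2 s, vague_box s nu & vague_box s `<=` B].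
have FF : Filter F.
  split.
  - by exists [::].
  - move=> B B' [s s0 sB] [s' s0' sB']; exists (s ++ s'); rewrite vague_box_cat.
      by split.
    by move=> nu' [/sB ? /sB' ?].
  - by move=> B B' BB' [s s0 sB]; exists s => // nu' /sB/BB'.
suff [s s0 sA] : F A by exists s => // nu' /sA AA; exists A.
rewrite -AE; apply: filter_bigI => i iE.
have bnu : isSubBaseTopological.b i nu by rewrite -AE in Anu; exact: Anu.
have /set_mem := EP _ iE; case: i bnu {iE} => f V /= fnu [fV oV].
have /nbhs_ballP[e /= e0 eV] : nbhs (pairing nu f) V by exact: open_nbhs_nbhs.
have [s s0 sP] := vague_box_test nu fV e0.
by exists s => // nu' /sP h; apply: eV; rewrite /ball/= distrC.
Qed.

End vague_base.

Section measurable_pairing.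
Variable R : realType.

Lemma measurable_pairing_test (f : R -> R) : vague_test f ->
  measurable_fun setT (fun nu : radon R => pairing nu f).
Proof.
move=> fV; apply: (measurability _ (RGenOpens.measurableE R)).
move=> _ [_ [x [y ->]] <-]; rewrite setTI; apply: sub_sigma_algebra.
exists [set (fun nu : radon R => pairing nu f) @^-1` `]x, y[%classic]; last by rewrite bigcup_set1.
move=> _ ->; pose D := [set fU : (R -> R) * set R | vague_test fU.1 /\ open fU.2].
apply: (@finI_from1 _ _ D (fun fU => (fun nu : radon R => pairing nu fU.1) @^-1` fU.2) (f, `]x, y[%classic)).
by split => //=; exact: interval_open.
Qed.

Lemma measurable_pairing (f : R -> R) C a : bounded_support C a f ->
  measurable_fun setT (fun nu : radon R => pairing nu f).
Proof.
(* [f] is known to be measurable on [0,oo) only. Extending it constantly to the left and multiplying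
   by a fixed cutoff brings it into the scope of [Borel_extension]. *)
move=> [mf fC fa]; pose g s := f (Num.max s 0).
have mg : measurable_fun setT g.
  apply: (@measurable_comp _ _ _ _ _ _ (`[0, +oo[%classic : set R)) => //.
    by move=> _ [s _ <-]; rewrite /= in_itv/= le_max lexx orbT.
  exact: measurable_maxr.
have gC s : `|g s| <= C by apply: fC; rewrite le_max lexx orbT.
have -> : (fun nu : radon R => pairing nu f) =
    (fun nu => pairing nu (fun s => g s * cutoff a s)).
  apply/funext => nu; apply: eq_pairing => s s0; rewrite /g (max_idPl s0).
  by have [sa|sa] := leP s a; [rewrite cutoff1 ?mulr1|rewrite fa ?mul0r].
suff [] : measurable_fun setT g /\ measurable_fun setT
  (fun nu : radon R => pairing nu (fun s => g s * cutoff a s)) by [].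
(* Measurability of [g] is kept in the class because dominated convergence of the pairings asks for
   it. *)
apply: (Borel_extension (C := [set g : R -> R | measurable_fun setT g /\
  measurable_fun setT (fun nu : radon R => pairing nu (fun s => g s * cutoff a s))])) => //.
- move=> f_ f0 M mf_ fM ff; split.
    apply: (measurable_fun_cvg (fun k => (mf_ k).1)) => // x _; exact: ff.
  apply: (measurable_fun_cvg (fun k => (mf_ k).2)) => // nu _.
  apply: (@pairing_cvg _ _ M (a + 1)) => [k|s s0].
    by apply: bounded_support_cutoff; [exact: (mf_ k).1|exact: fM].
  by apply: cvgM; [exact: ff|exact: cvg_cst].
- move=> v cv _; split; first exact: continuous_measurable_fun.
  by apply: measurable_pairing_test; apply: vague_test_cutoff.
- by exists C.
Qed.

End measurable_pairing.

(** * A monotone class theorem based on Laplace exponentials *)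

Section laplace_class.
Variable R : realType.
Implicit Types (nu : radon R).

Lemma bounded_positive_compact_test (f : R -> R) : vague_test f ->
  (forall s, 0 <= s -> 0 <= f s) -> bounded_positive_compact f.
Proof.
by move=> fV f0; apply/bounded_positive_compactP; split=> //; exact: vague_test_bounded.
Qed.

Definition pairing_gt (s : seq ((R -> R) * R)) : set (radon R) :=
  [set nu | forall x, List.In x s -> x.2 < pairing nu x.1].

Definition pairing_cylinders : set (set (radon R)) :=
  [set pairing_gt s | s in
    [set s | forall x, List.In x s -> bounded_positive_compact x.1]].

Lemma pairing_cylindersI : setI_closed pairing_cylinders.
Proof.
move=> _ _ [s sP <-] [t tP <-]; exists (s ++ t) => /=.
  by move=> x xst; have [/sP|/tP] := List.in_app_or _ _ _ xst.
apply/seteqP; split => [nu h|nu [hs ht] x].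
  by split => x xs; apply: h; apply: List.in_or_app; [left|right].
by move=> xst; have [/hs|/ht] := List.in_app_or _ _ _ xst.
Qed.

(** An open set is a countable union of boxes, a box is cut out by finitely many strict
    inequalities, and an upper bound on a pairing is a countable union of complements of lower
    bounds. *)
Lemma sub_pairing_cylinders :
  @measurable _ (radon R) `<=` <<s pairing_cylinders >>.
Proof.
pose Y := g_sigma_algebraType pairing_cylinders.
have gtP k i (r : R) : measurable ([set nu | r < pairing nu (hat k i)] : set Y).
  apply: sub_sigma_algebra; exists [:: (hat k i, r)] => /=.
    move=> x [<-|//]; apply: bounded_positive_compact_test; first exact: vague_test_hat.
    by move=> s _; exact: hat_ge0.
  apply/seteqP; split => [nu h|nu /= ? x [<-|]//].
  exact: (h (hat k i, r) (or_introl erefl)).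
have geC k i (r : R) : measurable ([set nu | pairing nu (hat k i) <= r] : set Y).
  rewrite (_ : mkset _ = ~` [set nu | r < pairing nu (hat k i)]).
    exact: measurableC.
  by apply/seteqP; split => nu /=; rewrite leNgt => // /negP.
have ltP k i (r : R) : measurable ([set nu | pairing nu (hat k i) < r] : set Y).
  rewrite (_ : mkset _ = \bigcup_n [set nu | pairing nu (hat k i) <= r - n.+1%:R^-1]).
    by apply: bigcupT_measurable => n; exact: geC.
  apply/seteqP; split => [nu /= nur|nu /= [n _ nur]]; last first.
    by apply: le_lt_trans nur _; rewrite ltrBlDr ltrDl invr_gt0 ltr0n.
  have rnu : 0 < r - pairing nu (hat k i) by rewrite subr_gt0.
  have [n _ /(_ n (leqnn n))/= nP] := near_infty_natSinv_lt (PosNum rnu).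
  by exists n => //=; rewrite lerBrDl -lerBrDr ltW.
have boxP s : measurable (vague_box s : set Y).
  elim: s => [|[[[k i] q] q'] s IH].
    rewrite (_ : vague_box _ = setT); first exact: measurableT.
    by apply/seteqP; split.
  rewrite (_ : vague_box _ = ([set nu | ratr q < pairing nu (hat k i)] `&`
      [set nu | pairing nu (hat k i) < ratr q']) `&` vague_box s).
    by apply: measurableI => //; exact: measurableI.
  apply/seteqP; split => [nu h|nu [[h1 h2] h] x].
    split; last by move=> x xs; apply: h; rewrite inE xs orbT.
    by have /andP := h (k, i, q, q') (mem_head _ _).
  by rewrite inE => /predU1P[->/=|/h//]; apply/andP.
apply: smallest_sub; first exact: smallest_sigma_algebra.
move=> U oU.
rewrite (_ : U = \bigcup_(s in [set s | vague_box s `<=` U]) vague_box s).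
  rewrite bigcup_mkcond.
  apply: (@countable_bigcupT_measurable _ Y) => [|s]; first exact: countableP.
  by case: ifP => // _; exact: boxP.
apply/seteqP; split => [nu Unu|nu [s sU /sU//]].
by have [s s0 sU] := vague_boxP oU Unu; exists s.
Qed.

(** The exponent is [- n e^{n(r - y)}]. The factor [n] settles the case [y = r], where the limit
    would otherwise be [e^{-1}] instead of 0. *)
Lemma cvg_expR_threshold (r y : R) :
  expR (- (n%:R * expR (n%:R * r) * expR (- (n%:R * y)))) @[n --> \oo] -->
  ((r < y)%R%:R : R).
Proof.
have E (n : nat) : n%:R * expR (n%:R * r) * expR (- (n%:R * y)) =
    n%:R * expR (n%:R * (r - y)).
  by rewrite -mulrA -expRD -mulrBr.
under eq_fun do rewrite E.
have [ry|yr] := ltP r y.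
  have -> : true%:R = expR (- 0) :> R by rewrite oppr0 expR0.
  apply: continuous_cvg; first exact: continuous_expR.
  apply: cvgN.
  have d0 : 0 < y - r by rewrite subr_gt0.
  apply: (@squeeze_cvgr _ _ _ _ (fun=> 0) (fun n => 4 / (y - r) ^+ 2 * n%:R^-1)).
  - near=> n; rewrite mulr_ge0 ?expR_ge0//=.
    have n0 : 0 < n%:R :> R by rewrite ltr0n; near: n; exact: nbhs_infty_gt.
    (* From [e^{x/2} >= 1 + x/2 >= x/2]; it beats the factor [n]. *)
    have h : (n%:R * (y - r) / 2) ^+ 2 <= expR (n%:R * (y - r)).
      have a0 : 0 <= n%:R * (y - r) / 2 by rewrite divr_ge0// mulr_ge0// ltW.
      rewrite {2}(splitr (n%:R * (y - r))) expRD -expr2.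
      rewrite ler_pXn2r ?nnegrE ?expR_ge0//.
      by apply: le_trans (expR_ge1Dx _); rewrite lerDr.
    rewrite -[r - y]opprB mulrN expRN ler_pdivrMr ?expR_gt0//.
    apply: le_trans (ler_wpM2l _ h); last by rewrite mulr_ge0 ?divr_ge0 ?sqr_ge0 ?invr_ge0 ?ltW.
    rewrite le_eqVlt; apply/orP; left; apply/eqP; field.
    by rewrite !gt_eqF.
  - exact: cvg_cst.
  - rewrite -[X in _ --> X](mulr0 (4 / (y - r) ^+ 2)); apply: cvgM; first exact: cvg_cst.
    by apply/gtr0_cvgV0; [near=> n; rewrite ltr0n; near: n; exact: nbhs_infty_gt|exact: cvgr_idn].
apply: (@squeeze_cvgr _ _ _ _ (fun=> 0) (fun n => expR (- n%:R))).
- near=> n; rewrite expR_ge0/= ler_expR lerN2 ler_peMr// -expR0 ler_expR.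
  by rewrite mulr_ge0// subr_ge0.
- exact: cvg_cst.
- exact: cvgn_expR.
Unshelve. all: by end_near. Qed.

(** [H] is not closed under products, yet indicators of [pairing_gt] are products. They are bounded
    limits of [exp(-c e^{-n <nu,f>})], whose power series consists of exponentials
    [e^{-n j <nu,f>}]; multiplied by [e^{-<nu,g>}] each of these is again a Laplace exponential,
    that of [g + n j f]. *)
Lemma radon_monotone_class (H : set (radon R -> R)) :
  linear_closed H -> bounded_cvg_closed H ->
  (forall f, bounded_positive_compact f -> H (fun nu => expR (- pairing nu f))) ->
  forall g : radon R -> R, measurable_fun setT g ->
    (exists M : R, forall nu, `|g nu| <= M) -> H g.
Proof.
move=> lH bH HL.
have bpc0 : bounded_positive_compact (fun=> 0 : R).
  by split => //; first (by exists 0); exists 0.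
have pairing0 (nu : radon R) : pairing nu (fun=> 0) = 0.
  by rewrite /pairing Rintegral_cst// mul0r.
have H1 : H (fun=> 1).
  rewrite (_ : (fun=> 1) = (fun nu : radon R => expR (- pairing nu (fun=> 0)))).
    exact: HL.
  by apply/funext => nu; rewrite pairing0 oppr0 expR0.
apply: (@monotone_class R _ _ pairing_cylinders) => //.
- exact: pairing_cylindersI.
- exact: sub_pairing_cylinders.
move=> _ [s /= sP <-].
(* The factor [e^{-<nu,g>}] is what the induction on the list needs, to absorb the exponentials from
   its head; [g = 0] gives the indicator itself. *)
suff /(_ _ bpc0) : forall g, bounded_positive_compact g ->
    H (fun nu => \1_(pairing_gt s) nu * expR (- pairing nu g)).
  rewrite (_ : (fun nu => _) = \1_(pairing_gt s))//.
  by apply/funext => nu; rewrite pairing0 oppr0 expR0 mulr1.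
elim: s sP => [_ g gP|[f r] s IH sP g gP].
  rewrite (_ : (fun nu => _) = (fun nu => expR (- pairing nu g))); first exact: HL.
  apply/funext => nu; rewrite indicE mem_set ?mul1r//.
have {}IH := IH (fun x xs => sP x (or_intror xs)).
have fP : bounded_positive_compact f := sP (f, r) (or_introl erefl).
pose Z (nu : radon R) : R := \1_(pairing_gt s) nu.
have ZE nu : 0 <= Z nu * expR (- pairing nu g) <= 1.
  rewrite mulr_ge0 ?expR_ge0 ?indicE//= -[leRHS]mulr1 ler_pM ?expR_ge0//.
    by rewrite lern1 leq_b1.
  rewrite -expR0 ler_expR oppr_le0; apply: pairing_ge0; by case: gP.
have pE nu n j : pairing nu (fun t => g t + (n * j)%:R * f t) =
    pairing nu g + (n * j)%:R * pairing nu f.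
  have [[[C [a gS]] _] [[C' [a' fS]] _]] :=
    ((bounded_positive_compactP _).1 gP, (bounded_positive_compactP _).1 fP).
  by rewrite (pairingD _ gS (bounded_supportZ _ fS)) (pairingZ _ _ fS).
have bpcD (n j : nat) : bounded_positive_compact (fun t => g t + (n * j)%:R * f t).
  have [[[C [a gS]] g0] [[C' [a' fS]] f0]] :=
    ((bounded_positive_compactP _).1 gP, (bounded_positive_compactP _).1 fP).
  apply/bounded_positive_compactP; split; last first.
    by move=> t t0; rewrite addr_ge0 ?mulr_ge0 ?g0 ?f0.
  exists (C + `|(n * j)%:R| * C'), (Num.max a a').
  exact: (bounded_supportD gS (bounded_supportZ _ fS)).
(* The partial sums of the series at [-c e^{-n <nu,f>}] are bounded, uniformly in [nu], by those at
   [c]. *)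
have step (c : R) (n : nat) : 0 <= c -> H (fun nu =>
    expR (- (c * expR (- (n%:R * pairing nu f)))) * (Z nu * expR (- pairing nu g))).
  move=> c0.
  have [M MP] : exists M : R, forall k, \sum_(0 <= j < k) c ^+ j / j`!%:R <= M.
    have /cvg_seq_bounded[M [_ MP]] := is_cvg_series_exp_coeff c.
    exists (M + 1) => k; apply: le_trans (ler_norm _) _.
    by apply: (MP (M + 1)) => //; rewrite ltrDl.
  apply: (bH (fun k nu => \sum_(0 <= j < k) (- c) ^+ j / j`!%:R *
      (Z nu * expR (- pairing nu (fun t => g t + (n * j)%:R * f t)))) _ M).
  - by move=> k; apply: linear_closed_sum => // j; exact: IH.
  - move=> k nu; apply: le_trans (ler_norm_sum _ _ _) _; apply: le_trans (MP k).
    apply: ler_sum => j _; rewrite normrM -[leRHS]mulr1; apply: ler_pM => //.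
      by rewrite normrM normrX normrN (ger0_norm c0) ger0_norm.
    rewrite pE ger0_norm ?mulr_ge0 ?expR_ge0 ?indicE//.
    have /andP[_] := ZE nu; apply: le_trans; rewrite ler_wpM2l ?indicE//.
    by rewrite ler_expR lerN2 lerDl mulr_ge0//; apply: pairing_ge0; case: fP.
  - move=> nu.
    rewrite (_ : (fun k => _) = (fun k => series (exp_coeff
      (- (c * expR (- (n%:R * pairing nu f))))) k * (Z nu * expR (- pairing nu g)))).
      apply: cvgM; last exact: cvg_cst.
      exact: is_cvg_series_exp_coeff.
    apply/funext => k; rewrite /series/= mulr_suml; apply: eq_bigr => j _.
    set X := expR (- (n%:R * _)).
    have -> : expR (- pairing nu (fun t => g t + (n * j)%:R * f t)) =
        X ^+ j * expR (- pairing nu g).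
      rewrite pE addrC opprD expRD /X -expRM_natl; congr (expR _ * _).
      by rewrite natrM; ring.
    rewrite /exp_coeff/= -(mulNr c) exprMn; ring.
rewrite (_ : (fun nu => _) = (fun nu => (r < pairing nu f)%R%:R *
    (Z nu * expR (- pairing nu g)))); last first.
  apply/funext => nu; rewrite mulrA /Z !indicE; congr (_ * _).
  rewrite -natrM mulnb; congr ((nat_of_bool _)%:R); apply/idP/andP.
    move/set_mem => h; split; first exact: (h (f, r) (or_introl erefl)).
    by apply/mem_set => x xs; apply: h; right.
  by move=> [h1 /set_mem h2]; apply/mem_set => x [<-//|]; exact: h2.
apply: (bH (fun n nu => expR (- (n%:R * expR (n%:R * r) *
    expR (- (n%:R * pairing nu f)))) * (Z nu * expR (- pairing nu g))) _ 1).
- by move=> n; apply: step; rewrite mulr_ge0 ?expR_ge0.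
- move=> n nu; have /andP[Z0 Z1] := ZE nu.
  rewrite ger0_norm ?mulr_ge0 ?expR_ge0// -[leRHS]mulr1 ler_pM ?expR_ge0//.
- by move=> nu; apply: cvgM; [exact: cvg_expR_threshold|exact: cvg_cst].
Qed.

End laplace_class.

(** * Paths as Radon measures *)

Section path.
Variable R : realType.
Implicit Types (w : cadlag R) (f : R -> R).

Lemma path_nneg w s : 0 <= w s.
Proof. by have [/path_ge0//|/path_lt0->] := leP 0 s. Qed.

Lemma path_norm_bounded w (a : R) : exists2 C, 0 <= C & forall s, s <= a -> `|w s| <= C.
Proof.
have [C wC] := path_bounded w a; exists `|C| => // s sa.
by rewrite ger0_norm ?path_nneg// (le_trans (wC _ sa))// ler_norm.
Qed.

Lemma bounded_support_path w C a f : bounded_support C a f ->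
  exists C', bounded_support C' a (fun s => f s * w s).
Proof.
move=> [mf fC fa]; have [D D0 wD] := path_norm_bounded w a.
exists (`|C| * D); split.
- by apply: measurable_funM => //; apply: measurable_funTS; exact: measurable_path.
- move=> s s0; have [sa|sa] := leP s a; last by rewrite fa// mul0r normr0 mulr_ge0.
  by rewrite normrM ler_pM ?wD// (le_trans (fC _ s0))// ler_norm.
- by move=> s s0 sa; rewrite fa ?mul0r.
Qed.

(** On indicators this is the definition of [path_mass]; the general case follows by monotone
    classes. *)
Lemma pairing_radon_of_path w C a f : bounded_support C a f ->
  pairing (radon_of_path w) f =
  \int[@lebesgue_measure R]_(s in `[0, +oo[) (f s * w s).
Proof.
move=> fS; have [mf fC fa] := fS.
(* Multiplying by this indicator gives all functions of the class a support in [0,a], hence finite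
   integrals. *)
pose I : R -> R := \1_`[0, a]%classic.
have mI : measurable_fun setT I by exact: measurable_indic.
have IS (g : R -> R) M : measurable_fun setT g -> (forall s, `|g s| <= M) ->
    bounded_support M a (fun s => g s * I s).
  move=> mg gM; split.
  - by apply: measurable_funTS; exact: measurable_funM.
  - move=> s _; rewrite normrM (le_trans _ (gM s))// ler_piMr//.
    by rewrite /I indicE ger0_norm ?ler0n// lern1 leq_b1.
  - move=> s s0 sa; rewrite /I indicE memNset ?mulr0//= in_itv/= s0/=.
    by apply/negP; rewrite -ltNge.
pose g s := f (Num.max s 0).
have mg : measurable_fun setT g.
  apply: (@measurable_comp _ _ _ _ _ _ (`[0, +oo[%classic : set R)) => //.
    by move=> _ [s _ <-]; rewrite /= in_itv/= le_max lexx orbT.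
  exact: measurable_maxr.
have gC s : `|g s| <= C by apply: fC; rewrite le_max lexx orbT.
have fg s : 0 <= s -> f s = g s * I s.
  move=> s0; rewrite /g (max_idPl s0) /I indicE.
  have [sa|sa] := leP s a; first by rewrite mem_set ?mulr1//= in_itv/= s0.
  by rewrite fa ?mul0r.
rewrite (eq_pairing _ fg).
rewrite [RHS](_ : _ = \int[@lebesgue_measure R]_(s in `[0, +oo[) (g s * I s * w s)); last first.
  by apply: eq_Rintegral => s; rewrite inE/= in_itv/= andbT => /fg ->.
pose H := [set g : R -> R | measurable_fun setT g /\ (exists M : R, forall s, `|g s| <= M) /\
  pairing (radon_of_path w) (fun s => g s * I s) =
    \int[@lebesgue_measure R]_(s in `[0, +oo[) (g s * I s * w s)].
have HI A : measurable A -> H (\1_A).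
  move=> mA; split; first exact: measurable_indic.
  split; first by exists 1 => s; rewrite indicE ger0_norm ?ler0n// lern1 leq_b1.
  have mB : measurable (A `&` `[0, a]%classic) by exact: measurableI.
  have BE s : \1_A s * I s = (\1_(A `&` `[0, a]%classic) s : R) by rewrite indicI.
  rewrite /pairing /Rintegral; congr fine.
  under eq_integral do rewrite BE.
  rewrite integral_indic//.
  rewrite (_ : _ `&` _ = A `&` `[0, a]%classic); last first.
    by apply/setIidl => s [_]; rewrite /= !in_itv/= => /andP[->].
  rewrite /radon_of_path/= /path_mass asboolT// integral_mkcond [RHS]integral_mkcond.
  apply: eq_integral => s _; rewrite /patch BE indicE.
  case: ifPn => sB.
    rewrite mem_set ?mul1r//; move: sB; rewrite inE => -[_].
    by rewrite /= !in_itv/= => /andP[->].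
  by rewrite mul0r; case: ifP.
suff [_ [_]] : H g by [].
apply: (@monotone_class R _ _ (@measurable _ R) H) => //.
- exact: measurableI.
- move=> k g1 g2 [mg1 [[M1 gM1] E1]] [mg2 [[M2 gM2] E2]]; split.
    by apply: measurable_funD => //; exact: measurable_funM.
  split.
    exists (`|k| * M1 + M2) => s.
    by rewrite (le_trans (ler_normD _ _))// lerD// normrM ler_wpM2l.
  have S1 := IS _ _ mg1 gM1; have S2 := IS _ _ mg2 gM2.
  have [C1 W1] := bounded_support_path w S1; have [C2 W2] := bounded_support_path w S2.
  rewrite (@eq_pairing _ _ _ (fun s => k * (g1 s * I s) + g2 s * I s)).
    2: by move=> s _; ring.
  rewrite (pairingD _ (bounded_supportZ k S1) S2) (pairingZ _ k S1) E1 E2.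
  have intg C' h : bounded_support C' a h ->
      (@lebesgue_measure R).-integrable (`[0, +oo[%classic : set R) (EFin \o h).
    exact: lebesgue_bounded_support_integrable.
  rewrite -RintegralZl//; last exact: intg W1.
  rewrite -(RintegralD _ (intg _ _ (bounded_supportZ k W1)) (intg _ _ W2))//.
  by apply: eq_Rintegral => s _; ring.
- move=> g_ g0 M Hg gM gg; split.
    by apply: (@measurable_fun_cvg _ _ _ _ g_) => // k; have [] := Hg k.
  split.
    exists M => s; rewrite -(cvg_lim _ (cvg_norm (gg s)))//; apply: limr_le.
      by apply/cvg_ex; exists `|g0 s|; exact: (cvg_norm (gg s)).
    exact: nearW.
  have S k : bounded_support M a (fun s => g_ k s * I s).
    by apply: IS; [have [] := Hg k|exact: gM].
  have cv s : g_ k s * I s @[k --> \oo] --> g0 s * I s.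
    by apply: cvgM; [exact: gg|exact: cvg_cst].
  have h1 : pairing (radon_of_path w) (fun s => g_ k s * I s) @[k --> \oo] -->
      pairing (radon_of_path w) (fun s => g0 s * I s).
    apply: (@pairing_cvg R (radon_of_path w) M a (fun k s => g_ k s * I s) (fun s => g0 s * I s) S).
    by move=> s _; exact: cv.
  have [D D0 wD] := path_norm_bounded w a.
  have h2 : \int[@lebesgue_measure R]_(s in `[0, +oo[) (g_ k s * I s * w s) @[k --> \oo] -->
      \int[@lebesgue_measure R]_(s in `[0, +oo[) (g0 s * I s * w s).
    apply: (@lebesgue_bounded_support_cvg _ _ (`|M| * D) a
      (fun k s => g_ k s * I s * w s)) => //.
    + move=> k; have [mh hM ha] := S k; split.
      * by apply: measurable_funM => //; apply: measurable_funTS; exact: measurable_path.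
      * move=> s s0; have [sa|sa] := leP s a; last by rewrite ha// mul0r normr0 mulr_ge0.
        by rewrite normrM ler_pM ?wD// (le_trans (hM _ s0))// ler_norm.
      * by move=> s s0 sa; rewrite ha ?mul0r.
    + have [|mg0 _ _] := @bounded_support_cvg _ _ _ (fun k s => g_ k s * I s) (fun s => g0 s * I s) S.
        by move=> s _; exact: cv.
      by apply: measurable_funM => //; apply: measurable_funTS; exact: measurable_path.
    + by apply: aeW => s _; apply: cvgM; [exact: cv|exact: cvg_cst].
  rewrite -(cvg_lim _ h1)// -(cvg_lim _ h2)//.
  by under eq_fun do rewrite (Hg _).2.2.
- rewrite (_ : (fun=> 1) = \1_setT); first exact: HI.
  by apply/funext => s; rewrite indicT.
- by exists C.
Qed.

(** To a jump at [t] of size above [3/(m+1)] is attached a rational [q < t] such that the path stays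
    within [1/(m+1)] of its left limit on (q,t). If [t < t'] shared the same [q], the path just
    before [t] would be close to both left limits and [w t] close to that at [t'], so that the jump
    at [t] would be too small. *)
Lemma countable_left_jumps w :
  countable [set t | 0 < t /\ ~ (w s @[s --> t^'-] --> w t)].
Proof.
pose l t := lim (w s @[s --> t^'-]).
pose J m := [set t : R | 0 < t /\ 3 * m.+1%:R^-1 < `|l t - w t|].
have sub : [set t | 0 < t /\ ~ (w s @[s --> t^'-] --> w t)] `<=` \bigcup_m J m.
  move=> t [t0 nt]; have lt := @path_left_limit _ w t t0.
  have d0 : 0 < `|l t - w t|.
    rewrite normr_gt0 subr_eq0; apply/eqP => lw; apply: nt; rewrite -lw.
    exact: lt.
  have d3 : 0 < `|l t - w t| / 3 by rewrite divr_gt0.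
  have [m _ /(_ m (leqnn m))/= mP] := near_infty_natSinv_lt (PosNum d3).
  by exists m => //; split => //; rewrite mulrC -ltr_pdivlMr.
apply: (sub_countable (subset_card_le sub)).
apply: bigcup_countable; first exact: countableP.
move=> m _.
have [q qP] : {q : R -> rat & forall t, J m t -> ratr (q t) < t /\
    forall s, ratr (q t) < s -> s < t -> `|l t - w s| < m.+1%:R^-1}.
  apply: (@choice _ _ (fun t q => J m t -> ratr q < t /\
    forall s, ratr q < s -> s < t -> `|l t - w s| < m.+1%:R^-1)) => t.
  have [[t0 _]|nJ] := pselect (J m t); last by exists 0.
  have lt := @path_left_limit _ w t t0.
  have m0 : 0 < m.+1%:R^-1 :> R by rewrite invr_gt0 ltr0n.
  have /cvgrPdist_lt/(_ _ m0) := lt.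
  rewrite near_withinE => -[d /= d0 dP].
  have tdt : t - d < t by rewrite ltrBlDr ltrDl.
  have [q] := rat_in_itvoo tdt.
  rewrite in_itv/= => /andP[q1 q2]; exists q => _; split => // s qs st.
  by apply: dP => //=; rewrite gtr0_norm ?subr_gt0//; lra.
apply/countable_injP; exists (fun t => pickle (q t)) => t t'.
rewrite !inE => Jt Jt' /(pcan_inj pickleK).
wlog : t t' Jt Jt' / t < t' => [W|tt' qq].
  have [tt'|t't|//] := ltgtP t t' => qq; first exact: W.
  exact/esym/W.
exfalso.
have [q1 q2] := qP _ Jt; have [q1' q2'] := qP _ Jt'.
have [t0 tJ] := Jt.
near t^'- => s.
have h1 : `|l t - w s| < m.+1%:R^-1 by apply: q2.
have h2 : `|l t' - w s| < m.+1%:R^-1.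
  by apply: q2'; [rewrite -qq|apply: lt_trans tt'].
have h3 : `|l t' - w t| < m.+1%:R^-1 by apply: q2' => //; rewrite -qq.
move: tJ h1 h2 h3; move: (m.+1%:R^-1) (l t) (l t') (w s) (w t) => k a b c d.
by rewrite !ltr_norml ltr_normr => /orP[] ? /andP[? ?] /andP[? ?] /andP[? ?]; lra.
Unshelve. all: by end_near. Qed.

Lemma path_continuity_point w t : 0 <= t ->
  (0 < t -> w s @[s --> t^'-] --> w t) ->
  forall e : R, 0 < e -> exists2 d : R, 0 < d &
    forall s, 0 <= s -> `|s - t| < d -> `|w s - w t| < e.
Proof.
move=> t0 wl e e0.
have /cvgrPdist_lt/(_ _ e0) := @path_right_continuous _ w t t0.
rewrite near_withinE => -[d /= d0 dP].
have [d' d'0 d'P] : exists2 d' : R, 0 < d' &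
    forall s, 0 <= s -> s < t -> `|t - s| < d' -> `|w t - w s| < e.
  have [tp|tn] := ltP 0 t; last first.
    by exists 1 => // s s0 st; have := lt_le_trans st tn; rewrite ltNge s0.
  have /cvgrPdist_lt/(_ _ e0) := wl tp.
  by rewrite near_withinE => -[d' /= d'0 d'P]; exists d' => // s _ st ?; exact: d'P.
exists (Num.min d d') => [|s s0]; first by rewrite lt_min d0.
rewrite lt_min !(distrC s) (distrC (w s)) => /andP[sd sd'].
have [st|ts|->] := ltgtP s t; last by rewrite subrr normr0.
  exact: d'P.
exact: dP.
Qed.

(** Otherwise some paths [y k], within [1/(k+1)] of [x] in the Skorokhod sense, are all outside.
    They converge to [x] at its continuity points, hence almost everywhere, and dominated
    convergence contradicts this; [f] need not be continuous. *)
Lemma open_skorokhod_pairing C a f (V : set R) : bounded_support C a f -> open V ->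
  open ((fun w => pairing (radon_of_path w) f) @^-1` V).
Proof.
move=> fS oV; have [mf fC fa] := fS.
suff h : skorokhod_open ((fun w => pairing (radon_of_path w) f) @^-1` V) by exact: h.
move=> x /= Vx.
have /nbhs_ballP[e /= e0 eV] : nbhs (pairing (radon_of_path x) f) V.
  exact: open_nbhs_nbhs.
suff [k kP] : exists k : nat, skorokhod_base x `|a| k.+1%:R^-1 `<=`
    (fun w => pairing (radon_of_path w) f) @^-1` V.
  by exists `|a|, k.+1%:R^-1; split => //; rewrite invr_gt0 ltr0n.
apply: contrapT => /forallNP noP.
have [y yP] : {y : nat -> cadlag R & forall k,
    skorokhod_base x `|a| k.+1%:R^-1 (y k) /\
    ~ V (pairing (radon_of_path (y k)) f)}.
  apply: (@choice _ _ (fun k y => skorokhod_base x `|a| k.+1%:R^-1 y /\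
    ~ V (pairing (radon_of_path y) f))) => k.
  apply: contrapT => /forallNP H; apply: (noP k) => y yx.
  by apply: contrapT => nV; apply: (H y).
(* A time change moves points by less than 1 here, so times up to [a] are sent to times below
   [|a| + 1]. *)
have [M M0 xM] := path_norm_bounded x (`|a| + 1).
have yxl k t : 0 <= t -> t <= a -> exists l : R, [/\ 0 <= l, `|l - t| < k.+1%:R^-1 &
    `|y k t - x l| < k.+1%:R^-1].
  move=> t0 ta; have [[l [_ lim] lP] _] := yP k.
  have [|h1 h2] := lP t; first by rewrite t0 (le_trans ta)// ler_norm.
  exists (l t); split => //.
  have : (l @` `[0, +oo[%classic) (l t) by exists t => //=; rewrite in_itv/= t0.
  by rewrite lim /= in_itv/= andbT.
have inv1 k : k.+1%:R^-1 <= 1 :> R by rewrite invf_le1// ler1n.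
have cvP : pairing (radon_of_path (y k)) f @[k --> \oo] --> pairing (radon_of_path x) f.
  rewrite (pairing_radon_of_path x fS).
  under eq_fun do rewrite (pairing_radon_of_path _ fS).
  apply: (@lebesgue_bounded_support_cvg _ _ (`|C| * (M + 1)) a (fun k s => f s * y k s)) => //.
  - move=> k; split.
    + by apply: measurable_funM => //; apply: measurable_funTS; exact: measurable_path.
    + move=> s s0; have [sa|sa] := leP s a; last first.
        by rewrite fa// mul0r normr0 mulr_ge0// addr_ge0.
      rewrite normrM ler_pM//; first by rewrite (le_trans (fC _ s0))// ler_norm.
      have [l [l0 ls yl]] := yxl k s s0 sa.
      rewrite -(subrK (x l) (y k s)) addrC (le_trans (ler_normD _ _))// lerD//.
        apply: xM; have := le_trans (ltW ls) (inv1 k); rewrite ler_norml => /andP[_].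
        by have := ler_norm a; lra.
      exact: le_trans (ltW yl) (inv1 k).
    + by move=> s s0 sa; rewrite fa ?mul0r.
  - by apply: measurable_funM => //; apply: measurable_funTS; exact: measurable_path.
  pose J := [set t | 0 < t /\ ~ (x s @[s --> t^'-] --> x t)].
  exists J; split.
  - exact: countable_measurable (countable_left_jumps x).
  - exact: countable_lebesgue_measure0 (countable_left_jumps x).
  move=> t /= /not_implyP[]; rewrite in_itv/= andbT => t0 nt.
  have cvt : (0 < t -> x s @[s --> t^'-] --> x t) -> y k t @[k --> \oo] --> x t \/ a < t.
    move=> xl; have [ta|ta] := leP t a; [left|by right].
    apply/cvgrPdist_lt => e' e'0; have e2 : 0 < e' / 2 by rewrite divr_gt0.
    have [d d0 dP] := path_continuity_point t0 xl e2.
    near=> k.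
    have kd : k.+1%:R^-1 < d by near: k; exact: (near_infty_natSinv_lt (PosNum d0)).
    have ke : k.+1%:R^-1 < e' / 2 by near: k; exact: (near_infty_natSinv_lt (PosNum e2)).
    have [l [l0 lt yl]] := yxl k t t0 ta.
    have := dP l l0 (lt_trans lt kd); have := lt_trans yl ke.
    by rewrite !ltr_norml => /andP[? ?] /andP[? ?]; apply/andP; split; lra.
  have [t1 nxl] : 0 < t /\ ~ (x s @[s --> t^'-] --> x t).
    apply/not_implyP => xl; apply: nt.
    have [h|ta] := cvt xl; first by apply: cvgM; [exact: cvg_cst|exact: h].
    rewrite fa// mul0r; under eq_fun do rewrite mul0r; exact: cvg_cst.
  by split.
have /(_ _ (nbhsx_ballx _ _ e0))[k _ /(_ k (leqnn k))/= kP] := cvP.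
by have [_] := yP k; apply; exact: eV.
Unshelve. all: by end_near. Qed.

Lemma measurable_skorokhod_pairing C a f : bounded_support C a f ->
  measurable_fun setT (fun w : cadlag R => pairing (radon_of_path w) f).
Proof.
move=> fS; apply: (measurability _ (RGenOpens.measurableE R)).
move=> _ [_ [x [y ->]] <-]; rewrite setTI; apply: sub_sigma_algebra.
by apply: open_skorokhod_pairing fS _; exact: interval_open.
Qed.

End path.

(** * Measurability by means of Laplace exponentials *)

Section laplace_measurability.
Variable R : realType.

Lemma measurable_expRN : measurable_fun setT (fun x : R => expR (- x)).
Proof. by apply: measurableT_comp => //. Qed.

Lemma measurable_radon_of_path : measurable_fun setT (@radon_of_path R).
Proof.
move=> _ B mB; rewrite setTI.
pose H := [set g : radon R -> R | measurable_fun setT (g \o @radon_of_path R)].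
have : H \1_B.
  apply: radon_monotone_class => //.
  - by move=> k g h mg mh; apply: measurable_funD => //; exact: measurable_funM.
  - move=> g_ g0 M Hg gM gg; apply: (@measurable_fun_cvg _ _ _ _ (fun k => g_ k \o @radon_of_path R)) => //.
    by move=> w _; exact: gg.
  - move=> f /bounded_positive_compactP[[C [a fS]] _].
    by apply: (measurableT_comp measurable_expRN); exact: measurable_skorokhod_pairing fS.
  - by exists 1 => nu; rewrite indicE ger0_norm ?ler0n// lern1 leq_b1.
move=> /(_ measurableT [set 1] (measurable_set1 _)); rewrite setTI.
rewrite (_ : _ @^-1` [set 1] = @radon_of_path R @^-1` B)//.
apply/seteqP; split => w /=; rewrite indicE.
  by case: (boolP (_ \in B)) => [/set_mem//|_ /eqP]; rewrite eq_sym oner_eq0.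
by move=> wB; rewrite mem_set.
Qed.

Lemma measurable_expR_pairing f : bounded_positive_compact f ->
  measurable_fun setT (fun nu : radon R => expR (- pairing nu f)).
Proof.
move=> /bounded_positive_compactP[[C [a fS]] _].
by apply: (measurableT_comp measurable_expRN); exact: measurable_pairing fS.
Qed.

Lemma expR_pairing01 (nu : radon R) f : bounded_positive_compact f ->
  0 <= expR (- pairing nu f) <= 1.
Proof.
move=> [_ f0 _ _]; rewrite expR_ge0/= -[leRHS]expR0 ler_expR oppr_le0.
exact: pairing_ge0.
Qed.

Lemma bounded_Rintegral_cvg d (X : measurableType d) (P : probability X R)
    (g_ : nat -> X -> R) (g : X -> R) (M : R) :
  (forall k, measurable_fun setT (g_ k)) -> (forall k x, `|g_ k x| <= M) ->
  (forall x, g_ k x @[k --> \oo] --> g x) ->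
  \int[P]_x g_ k x @[k --> \oo] --> \int[P]_x g x.
Proof.
move=> mg gM gg; apply: (@Rdominated_cvg _ _ _ _ _ _ _ (fun=> M)) => //.
by apply: (@bounded_integrable _ _ _ _ _ _ `|M|).
Qed.

Lemma Rintegral_indic d (X : measurableType d) (P : probability X R) (A : set X) :
  measurable A -> (\int[P]_x \1_A x)%:E = P A.
Proof.
move=> mA; rewrite /Rintegral fineK integral_indic ?setIT//.
by rewrite fin_num_measure.
Qed.

End laplace_measurability.

Section laplace_kernel.
Variable R : realType.
Context d (X : measurableType d).
Variable K : X -> probability (radon R) R.

(** The measurability proof is an argument so that the kernel structure depending on it can be
    attached to this constant. *)
Definition laplace_kernel (mK : forall f, bounded_positive_compact f ->
    measurable_fun setT (fun x => \int[K x]_nu expR (- pairing nu f))) (x : X) :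
  {measure set (radon R) -> \bar R} := K x.

Hypothesis mK : forall f, bounded_positive_compact f ->
  measurable_fun setT (fun x => \int[K x]_nu expR (- pairing nu f)).

Let measurable_laplace_kernel B : measurable B -> measurable_fun setT (K ^~ B).
Proof.
move=> mB.
have KB : measurable_fun setT (fun x => \int[K x]_nu (\1_B nu : R)).
  pose H := [set g : radon R -> R | [/\ measurable_fun setT g,
    exists M : R, forall nu, `|g nu| <= M &
    measurable_fun setT (fun x => \int[K x]_nu g nu)]].
  suff [] : H \1_B by [].
  apply: radon_monotone_class => //.
  - move=> k g h [mg [M gM] Eg] [mh [N hN] Eh]; split.
    + by apply: measurable_funD => //; exact: measurable_funM.
    + exists (`|k| * M + N) => x.
      by rewrite (le_trans (ler_normD _ _))// lerD// normrM ler_wpM2l.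
    + have i1 (L : probability (radon R) R) : L.-integrable setT (EFin \o g).
        exact: bounded_integrable.
      have i2 (L : probability (radon R) R) : L.-integrable setT (EFin \o h).
        exact: bounded_integrable.
      have i3 (L : probability (radon R) R) : L.-integrable setT (EFin \o (fun x => k * g x)).
        apply: (@bounded_integrable _ _ _ _ _ _ (`|k| * M)) => //; first exact: measurable_funM.
        by move=> x _; rewrite normrM ler_wpM2l.
      under eq_fun do rewrite (RintegralD measurableT (i3 _) (i2 _)) (RintegralZl _ measurableT (i1 _)).
      by apply: measurable_funD => //; exact: measurable_funM.
  - move=> g_ g0 M Hg gM gg.
    have mg k : measurable_fun setT (g_ k) by have [] := Hg k.
    split; first exact: (measurable_fun_cvg mg).
      exists M => x; rewrite -(cvg_lim _ (cvg_norm (gg x)))//; apply: limr_le.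
        by apply/cvg_ex; exists `|g0 x|; exact: (cvg_norm (gg x)).
      exact: nearW.
    apply: (@measurable_fun_cvg _ _ _ _ (fun k x => \int[K x]_nu g_ k nu)).
      by move=> k; have [] := Hg k.
    by move=> x _; exact: bounded_Rintegral_cvg.
  - move=> f fB; split; [exact: measurable_expR_pairing| |exact: mK].
    by exists 1 => nu; have /andP[? ?] := expR_pairing01 nu fB; rewrite ger0_norm.
  - by exists 1 => nu; rewrite indicE ger0_norm ?ler0n// lern1 leq_b1.
rewrite (_ : K ^~ B = (fun x => (\int[K x]_nu \1_B nu)%:E)).
  by apply/measurable_EFinP; exact: KB.
by apply/funext => x; rewrite Rintegral_indic.
Qed.

HB.instance Definition _ := @isKernel.Build _ _ X (radon R) R (laplace_kernel mK)
  measurable_laplace_kernel.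

Let laplace_kernel_setT x : laplace_kernel mK x setT = 1%E.
Proof. exact: probability_setT. Qed.

HB.instance Definition _ := @Kernel_isProbability.Build _ _ X (radon R) R
  (laplace_kernel mK) laplace_kernel_setT.

End laplace_kernel.

(** * Approximation by step densities *)

Section telescope.
Variable R : realType.
Implicit Types (nu : radon R) (f : R -> R).

(** The increments of an increasing family [psi] form a partition of unity on [0,a]. The Riemann sum
    then depends on [nu] only through the numbers [pairing nu (psi i)], so measures that agree on
    these can be compared. *)
Lemma pairing_telescope nu f (psi : nat -> R -> R) (M : nat) (h C a e N : R) :
  bounded_support C a f ->
  (forall i, bounded_support 1 N (psi i)) ->
  (forall s, 0 <= s -> psi 0%N s = 0) ->
  (forall i s, 0 <= s -> psi i s <= psi i.+1 s) ->
  (forall s, 0 <= s <= a -> psi M s = 1) ->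
  (forall i s, 0 <= s -> psi i s != psi i.+1 s -> `|f s - f (i%:R * h)| <= e) ->
  `|pairing nu f - \sum_(0 <= i < M) f (i%:R * h) *
      (pairing nu (psi i.+1) - pairing nu (psi i))| <= e * pairing nu (psi M).
Proof.
move=> fS pS p0 pi p1 fp.
have FS i : bounded_support (1 + 1) N (fun s => psi i.+1 s - psi i s).
  by have := bounded_supportB (pS i.+1) (pS i); rewrite maxxx.
have nu0 : pairing nu (psi 0%N) = 0.
  by rewrite (@eq_pairing _ _ _ (fun=> 0))// /pairing Rintegral_cst// mul0r.
have E i : pairing nu (psi i.+1) - pairing nu (psi i) =
    pairing nu (fun s => psi i.+1 s - psi i s).
  by rewrite (pairingB _ (pS i.+1) (pS i)).
have -> : pairing nu (psi M) = \sum_(0 <= i < M) pairing nu (fun s => psi i.+1 s - psi i s).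
  under eq_bigr do rewrite -E.
  by rewrite telescope_sumr// nu0 subr0.
under eq_bigr do rewrite E.
apply: (@pairing_partition _ _ _ (index_iota 0 M) (fun i => i%:R * h)
  (fun i s => psi i.+1 s - psi i s) C a _ (1 + 1) e N) => //.
- by move=> i s s0; rewrite subr_ge0 pi.
- move=> s /andP[s0 sa]; rewrite telescope_sumr// p0// subr0 p1//.
  by rewrite s0.
- by move=> i s s0; rewrite subr_eq0 eq_sym; exact: fp.
Qed.

Definition below (t s : R) : R := \1_(`[0, t[%classic) s.

Lemma belowE t s : 0 <= s -> below t s = (s < t)%R%:R.
Proof.
move=> s0; rewrite /below indicE; congr ((nat_of_bool _)%:R); apply/idP/idP.
  by move/set_mem; rewrite /= in_itv/= => /andP[].
by move=> st; apply/mem_set; rewrite /= in_itv/= s0.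
Qed.

Lemma bounded_support_below t N : t <= N -> bounded_support 1 N (below t).
Proof.
move=> tN; split; first exact: measurable_indic.
  by move=> s s0; rewrite belowE// ger0_norm ?ler0n// lern1 leq_b1.
by move=> s s0 Ns; rewrite belowE// ltNge (le_trans tN (ltW Ns)).
Qed.

Lemma below0 s : 0 <= s -> below 0 s = 0.
Proof. by move=> s0; rewrite belowE// ltNge s0. Qed.

Lemma le_below t t' s : 0 <= s -> t <= t' -> below t s <= below t' s.
Proof.
move=> s0 tt; rewrite !belowE//; have [st|_] := ltP s t; last by rewrite ler0n.
by rewrite (lt_le_trans st tt).
Qed.

End telescope.

Section step_density.
Variables (R : realType) (eta : radon R) (n : nat).

Let h : R := n.+1%:R^-1.

Let h0 : 0 < h. Proof. by rewrite invr_gt0 ltr0n. Qed.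

Definition cell_mass (i : nat) : R :=
  pairing eta (below (i.+1%:R * h)) - pairing eta (below (i%:R * h)).

Let bS (t : R) : bounded_support 1 t (below t). Proof. exact: bounded_support_below. Qed.

Let cell_mass_ge0 i : 0 <= cell_mass i.
Proof.
rewrite subr_ge0; apply: (le_pairing _ (bS _) (bS _)) => s s0.
by apply: le_below => //; rewrite ler_pM2r// ler_nat.
Qed.

(** Constant on each cell closed on the left, which makes it right continuous; [n+1] is the inverse
    of the mesh, so each cell gets its mass under [eta]. *)
Definition step_path (s : R) : R :=
  if 0 <= s then n.+1%:R * cell_mass (Num.truncn (s * n.+1%:R)) else 0.

Let step_pathE i s : i%:R * h <= s < i.+1%:R * h -> step_path s = n.+1%:R * cell_mass i.
Proof.
rewrite /h ler_pdivrMr ?ltr0n// ltr_pdivlMr ?ltr0n// => si.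
rewrite /step_path ifT; last first.
  have /andP[i1 _] := si; rewrite -(@pmulr_lge0 _ n.+1%:R) ?ltr0n//.
  exact: (le_trans (ler0n _ i) i1).
by rewrite (truncn_def si).
Qed.

Let step_right s : 0 <= s -> step_path t @[t --> s^'+] --> step_path s.
Proof.
move=> s0; pose i := Num.truncn (s * n.+1%:R).
have /andP[i1 i2] : i%:R * h <= s < i.+1%:R * h.
  by rewrite /h ler_pdivrMr ?ltr0n// ltr_pdivlMr ?ltr0n// truncn_itv// mulr_ge0.
rewrite (@step_pathE i) ?i1//; apply: cvg_near_cst; near=> t.
apply: step_pathE; apply/andP; split; last by near: t; exact: nbhs_right_lt.
by apply: (le_trans i1); near: t; exact: nbhs_right_ge.
Unshelve. all: by end_near. Qed.

Let step_left s : 0 < s -> cvg (step_path t @[t --> s^'-]).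
Proof.
move=> s0; have [i /andP[i1 i2]] : exists i : nat, i%:R * h < s <= i.+1%:R * h.
  pose i := Num.truncn (s * n.+1%:R).
  have /andP[i1 i2] : i%:R * h <= s < i.+1%:R * h.
    by rewrite /h ler_pdivrMr ?ltr0n// ltr_pdivlMr ?ltr0n// truncn_itv// mulr_ge0// ltW.
  (* Left limits need cells closed on the right: a grid point belongs to the preceding one. *)
  move: i1; rewrite le_eqVlt => /predU1P[ei|i1]; last by exists i; rewrite i1 ltW.
  move: ei; case: (i) => [|j] js; first by move: s0; rewrite -js mul0r ltxx.
  by exists j; rewrite -js lexx ltr_pM2r// ltr_nat ltnSn.
apply/cvg_ex; exists (n.+1%:R * cell_mass i); apply: cvg_near_cst; near=> t.
apply: step_pathE; apply/andP; split.
  by near: t; exact: nbhs_left_ge.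
by apply: lt_le_trans i2; near: t; exact: nbhs_left_lt.
Unshelve. all: by end_near. Qed.

Let step_lt0 s : s < 0 -> step_path s = 0.
Proof. by move=> s0; rewrite /step_path leNgt s0. Qed.

Let step_ge0 s : 0 <= s -> 0 <= step_path s.
Proof. by move=> s0; rewrite /step_path s0 mulr_ge0. Qed.

Definition step_density : cadlag R := Cadlag step_lt0 step_ge0 step_right step_left.

Lemma pairing_step_density (i : nat) :
  pairing (radon_of_path step_density) (below (i%:R * h)) =
  pairing eta (below (i%:R * h)).
Proof.
have z (nu : radon R) : pairing nu (below (0%:R * h)) = 0.
  rewrite mul0r (@eq_pairing _ _ _ (fun=> 0)); last by move=> s; exact: below0.
  by rewrite /pairing Rintegral_cst// mul0r.
elim: i => [|i IH]; first by rewrite !z.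
rewrite -[LHS](subrK (pairing (radon_of_path step_density) (below (i%:R * h)))).
rewrite -(pairingB _ (bS _) (bS _)) IH -[RHS](subrK (pairing eta (below (i%:R * h)))).
congr (_ + _); rewrite -/(cell_mass i).
have dS := bounded_supportB (bS (i.+1%:R * h)) (bS (i%:R * h)).
rewrite (pairing_radon_of_path _ dS).
pose c := n.+1%:R * cell_mass i.
have ih : 0 <= i%:R * h by rewrite mulr_ge0// ltW.
have iih : i%:R * h < i.+1%:R * h by rewrite ltr_pM2r// ltr_nat.
transitivity (\int[@lebesgue_measure R]_(s in `[0, +oo[)
    (c * \1_(`[i%:R * h, i.+1%:R * h[%classic) s)).
  apply: eq_Rintegral => s; rewrite inE/= in_itv/= andbT => s0.
  rewrite !belowE// indicE.
  have [si|si] := ltP s (i%:R * h).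
    by rewrite (lt_trans si iih) subrr mul0r memNset ?mulr0//= in_itv/= leNgt si.
  have [si'|si'] := ltP s (i.+1%:R * h).
    rewrite mem_set ?mulr1 ?subr0 ?mul1r/= ?in_itv/= ?si//.
    by apply: step_pathE; rewrite si.
  by rewrite subrr mul0r memNset ?mulr0//= in_itv/= (ltNge s) si' andbF.
rewrite RintegralZl//.
  rewrite /Rintegral integral_indic//.
  rewrite setIC (_ : _ `&` _ = `[i%:R * h, i.+1%:R * h[%classic); last first.
    by apply/setIidr => s; rewrite /= !in_itv/= andbT => /andP[/(le_trans ih)].
  rewrite /= lebesgue_measure_itv/= lte_fin iih -EFinB/= /c -mulrBl -natr1 /h.
  by field; rewrite nat1r pnatr_eq0.
apply: (@lebesgue_bounded_support_integrable _ _ 1 (i.+1%:R * h)) => //; split.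
- exact: measurable_indic.
- by move=> s _; rewrite indicE ger0_norm ?ler0n// lern1 leq_b1.
- by move=> s s0 si; rewrite indicE memNset//= in_itv/= (ltNge s) (ltW si) andbF.
Qed.

(** By [pairing_step_density] both measures have the same Riemann sums on the grid, so only two
    approximation errors remain. *)
Lemma step_density_dist f (C a e : R) : bounded_support C a f ->
  (forall s t, 0 <= s -> 0 <= t -> `|s - t| <= h -> `|f s - f t| <= e) -> 0 <= a ->
  `|pairing (radon_of_path step_density) f - pairing eta f| <=
    2 * e * pairing eta (below (a + 2)).
Proof.
move=> fS fe a0.
pose M := (Num.truncn (a * n.+1%:R)).+1.
have aM : a < M%:R * h by rewrite /h ltr_pdivlMr ?ltr0n// truncnS_gt.
have Ma : M%:R * h <= a + 1.
  rewrite /h ler_pdivrMr ?ltr0n// mulrDl mul1r /M -[X in X <= _]natr1 lerD//.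
    by rewrite truncn_le// mulr_ge0.
  by rewrite ler1n.
have e0 : 0 <= e by apply: le_trans (fe 0 0 _ _ _) => //; rewrite subrr normr0 ltW.
have T (nu : radon R) : `|pairing nu f - \sum_(0 <= i < M) f (i%:R * h) *
      (pairing nu (below (i.+1%:R * h)) - pairing nu (below (i%:R * h)))| <=
      e * pairing nu (below (M%:R * h)).
  (* Capping at [M] gives all [psi i] a common support. *)
  pose psi (i : nat) : R -> R := below ((minn i M)%:R * h).
  have le_h (i j : nat) : (i <= j)%N -> i%:R * h <= j%:R * h.
    by move=> ij; rewrite ler_pM2r// ler_nat.
  have := @pairing_telescope _ nu f psi M h C a e (M%:R * h) fS.
  rewrite /psi minnn (_ : \sum_(0 <= i < M) _ = \sum_(0 <= i < M) f (i%:R * h) *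
      (pairing nu (below (i.+1%:R * h)) - pairing nu (below (i%:R * h)))).
    apply.
    - by move=> i; apply: bounded_support_below; apply: le_h; rewrite geq_minr.
    - by move=> s s0; rewrite min0n mul0r below0.
    - move=> i s s0; apply: le_below => //; apply: le_h.
      by rewrite leq_min geq_minr andbT (leq_trans (geq_minl _ _)).
    - by move=> s /andP[s0 sa]; rewrite belowE// (le_lt_trans sa aM).
    - move=> i s s0; rewrite !belowE//; have [iM|Mi] := ltnP i M; last first.
        by rewrite !(minn_idPr _) ?eqxx// (leq_trans Mi).
      rewrite (minn_idPl _)// ?(ltnW iM)//; move=> si.
      apply: fe => //; first by rewrite mulr_ge0// ltW.
      move: si; have [si|si] := ltP s (i%:R * h).
        by rewrite (lt_le_trans si) ?eqxx//; apply: le_h.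
      have [si'|] := ltP s (i.+1%:R * h); last by rewrite eqxx.
      by move=> _; rewrite ger0_norm ?subr_ge0// lerBlDl; move: (ltW si'); rewrite -natr1 mulrDl mul1r.
  apply: eq_big_nat => i /andP[_ iM].
  by rewrite !(minn_idPl _) ?(ltnW iM).
have := T (radon_of_path step_density); have := T eta.
under [X in `|_ - X| <= _ -> _]eq_bigr do rewrite -!pairing_step_density.
rewrite pairing_step_density.
set A := \sum_(0 <= i < M) _; set m := pairing eta (below (M%:R * h)) => h1 h2.
have mM : m <= pairing eta (below (a + 2)).
  apply: (le_pairing _ (bS _) (bS _)) => s s0; apply: le_below => //; lra.
have em : e * m <= e * pairing eta (below (a + 2)) by rewrite ler_wpM2l.
by move: h1 h2; rewrite !ler_norml => /andP[? ?] /andP[? ?]; apply/andP; split; lra.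
Qed.

End step_density.

Lemma step_density_cvg (R : realType) (eta : radon R) f : vague_test f ->
  pairing (radon_of_path (step_density eta n)) f @[n --> \oo] --> pairing eta f.
Proof.
move=> fV; have [C [a0 fS0]] := vague_test_bounded fV.
pose a : R := `|a0|.
have fS : bounded_support C a f.
  by apply: bounded_support_le fS0 => //; exact: ler_norm.
pose S : R := pairing eta (below (a + 2)).
have S0 : 0 <= S by apply: pairing_ge0 => s s0; rewrite belowE.
apply/cvgrPdist_le => e e0.
have e'0 : 0 < e / (2 * S + 1) by rewrite divr_gt0//; lra.
have [d d0 dP] := vague_test_unif fV e'0.
near=> n; rewrite distrC.
apply: (le_trans (@step_density_dist _ eta n f C a (e / (2 * S + 1)) fS _ _)).
- move=> s t s0 t0 st; apply: dP => //; apply: (le_lt_trans st).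
  by near: n; exact: (near_infty_natSinv_lt (PosNum d0)).
- by rewrite /a.
- rewrite -/S -mulrA mulrCA -[leRHS]mulr1 -mulrA ler_pM2l//.
  by rewrite mulrC ler_pdivrMr; lra.
Unshelve. all: by end_near. Qed.

(** * Vague compactness along an ultrafilter *)

Section stieltjes.
Variables (R : realType) (H : R -> R).
Hypotheses (H_nd : {homo H : x y / x <= y}) (H_le0 : forall t, t <= 0 -> H t = 0).

(** [H] will be an ultralimit of distribution functions and need not be continuous from either side;
    its right-continuous version defines the Stieltjes measure. *)
Definition right_limit (t : R) : R := inf (H @` `]t, +oo[%classic).

Let H_ge0 t : 0 <= H t.
Proof.
have [t0|t0] := leP t 0; first by rewrite H_le0.
by rewrite -(@H_le0 0)// H_nd// ltW.
Qed.

Let has_lb t : has_lbound (H @` `]t, +oo[%classic).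
Proof. by exists 0 => _ [s _ <-]. Qed.

Let nonempty t : H @` `]t, +oo[%classic !=set0.
Proof. by exists (H (t + 1)), (t + 1) => //=; rewrite in_itv/= andbT ltrDl. Qed.

Lemma right_limit_le t s : t < s -> right_limit t <= H s.
Proof. by move=> ts; apply: ge_inf => //; exists s => //=; rewrite in_itv/= andbT. Qed.

Lemma right_limit_ge t : H t <= right_limit t.
Proof.
apply: lb_le_inf => // _ [s + <-]; rewrite /= in_itv/= andbT => /ltW; exact: H_nd.
Qed.

Lemma right_limit_lt t e : 0 < e -> exists2 s, t < s & H s < right_limit t + e.
Proof.
move=> e0; have [_ [s + <-] Hs] := inf_adherent e0 (conj (nonempty t) (has_lb t)).
by rewrite /= in_itv/= andbT => ts; exists s.
Qed.

Lemma right_limit_lt0 t : t < 0 -> right_limit t = 0.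
Proof.
move=> t0; apply/eqP; rewrite eq_le; apply/andP; split.
  by rewrite -(@H_le0 0)// right_limit_le.
by apply: lb_le_inf => // _ [s _ <-].
Qed.

Let right_limit_nd : {homo right_limit : x y / x <= y}.
Proof.
move=> x y xy; apply: lb_le_inf => // _ [s + <-].
by rewrite /= in_itv/= andbT => ys; apply: right_limit_le; exact: le_lt_trans ys.
Qed.

Let right_limit_rc : right_continuous right_limit.
Proof.
move=> t; apply/cvgrPdist_le => e e0; have [s ts Hs] := right_limit_lt t e0.
near=> u; have tu : t <= u by near: u; exact: nbhs_right_ge.
have us : u < s by near: u; exact: nbhs_right_lt.
have := right_limit_nd tu; have := right_limit_le us.
rewrite distrC => h1 h2; rewrite ger0_norm ?subr_ge0//.
by rewrite lerBlDl (le_trans h1)// ltW.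
Unshelve. all: by end_near. Qed.

HB.instance Definition _ := isCumulative.Build R _ R right_limit right_limit_nd
  right_limit_rc.

Definition stieltjes (A : set R) : \bar R :=
  if `[< measurable A >] then lebesgue_stieltjes_measure right_limit A else 0%E.

Let stieltjes0 : stieltjes set0 = 0%E.
Proof. by rewrite /stieltjes; case: asboolP => // _; exact: measure0. Qed.

Let stieltjes_ge0 A : (0 <= stieltjes A)%E.
Proof. by rewrite /stieltjes; case: asboolP => // _; exact: measure_ge0. Qed.

Let stieltjes_sigma_additive : semi_sigma_additive stieltjes.
Proof.
move=> F mF tF mUF; rewrite /stieltjes asboolT//.
under eq_fun do under eq_bigr do rewrite asboolT//.
exact: (@measure_semi_sigma_additive _ _ _ (lebesgue_stieltjes_measure right_limit)).
Qed.

HB.instance Definition _ := isMeasure.Build _ _ _ stieltjes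
  stieltjes0 stieltjes_ge0 stieltjes_sigma_additive.

Let stieltjes_oc x y : x <= y ->
  stieltjes `]x, y]%classic = (right_limit y - right_limit x)%:E.
Proof.
move=> xy; rewrite /stieltjes asboolT//.
rewrite /lebesgue_stieltjes_measure /measure_extension measurable_mu_extE/=; last first.
  exact: is_ocitv.
rewrite wlength_itv/= lte_fin; case: ltgtP xy => // ->.
by rewrite subrr.
Qed.

Let stieltjes_lt0 : stieltjes `]-oo, 0[%classic = 0%E.
Proof.
pose F (n : nat) := `](- n%:R - 1 : R), (- n.+1%:R^-1)]%classic.
have neg n : - n.+1%:R^-1 < 0 :> R by rewrite oppr_lt0 invr_gt0 ltr0n.
have F0 n : stieltjes (F n) = 0%E.
  have le1 : - n%:R - 1 <= - n.+1%:R^-1 :> R.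
    have k1 : n.+1%:R^-1 <= 1 :> R by rewrite invf_le1// ler1n.
    have n0 : 0 <= n%:R :> R by [].
    by move: k1 n0; move: (n.+1%:R^-1) (n%:R) => x y; lra.
  rewrite stieltjes_oc// !right_limit_lt0 ?subrr//.
apply/eqP; rewrite eq_le measure_ge0 andbT.
rewrite (_ : `]-oo, 0[%classic = \bigcup_n F n).
  apply: (le_trans (generalized_Boole_inequality _ _ _)) => //.
    by move=> n; exact: measurable_itv.
    by apply: bigcup_measurable => n _; exact: measurable_itv.
  by rewrite eseries0// => n _ _; exact: F0.
apply/seteqP; split => [s|s [n _]]; rewrite /F /= !in_itv/=; last first.
  by move=> /andP[_ sn]; exact: le_lt_trans sn (neg n).
move=> s0; have s0' : 0 < - s by rewrite oppr_gt0.
near \oo => n; exists n => //; rewrite /F/= in_itv/=; apply/andP; split.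
  rewrite -opprD ltrNl; apply: (@le_lt_trans _ _ n%:R); last by rewrite ltrDl.
  by near: n; exact: nbhs_infty_ger.
rewrite lerNr ltW//; near: n; exact: (near_infty_natSinv_lt (PosNum s0')).
Unshelve. all: by end_near. Qed.

Let stieltjes_cc t : 0 <= t -> stieltjes `[0, t]%classic = (right_limit t)%:E.
Proof.
move=> t0.
(* The mass of [0,t], with a possible atom at 0, is that of ]-1,t], because the open interval ]-1,0[
   is null. *)
have n1 : stieltjes `](-1), 0[%classic = 0%E.
  apply/eqP; rewrite eq_le measure_ge0 andbT -stieltjes_lt0.
  by apply: le_measure; rewrite ?inE//= => s; rewrite /= !in_itv/= => /andP[].
have : stieltjes `](-1), t]%classic = (right_limit t)%:E.
  by rewrite stieltjes_oc ?(@right_limit_lt0 (-1)) ?subr0 ?ltrN10// (le_trans _ t0)// lerN10.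
rewrite (_ : `](-1), t]%classic = `](-1), 0[%classic `|` `[0, t]%classic).
  rewrite measureU//; first by rewrite [X in (X + _)%E]n1 add0e.
  apply/seteqP; split => // s [] /=; rewrite !in_itv/= => /andP[_ s0] /andP[s0' _].
  by move: s0; rewrite ltNge s0'.
apply/seteqP; split => s /=; rewrite !in_itv/=.
  by move=> /andP[s1 st]; have [s0|s0] := ltP s 0; [left; rewrite s1|right].
by move=> [/andP[-> s0]|/andP[s0 ->]]; [rewrite (le_trans (ltW s0))|rewrite andbT; lra].
Qed.

Let stieltjes_compact a : (stieltjes `[0%R, a]%classic < +oo)%E.
Proof.
have [a0|a0] := leP 0 a; first by rewrite stieltjes_cc// ltry.
by rewrite set_itv_ge ?measure0// bnd_simp -ltNge.
Qed.

Let stieltjes_nonmeasurable A : ~ measurable A -> stieltjes A = 0%E.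
Proof. by move=> nA; rewrite /stieltjes asboolF. Qed.

Definition radon_stieltjes : radon R :=
  Radon stieltjes_lt0 stieltjes_compact stieltjes_nonmeasurable.

Lemma pairing_stieltjes_cc t : 0 <= t ->
  pairing radon_stieltjes (\1_`[0, t]%classic) = right_limit t.
Proof.
move=> t0; rewrite /pairing /Rintegral integral_indic//.
rewrite (_ : _ `&` _ = `[0, t]%classic); last first.
  by apply/setIidl => s; rewrite /= !in_itv/= andbT => /andP[].
by rewrite /= stieltjes_cc.
Qed.

(** The mass of [0,t) is the limit of the masses of [0, t - 1/(k+1)]. Together with [right_limit_ge]
    this places [H t] between the masses of [0,t) and [0,t]. *)
Lemma pairing_stieltjes_below t : pairing radon_stieltjes (below t) <= H t.
Proof.
have [t0|t0] := leP t 0.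
  rewrite (@eq_pairing _ _ _ (fun=> 0)).
    by rewrite /pairing Rintegral_cst// mul0r.
  by move=> s s0; rewrite belowE// ltNge (le_trans t0).
have c : pairing radon_stieltjes (\1_`[0, t - k.+1%:R^-1]%classic) @[k --> \oo] -->
    pairing radon_stieltjes (below t).
  apply: (@pairing_cvg _ _ 1 t) => [k|s s0].
    apply: bounded_support_le (bounded_support_indic (t - k.+1%:R^-1)) => //.
    by rewrite lerBlDr lerDl.
  rewrite belowE//; apply: cvg_near_cst; have [st|ts] := ltP s t.
    have ts : 0 < t - s by rewrite subr_gt0.
    near=> k; rewrite indicE mem_set//= in_itv/= s0/= lerBrDr -lerBrDl ltW//.
    near: k; exact: (near_infty_natSinv_lt (PosNum ts)).
  near=> k; rewrite indicE memNset//= in_itv/= s0/=; apply/negP; rewrite -ltNge.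
  by apply: lt_le_trans ts; rewrite ltrBlDr ltrDl invr_gt0 ltr0n.
rewrite -(cvg_lim _ c)//; apply: limr_le; first by apply/cvg_ex; eexists; exact: c.
near=> k; rewrite pairing_stieltjes_cc.
  by apply: right_limit_le; rewrite ltrBlDr ltrDl invr_gt0 ltr0n.
rewrite subr_ge0 ltW//; near: k; exact: (near_infty_natSinv_lt (PosNum t0)).
Unshelve. all: by end_near. Qed.

(* [H] takes, at an atom of the limit measure, some value between the left and
   right limits of its distribution function; [theta] is the fraction of the
   atom that it counts. *)
Lemma stieltjes_interpolation t : exists theta : R, 0 <= theta <= 1 /\
  pairing radon_stieltjes
    (fun s => (1 - theta) * below t s + theta * \1_(`[0, t]%classic) s) = H t.
Proof.
have bS : bounded_support 1 t (below t) by exact: bounded_support_below.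
have iS := bounded_support_indic t.
have E theta : pairing radon_stieltjes
    (fun s => (1 - theta) * below t s + theta * \1_(`[0, t]%classic) s) =
    (1 - theta) * pairing radon_stieltjes (below t) +
    theta * pairing radon_stieltjes (\1_`[0, t]%classic).
  rewrite (pairingD _ (bounded_supportZ _ bS) (bounded_supportZ _ iS)).
  by rewrite (pairingZ _ _ bS) (pairingZ _ _ iS).
have [t0|t0] := ltP t 0.
  exists 0; split; first by rewrite lexx ler01.
  rewrite E mul0r addr0 subr0 mul1r H_le0 ?ltW//.
  rewrite (@eq_pairing _ _ _ (fun=> 0)).
    by rewrite /pairing Rintegral_cst// mul0r.
  by move=> s s0; rewrite belowE// ltNge (le_trans (ltW t0)).
have h1 := pairing_stieltjes_below t; have h2 := right_limit_ge t.
rewrite -pairing_stieltjes_cc// in h2.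
set x := pairing radon_stieltjes (below t) in h1 *.
set y := pairing radon_stieltjes (\1_`[0, t]%classic) in h2 *.
suff [theta [th01 thE]] : exists theta : R, 0 <= theta <= 1 /\
    (1 - theta) * x + theta * y = H t by exists theta; rewrite E.
have [xy|xy] := eqVneq x y.
  by exists 0; split; [rewrite lexx ler01|rewrite mul0r subr0 mul1r addr0; lra].
have yx : 0 < y - x by rewrite subr_gt0 lt_neqAle xy (le_trans h1).
exists ((H t - x) / (y - x)); split; last by field; lra.
by apply/andP; split; [rewrite divr_ge0|rewrite ler_pdivrMr// mul1r]; lra.
Qed.

End stieltjes.

Section vague_ultralimit.
Variables (R : realType) (nu : nat -> radon R).
Hypothesis nu_bdd : forall k : nat, exists C : R,
  \forall n \near nat_ultra, pairing (nu n) (below k%:R) <= C.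

Let bS (t : R) : bounded_support 1 t (below t). Proof. exact: bounded_support_below. Qed.

Let H (t : R) := lim (pairing (nu n) (below t) @[n --> nat_ultra]).

Let mono (mu : radon R) (s t : R) : s <= t -> pairing mu (below s) <= pairing mu (below t).
Proof. by move=> st; apply: (le_pairing _ (bS _) (bS _)) => x x0; exact: le_below. Qed.

Let nneg (mu : radon R) (t : R) : 0 <= pairing mu (below t).
Proof. by apply: pairing_ge0 => s s0; rewrite belowE. Qed.

Let H_cvg t : pairing (nu n) (below t) @[n --> nat_ultra] --> H t.
Proof.
have [k tk] : exists k : nat, t <= k%:R.
  by exists (Num.truncn t).+1; rewrite ltW// truncnS_gt.
have [C CP] := nu_bdd k.
apply: (@is_cvg_ultra _ _ C); apply: filterS CP => n CP.
by rewrite ger0_norm// (le_trans _ CP)// mono.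
Qed.

Let H_nd : {homo H : x y / x <= y}.
Proof.
move=> x y xy; apply: ler_lim; [exact: H_cvg|exact: H_cvg|].
by apply: filterE => n; exact: mono.
Qed.

Let H_le0 t : t <= 0 -> H t = 0.
Proof.
move=> t0; apply: (@cvg_lim _ (@Rhausdorff R)); apply: cvg_near_cst; apply: filterE => n.
rewrite (@eq_pairing _ _ _ (fun=> 0)); first by rewrite /pairing Rintegral_cst// mul0r.
by move=> s s0; rewrite belowE// ltNge (le_trans t0).
Qed.

(** Helly's selection theorem along the ultrafilter. Riemann sums of [nu n] on a fixed grid converge
    to the sum built on [H]. That sum is a Riemann sum of [mu] for a partition that shares out the
    atoms at grid points, so the grid need not avoid the discontinuities of [H]. *)
Lemma vague_ultralimit : exists mu : radon R, forall f, vague_test f ->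
  pairing (nu n) f @[n --> nat_ultra] --> pairing mu f.
Proof.
pose mu := radon_stieltjes H_nd H_le0; exists mu => f fV.
have [C [a0 fS0]] := vague_test_bounded fV.
pose a : R := `|a0|.
have fS : bounded_support C a f.
  by apply: bounded_support_le fS0 => //; exact: ler_norm.
have [theta thP] := @choice _ _ (fun t theta => 0 <= theta <= 1 /\ pairing mu
    (fun s => (1 - theta) * below t s + theta * \1_(`[0, t]%classic) s) = H t)
  (stieltjes_interpolation H_nd H_le0).
apply/cvgrPdist_le => e e0.
have a2 : 0 <= a + 2 by rewrite /a addr_ge0.
have HA0 : 0 <= H (a + 2) by rewrite -(H_le0 (lexx 0)); exact: H_nd.
(* The masses involved are eventually at most [H (a + 2) + 1], so each approximation error is at
   most [e/4]. *)
pose e' := e / (4 * (H (a + 2) + 1)).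
have e'0 : 0 < e' by rewrite divr_gt0// mulr_gt0// ltr_wpDl.
have [d d0 dP] := vague_test_unif fV e'0.
have [k kd] : exists k, k.+1%:R^-1 < d.
  have [k _ /(_ k (leqnn k))] := near_infty_natSinv_lt (PosNum d0).
  by exists k.
pose h : R := k.+1%:R^-1.
have h0 : 0 < h by rewrite invr_gt0 ltr0n.
pose M := (Num.truncn (a * k.+1%:R)).+1.
have aM : a < M%:R * h by rewrite /h ltr_pdivlMr ?ltr0n// truncnS_gt.
have Ma : M%:R * h <= a + 1.
  rewrite /h ler_pdivrMr ?ltr0n// mulrDl mul1r /M -[X in X <= _]natr1 lerD//.
    by rewrite truncn_le// /a mulr_ge0.
  by rewrite ler1n.
have le_h (i j : nat) : (i <= j)%N -> i%:R * h <= j%:R * h.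
  by move=> ij; rewrite ler_pM2r// ler_nat.
have lt_h (i : nat) : i%:R * h < i.+1%:R * h by rewrite ltr_pM2r// ltr_nat.
(* The indicator of [0,t) plus the fraction [th t] of the point [t]: with [th = 0] it is [below],
   for [nu n]; with the interpolating fractions its pairing with [mu] is [H t]. *)
pose psi (th : R -> R) t s : R := (1 - th t) * below t s + th t * \1_(`[0, t]%classic) s.
have ccE (t s : R) : 0 <= s -> \1_(`[0, t]%classic) s = (s <= t)%R%:R :> R.
  move=> s0; rewrite indicE; congr ((nat_of_bool _)%:R); apply/idP/idP.
    by move/set_mem; rewrite /= in_itv/= => /andP[].
  by move=> st; apply/mem_set; rewrite /= in_itv/= s0.
have psi_below th t s : 0 <= s -> s < t -> psi th t s = 1.
  by move=> s0 st; rewrite /psi belowE// ccE// st (ltW st) !mulr1 subrK.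
have psi_above th t s : 0 <= s -> t < s -> psi th t s = 0.
  by move=> s0 ts; rewrite /psi belowE// ccE// !leNgt ts (ltNge s) (ltW ts) !mulr0 addr0.
have psi01 th t s : (forall t, 0 <= th t <= 1) -> 0 <= s -> 0 <= psi th t s <= 1.
  move=> th01 s0; have /andP[th0 th1] := th01 t; have [st|ts|st] := ltgtP s t.
  - by rewrite psi_below// lexx ler01.
  - by rewrite psi_above// lexx ler01.
  - by rewrite /psi belowE// ccE// st ltxx lexx mulr0 add0r mulr1 th0.
have T (lam : radon R) (th : R -> R) : (forall t, 0 <= th t <= 1) -> th 0 = 0 ->
   `|pairing lam f - \sum_(0 <= i < M) f (i%:R * h) *
      (pairing lam (psi th (i.+1%:R * h)) - pairing lam (psi th (i%:R * h)))| <=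
      e' * pairing lam (psi th (M%:R * h)).
  move=> th01 th0.
  have := @pairing_telescope _ lam f (fun i => psi th ((minn i M)%:R * h)) M h C a e' (M%:R * h) fS.
  rewrite minnn (_ : \sum_(0 <= i < M) _ = \sum_(0 <= i < M) f (i%:R * h) *
      (pairing lam (psi th (i.+1%:R * h)) - pairing lam (psi th (i%:R * h)))).
    apply.
    - move=> i; split.
      + apply: measurable_funD; apply: measurable_funM => //; exact: measurable_indic.
      + by move=> s s0; have /andP[p0 p1] := psi01 th ((minn i M)%:R * h) s th01 s0; rewrite ger0_norm.
      + move=> s s0 Ns; apply: psi_above => //; apply: le_lt_trans Ns; apply: le_h.
        exact: geq_minr.
    - by move=> s s0; rewrite min0n mul0r /psi below0// th0; ring.
    - move=> i s s0 /=; have [iM|Mi] := ltnP i M; last first.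
        by rewrite !(minn_idPr _)// (leq_trans Mi).
      rewrite (minn_idPl iM) ?(minn_idPl (ltnW iM)).
      have [si|si] := ltP s (i.+1%:R * h).
        by rewrite [leRHS]psi_below//; have /andP[] := psi01 th (i%:R * h) s th01 s0.
      rewrite [leLHS]psi_above ?(lt_le_trans (lt_h i))//.
      by have /andP[] := psi01 th (i.+1%:R * h) s th01 s0.
    - by move=> s /andP[s0 sa]; rewrite psi_below// (le_lt_trans sa aM).
    - move=> i s s0 /=; have [iM|Mi] := ltnP i M; last first.
        by rewrite !(minn_idPr _) ?eqxx// (leq_trans Mi).
      rewrite (minn_idPl iM) ?(minn_idPl (ltnW iM)) => si.
      apply: dP => //; first by rewrite mulr_ge0// ltW.
      apply: le_lt_trans kd; move: si; have [si|si] := ltP s (i%:R * h).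
        by rewrite !psi_below ?eqxx// (lt_trans si).
      have [si'|si' _] := ltP (i.+1%:R * h) s.
        by rewrite !psi_above ?eqxx// (lt_trans (lt_h i)).
      by rewrite ger0_norm ?subr_ge0// lerBlDl -/h; move: si'; rewrite -natr1 mulrDl mul1r.
  apply: eq_big_nat => i /andP[_ iM].
  by rewrite !(minn_idPl _)// ltnW.
have psi0 (lam : radon R) t : pairing lam (psi (fun=> 0) t) = pairing lam (below t).
  by apply: eq_pairing => s _; rewrite /psi subr0 mul1r mul0r addr0.
(* The telescoping sum has to start from the zero function, so the point 0 must not be counted at
   [t = 0]; there [H] vanishes anyway. *)
pose th' t := if t <= 0 then 0 else theta t.
have th'01 t : 0 <= th' t <= 1.
  by rewrite /th'; case: ifP => _; [rewrite lexx ler01|have [] := thP t].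
have muH t : pairing mu (psi th' t) = H t.
  rewrite /psi /th'; case: ifPn => [t0|_]; last by have [] := thP t.
  rewrite H_le0// (@eq_pairing _ _ _ (fun=> 0)); first by rewrite /pairing Rintegral_cst// mul0r.
  by move=> s s0; rewrite belowE// ltNge (le_trans t0)// mulr0 mul0r addr0.
have th'0 : th' 0 = 0 by rewrite /th' lexx.
have := T mu th' th'01 th'0; rewrite muH.
under eq_bigr do rewrite !muH.
set S := \sum_(0 <= i < M) _ => hmu.
have Scvg : \sum_(0 <= i < M) f (i%:R * h) * (pairing (nu n) (below (i.+1%:R * h)) -
    pairing (nu n) (below (i%:R * h))) @[n --> nat_ultra] --> S.
  apply: cvg_sumr => i; apply: cvgM; first exact: cvg_cst.
  by apply: cvgB; exact: H_cvg.
have HM : H (M%:R * h) <= H (a + 2).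
  by apply: H_nd; rewrite (le_trans Ma)// lerD2l ler1n.
have tri (x s t y : R) : `|x - s| <= e / 4 -> `|s - t| <= e / 4 -> `|y - t| <= e / 4 ->
    `|x - y| <= e.
  rewrite !ler_norml => /andP[? ?] /andP[? ?] /andP[? ?].
  by apply/andP; split; lra.
have e4 : 0 < e / 4 by rewrite divr_gt0.
have ee' : e' * (H (a + 2) + 1) = e / 4 by rewrite /e'; field; rewrite gt_eqF// ltr_wpDl.
near=> n.
have h1 : `|S - \sum_(0 <= i < M) f (i%:R * h) * (pairing (nu n) (below (i.+1%:R * h)) -
    pairing (nu n) (below (i%:R * h)))| <= e / 4.
  by near: n; move/cvgrPdist_le: Scvg => /(_ _ e4).
have h2 : `|H (M%:R * h) - pairing (nu n) (below (M%:R * h))| <= 1.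
  by near: n; move/cvgrPdist_le: (@H_cvg (M%:R * h)) => /(_ _ ltr01).
have z01 : 0 <= (0 : R) <= 1 by rewrite lexx ler01.
have := T (nu n) (fun=> 0) (fun=> z01) erefl; rewrite psi0.
under eq_bigr do rewrite !psi0.
move: h1; set Sn := \sum_(0 <= i < M) _ => h1 h3.
have h4 : e' * pairing (nu n) (below (M%:R * h)) <= e / 4.
  rewrite -ee' ler_wpM2l ?(ltW e'0)//.
  apply: (@le_trans _ _ (H (M%:R * h) + 1)); last by rewrite lerD2r.
  by move: h2; rewrite ler_norml lerBrDr addrC lerBlDr => /andP[].
have h5 : e' * H (M%:R * h) <= e / 4 by rewrite -ee' ler_wpM2l ?(ltW e'0)// (le_trans HM)// lerDl.
exact: tri (le_trans hmu h5) h1 (le_trans h3 h4).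
Unshelve. all: by end_near. Qed.

End vague_ultralimit.

(** * The cumulant equation *)

Section branching_mechanism.
Variables (R : realType) (b sigma : R) (m : {measure set R -> \bar R}).
Hypothesis mfin : (\int[m]_(z in `]0%R, +oo[) (Num.min z (z ^+ 2))%:E < +oo)%E.

Let D : set R := `]0, +oo[%classic.
Let k (l z : R) : R := expR (- (z * l)) - 1 + z * l.
Let w (z : R) : R := Num.min z (z ^+ 2).

Let mD : measurable D. Proof. exact: measurable_itv. Qed.

Let w_ge0 z : D z -> 0 <= w z.
Proof. by rewrite /D/= in_itv/= andbT => z0; rewrite le_min (ltW z0) sqr_ge0. Qed.

Let mk l : measurable_fun D (k l).
Proof.
apply: measurable_funTS; apply: measurable_funD; last exact: measurable_funM.
apply: measurable_funB => //; apply: measurableT_comp => //.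
by apply: measurableT_comp => //; exact: measurable_funM.
Qed.

Let w_int : m.-integrable D (EFin \o w).
Proof.
apply/integrableP; split.
  apply/measurable_EFinP; apply: measurable_funTS.
  rewrite (_ : w = fun z => Num.min z (z * z)); last by apply/funext => z; rewrite /w expr2.
  by apply: measurable_minr => //; exact: measurable_funM.
rewrite (eq_integral (fun z => (w z)%:E)) // => z; rewrite inE => Dz.
by rewrite /= ger0_norm ?w_ge0.
Qed.

Let k0 z : k 0 z = 0.
Proof. by rewrite /k mulr0 oppr0 expR0 subrr addr0. Qed.

(** The derivative of [k] in [l] is [z (1 - e^{-zl})], which is at most both [z] and [z^2 l]; so one
    integrable function [w] controls the increments for all arguments up to [C]. *)
Let k_incr (C l l' z : R) : D z -> 0 <= l -> l <= l' -> l' <= C ->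
  0 <= k l' z - k l z <= Num.max 1 C * (l' - l) * w z.
Proof.
rewrite /D/= in_itv/= andbT => z0 l0 ll' lC.
pose d := z * (l' - l).
have d0 : 0 <= d by rewrite mulr_ge0 ?subr_ge0// ltW.
have kE : k l' z - k l z = d - expR (- (z * l)) * (1 - expR (- d)).
  rewrite /k mulrBr mulr1 -expRD (_ : - (z * l) + - d = - (z * l')); last by rewrite /d; ring.
  by rewrite /d; ring.
have e1 : 0 <= 1 - expR (- d) by rewrite subr_ge0 -[leRHS]expR0 ler_expR oppr_le0.
have ed : 1 - expR (- d) <= d by have := expR_ge1Dx (- d); lra.
have zl0 : 0 <= z * l by rewrite mulr_ge0// ltW.
have el1 : expR (- (z * l)) <= 1 by rewrite -[leRHS]expR0 ler_expR oppr_le0.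
have el0 : 0 <= expR (- (z * l)) by exact: expR_ge0.
apply/andP; split.
  rewrite kE subr_ge0; apply: le_trans ed.
  by rewrite ler_piMl.
have C0 : 0 <= C by rewrite (le_trans l0)// (le_trans ll').
have M1 : 1 <= Num.max 1 C by rewrite le_max lexx.
have MC : C <= Num.max 1 C by rewrite le_max lexx orbT.
rewrite kE /w; have [zz|zz] := leP z (z ^+ 2).
  apply: (@le_trans _ _ d); first by rewrite lerBlDr lerDl mulr_ge0.
  by rewrite /d mulrC ler_wpM2r ?(ltW z0)// ler_peMl// subr_ge0.
(* [e^{-zl}(1 - e^{-d}) >= e^{-zl} d e^{-d} = d e^{-zl'} >= d (1 - zl')]. *)
have h1 : d * expR (- d) <= 1 - expR (- d).
  have h : expR (- d) * (1 + d) <= 1.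
    apply: (@le_trans _ _ (expR (- d) * expR d)); last by rewrite -expRD addNr expR0.
    by rewrite ler_wpM2l ?expR_ge0// expR_ge1Dx.
  by move: h; rewrite mulrDr mulr1 [expR _ * d]mulrC; lra.
have h2 : d * (1 - z * l') <= expR (- (z * l)) * (1 - expR (- d)).
  apply: le_trans (ler_wpM2l el0 h1).
  rewrite mulrCA -expRD (_ : - (z * l) + - d = - (z * l')); last by rewrite /d; ring.
  by rewrite ler_wpM2l//; have := expR_ge1Dx (- (z * l')); lra.
apply: (@le_trans _ _ (d * (z * l'))); first by move: h2; rewrite mulrBr mulr1; lra.
rewrite (_ : d * (z * l') = l' * (l' - l) * z ^+ 2); last by rewrite /d; ring.
rewrite ler_wpM2r ?sqr_ge0// ler_wpM2r ?subr_ge0//.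
exact: le_trans MC.
Qed.

Let k_int l : 0 <= l -> m.-integrable D (EFin \o k l).
Proof.
move=> l0.
have wZ : m.-integrable D (EFin \o (fun z => (Num.max 1 l * l) * w z)).
  rewrite (_ : EFin \o _ = (fun z => (Num.max 1 l * l)%:E * (w z)%:E)%E).
    by apply: integrableZl => //; exact: mD.
  by apply/funext => z; rewrite /= EFinM.
apply: le_integrable wZ => //; first exact/measurable_EFinP.
move=> z Dz; have := k_incr Dz (lexx 0) l0 (lexx l); rewrite k0 !subr0 => /andP[h1 h2].
by rewrite /= lee_fin ger0_norm// (le_trans h2)// ler_norm.
Qed.

Let Phi l := \int[m]_(z in D) k l z.

Let Phi_ge0 l : 0 <= l -> 0 <= Phi l.
Proof.
move=> l0; apply: Rintegral_ge0 => z Dz.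
by have := k_incr Dz (lexx 0) l0 (lexx l); rewrite k0 !subr0 => /andP[].
Qed.

Let Phi_lip C l l' : 0 <= l -> l <= l' -> l' <= C ->
  `|Phi l' - Phi l| <= Num.max 1 C * \int[m]_(z in D) w z * (l' - l).
Proof.
move=> l0 ll' lC; have l'0 := le_trans l0 ll'.
have wZ : m.-integrable D (EFin \o (fun z => (Num.max 1 C * (l' - l)) * w z)).
  rewrite (_ : EFin \o _ = (fun z => (Num.max 1 C * (l' - l))%:E * (w z)%:E)%E).
    by apply: integrableZl => //; exact: mD.
  by apply/funext => z; rewrite /= EFinM.
have kI : m.-integrable D (EFin \o (fun z => k l' z - k l z)).
  rewrite (_ : EFin \o _ = ((EFin \o k l') \- (EFin \o k l))%E).
    by apply: integrableB; [exact: mD|exact: k_int|exact: k_int].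
  by apply/funext => z; rewrite /= EFinB.
rewrite /Phi -(RintegralB _ (k_int l'0) (k_int l0))//.
apply: (le_trans (le_normr_Rintegral _ kI)) => //.
rewrite mulrAC -(RintegralZl _ _ w_int)//.
apply: le_Rintegral => //.
  rewrite (_ : EFin \o _ = abse \o (EFin \o (fun z => k l' z - k l z)))//.
  exact: integrable_abse.
by move=> z Dz; have /andP[? ?] := k_incr Dz l0 ll' lC; rewrite ger0_norm.
Qed.

Lemma branching_mechanism0 : branching_mechanism b sigma m 0 = 0.
Proof.
rewrite /branching_mechanism mulr0 expr0n/= mulr0 mul0r !add0r.
under eq_Rintegral do rewrite -/(k 0 _) k0.
by rewrite Rintegral_cst// mul0r.
Qed.

Lemma branching_mechanism_ge l : 0 <= l -> b * l <= branching_mechanism b sigma m l.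
Proof.
move=> l0; rewrite /branching_mechanism -addrA lerDl addr_ge0//; last exact: Phi_ge0.
by rewrite divr_ge0// mulr_ge0 ?sqr_ge0.
Qed.

Lemma branching_mechanism_lipschitz C : 0 <= C -> exists2 L, 0 <= L &
  forall l l', 0 <= l <= C -> 0 <= l' <= C ->
    `|branching_mechanism b sigma m l - branching_mechanism b sigma m l'| <=
    L * `|l - l'|.
Proof.
move=> C0; pose M := Num.max 1 C * \int[m]_(z in D) w z.
have M0 : 0 <= M.
  by rewrite mulr_ge0 ?le_max ?ler01//; apply: Rintegral_ge0; exact: w_ge0.
exists (`|b| + sigma ^+ 2 * C + M).
  by rewrite !addr_ge0// mulr_ge0// sqr_ge0.
move=> l l' /andP[l0 lC] /andP[l'0 l'C]; wlog ll : l l' l0 lC l'0 l'C / l' <= l.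
  move=> W; have [/W->//|/ltW/W] := leP l' l.
  by rewrite distrC (distrC l'); exact.
rewrite (_ : _ - _ = b * (l - l') + sigma ^+ 2 * (l - l') * ((l + l') / 2) +
    (Phi l - Phi l')); last by rewrite /branching_mechanism -/(Phi l) -/(Phi l'); field.
have ll0 : 0 <= l - l' by rewrite subr_ge0.
apply: le_trans (ler_normD _ _) _; rewrite (ger0_norm ll0) [leRHS]mulrDl [X in _ <= X + _]mulrDl lerD//.
  apply: le_trans (ler_normD _ _) _; rewrite lerD//.
    by rewrite normrM (ger0_norm ll0).
  rewrite ger0_norm; last by rewrite mulr_ge0 ?divr_ge0 ?addr_ge0// mulr_ge0// sqr_ge0.
  by rewrite mulrAC ler_wpM2r// ler_wpM2l ?sqr_ge0//; lra.
exact: Phi_lip.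
Qed.

End branching_mechanism.

(** * Tail integrals and Gronwall's lemma *)

Section tail_integral.
Variable R : realType.
Implicit Types (f g : R -> R) (C a s : R).

Definition tail f s : R := \int[@lebesgue_measure R]_(t in `]s, +oo[) f t.

Let sub0 s : 0 <= s -> `]s, +oo[%classic `<=` (`[0, +oo[%classic : set R).
Proof.
by move=> s0 t; rewrite /= !in_itv/= !andbT => /ltW; exact: le_trans.
Qed.

Let int C a f s : 0 <= s -> bounded_support C a f ->
  (@lebesgue_measure R).-integrable `]s, +oo[%classic (EFin \o f).
Proof. by move=> s0 fS; apply: lebesgue_bounded_support_integrable fS => //; exact: sub0. Qed.

Lemma tailD C a C' a' f g s : 0 <= s -> bounded_support C a f ->
  bounded_support C' a' g -> tail (fun t => f t + g t) s = tail f s + tail g s.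
Proof. by move=> s0 fS gS; rewrite /tail RintegralD//; [exact: int fS|exact: int gS]. Qed.

Lemma tailB C a C' a' f g s : 0 <= s -> bounded_support C a f ->
  bounded_support C' a' g -> tail (fun t => f t - g t) s = tail f s - tail g s.
Proof. by move=> s0 fS gS; rewrite /tail RintegralB//; [exact: int fS|exact: int gS]. Qed.

Lemma tailZ k C a f s : 0 <= s -> bounded_support C a f ->
  tail (fun t => k * f t) s = k * tail f s.
Proof. by move=> s0 fS; rewrite /tail RintegralZl//; exact: int fS. Qed.

Lemma le_tail C a C' a' f g s : 0 <= s -> bounded_support C a f ->
  bounded_support C' a' g -> (forall t, s < t -> f t <= g t) -> tail f s <= tail g s.
Proof.
move=> s0 fS gS fg; apply: le_Rintegral => //; [exact: int fS|exact: int gS|].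
by move=> t; rewrite /= in_itv/= andbT; exact: fg.
Qed.

Lemma ler_norm_tail C a f s : 0 <= s -> bounded_support C a f ->
  `|tail f s| <= tail (fun t => `|f t|) s.
Proof. by move=> s0 fS; apply: le_normr_Rintegral => //; exact: int fS. Qed.

Lemma tail_split C a f s t : 0 <= s -> s <= t -> bounded_support C a f ->
  tail f s = \int[@lebesgue_measure R]_(x in `]s, t]) f x + tail f t.
Proof.
move=> s0 st fS.
have := @Rintegral_itvB R f (BRight s) +oo%O t (int s0 fS).
rewrite !bnd_simp => /(_ st isT) E.
by rewrite /tail -E addrC subrK.
Qed.

Lemma tail_lipschitz C a f s t : 0 <= s -> s <= t -> bounded_support C a f ->
  `|tail f s - tail f t| <= C * (t - s).
Proof.
move=> s0 st fS; rewrite (tail_split s0 st fS) addrK.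
have sub : `]s, t]%classic `<=` (`[0, +oo[%classic : set R).
  by move=> x; rewrite /= !in_itv/= andbT => /andP[/ltW + _]; exact: le_trans.
have fi : (@lebesgue_measure R).-integrable `]s, t]%classic (EFin \o f).
  exact: lebesgue_bounded_support_integrable fS.
apply: (le_trans (le_normr_Rintegral _ fi)) => //.
have muE : fine (@lebesgue_measure R `]s, t]%classic) = t - s.
  rewrite lebesgue_measure_itv/= lte_fin; case: ltP => // ts.
  by rewrite (le_anti (_ : s <= t <= s)) ?subrr// st.
have mufin : (@lebesgue_measure R `]s, t]%classic < +oo)%E.
  by rewrite lebesgue_measure_itv/=; case: ifP => _; rewrite ?ltry.
have cfin : (@lebesgue_measure R).-integrable `]s, t]%classic (EFin \o (fun=> C)).
  apply: (@bounded_on_integrable _ _ _ (@lebesgue_measure R) _ `]s, t]%classic `|C|) => //.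
have afi : (@lebesgue_measure R).-integrable `]s, t]%classic (EFin \o (fun x => `|f x|)).
  exact: lebesgue_bounded_support_integrable (bounded_support_norm fS).
rewrite -muE -Rintegral_cst//; apply: le_Rintegral => // x /sub.
by rewrite /= in_itv/= andbT; have [_ + _] := fS; exact.
Qed.

Lemma tail_le C a f s : 0 <= s -> s <= a -> bounded_support C a f ->
  `|tail f s| <= C * (a - s).
Proof.
move=> s0 sa fS; have := tail_lipschitz s0 sa fS.
rewrite [X in _ - X](@eq_Rintegral _ _ _ _ _ (fun=> 0)) ?Rintegral_cst// ?mul0r ?subr0//.
move=> t; rewrite inE/= in_itv/= andbT => ta; have [_ _ fa] := fS.
by rewrite fa// (le_trans s0)// (le_trans sa)// ltW.
Qed.

Lemma tail_eq0 C a f s : 0 <= s -> a <= s -> bounded_support C a f -> tail f s = 0.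
Proof.
move=> s0 sa [_ _ fa]; rewrite /tail (@eq_Rintegral _ _ _ _ _ (fun=> 0)).
  by rewrite Rintegral_cst// mul0r.
move=> t; rewrite inE/= in_itv/= andbT => ta.
by rewrite fa// ?(le_trans s0)// ?(le_lt_trans sa)// ltW.
Qed.

Lemma tail_ge0 f s : 0 <= s -> (forall t, 0 <= t -> 0 <= f t) -> 0 <= tail f s.
Proof.
move=> s0 f0; apply: Rintegral_ge0 => t; rewrite /= in_itv/= andbT => st.
by rewrite f0// (le_trans s0)// ltW.
Qed.

Lemma tail_mono C a f s t : 0 <= s -> s <= t -> bounded_support C a f ->
  (forall t, 0 <= t -> 0 <= f t) -> tail f t <= tail f s.
Proof.
move=> s0 st fS f0; rewrite (tail_split s0 st fS) lerDr.
apply: Rintegral_ge0 => x; rewrite /= in_itv/= => /andP[sx _].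
by rewrite f0// (le_trans s0)// ltW.
Qed.

Lemma bounded_support_expR (B A : R) :
  bounded_support (expR (`|B| * `|A|)) A
    (fun t => expR (B * (A - t)) * \1_(`[0, A]%classic) t).
Proof.
have mI : measurable_fun setT (\1_(`[0, A]%classic) : R -> R) by exact: measurable_indic.
split.
- apply: measurable_funTS; apply: measurable_funM => //; apply: measurableT_comp => //.
  by apply: measurable_funM => //; exact: measurable_funB.
- move=> s s0; rewrite ger0_norm ?mulr_ge0 ?expR_ge0 ?indicE//.
  have [sA|sA] := leP s A; last first.
    by rewrite memNset ?mulr0 ?expR_ge0//= in_itv/= s0/= leNgt sA.
  rewrite mem_set ?mulr1/= ?in_itv/= ?s0// ler_expR.
  apply: le_trans (ler_norm _) _; rewrite normrM ler_wpM2l//.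
  by rewrite !ger0_norm ?subr_ge0 ?(le_trans s0 sA)// lerBlDr lerDl.
- by move=> s s0 sA; rewrite indicE memNset ?mulr0//= in_itv/= s0/= leNgt sA.
Qed.

(** The fundamental theorem of calculus; the truncation at [A] keeps the exponential among the
    functions of bounded support. *)
Lemma tail_expR (B A s : R) : 0 <= s -> s <= A ->
  B * tail (fun t => expR (B * (A - t)) * \1_(`[0, A]%classic) t) s <=
  expR (B * (A - s)) - 1.
Proof.
move=> s0; rewrite le_eqVlt => /predU1P[sA|sA].
  rewrite sA in s0 *.
  rewrite (tail_eq0 s0 (lexx A) (bounded_support_expR B A)).
  by rewrite subrr !mulr0 expR0 subrr.
have A0 := le_trans s0 (ltW sA).
rewrite (tail_split s0 (ltW sA) (bounded_support_expR B A)).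
rewrite (tail_eq0 A0 (lexx A) (bounded_support_expR B A)) addr0.
pose F (t : R) := - expR (B * (A - t)).
have dF (t : R) : is_derive t 1 F (B * expR (B * (A - t))).
  have d1 : is_derive t 1 (fun t : R => B * (A - t)) (- B).
    have : is_derive t 1 (B \*: (cst A - id : R -> R)) (B *: (0 - 1)) by exact: is_deriveZ.
    by rewrite sub0r scalerN -[B *: 1]/(B * 1) mulr1.
  have := is_deriveN (@is_derive1_comp _ expR (fun t => B * (A - t)) t _ _
    (is_derive_expR (B * (A - t))) d1).
  by rewrite -mulrN opprK mulrC.
have cont (t : R) : {for t, continuous (fun t => B * expR (B * (A - t)))}.
  apply: cvgM; first exact: cvg_cst.
  apply: continuous_cvg; first exact: continuous_expR.
  apply: cvgM; first exact: cvg_cst.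
  by apply: cvgB; [exact: cvg_cst|exact: cvg_id].
have := @continuous_FTC2 R (fun t => B * expR (B * (A - t))) F s A sA.
rewrite /F subrr mulr0 expR0 -EFinB opprK => h.
rewrite -RintegralZl//; last first.
  apply: lebesgue_bounded_support_integrable (bounded_support_expR B A) => //.
  by move=> t; rewrite /= !in_itv/= andbT => /andP[/ltW + _]; exact: le_trans.
rewrite [leLHS](_ : _ = \int[@lebesgue_measure R]_(t in `]s, A]) (B * expR (B * (A - t)))); last first.
  apply: eq_Rintegral => t; rewrite inE/= in_itv/= => /andP[st tA].
  by rewrite indicE mem_set ?mulr1//= in_itv/= tA (le_trans s0)// ltW.
have cF (t : R) : F x @[x --> t] --> F t.
  apply: cvgN; apply: continuous_cvg; first exact: continuous_expR.
  apply: cvgM; first exact: cvg_cst.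
  by apply: cvgB; [exact: cvg_cst|exact: cvg_id].
have cc : {within `[s, A]%classic, continuous (fun t => B * expR (B * (A - t)))}.
  exact: continuous_subspaceT.
rewrite Rintegral_itv_obnd_cbnd; last first.
  have ic := continuous_compact_integrable (@segment_compact R s A) cc.
  apply: integrableS ic => //.
  by move=> t; rewrite /= !in_itv/= => /andP[/ltW -> ->].
rewrite /Rintegral h//=.
- by rewrite addrC.
- split.
  + by move=> t _; have [] := dF t.
  + by apply: cvg_at_right_filter; exact: (cF s).
  + by apply: cvg_at_left_filter; exact: (cF A).
- by move=> t _; rewrite derive1E; have [_ ->] := dF t.
Qed.

(** Let [K] be the supremum of [v s e^{-2B(A-s)}] over [s0,A]. With the rate [2 B] in place of [B]
    the integral term contributes at most [K/2], so that [K <= e + K/2] and [K <= 2 e], without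
    iteration. The starting point [s0] lets the inequality be used beyond the support of [f]
    alone. *)
Lemma gronwall (v : R -> R) (C A B e s0 : R) : bounded_support C A v ->
  0 <= s0 -> 0 <= B -> 0 <= e -> (forall s, 0 <= s -> 0 <= v s) ->
  (forall s, s0 <= s -> v s <= e + B * tail v s) ->
  forall s, s0 <= s -> s <= A -> v s <= 2 * e * expR (2 * B * (A - s)).
Proof.
move=> vS s00 B0 e0 v0 vle.
pose E := [set v s * expR (- (2 * B * (A - s))) | s in [set s | s0 <= s <= A]].
have [_ vC va] := vS.
have C0 : 0 <= C by apply: le_trans (vC 0 (lexx 0)).
have ub : has_ubound E.
  exists C => _ [s /= /andP[ss sA] <-]; have s0' := le_trans s00 ss.
  rewrite -[leRHS]mulr1 ler_pM ?v0 ?expR_ge0//.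
    by rewrite (le_trans (ler_norm _))// vC.
  by rewrite -[leRHS]expR0 ler_expR oppr_le0 !mulr_ge0// subr_ge0.
have expK s : expR (- (2 * B * (A - s))) * expR (2 * B * (A - s)) = 1.
  by rewrite -expRD addNr expR0.
move=> s1 ss1 s1A.
have E0 : E !=set0 by eexists; exists s1 => //=; rewrite ss1.
set K := sup E.
have vK s : s0 <= s -> s <= A -> v s <= K * expR (2 * B * (A - s)).
  move=> ss sA.
  have -> : v s = v s * expR (- (2 * B * (A - s))) * expR (2 * B * (A - s)).
    by rewrite -mulrA expK mulr1.
  rewrite ler_wpM2r ?expR_ge0//.
  by apply: ub_le_sup => //; exists s => //=; rewrite ss.
have K0 : 0 <= K.
  apply: le_trans (ub_le_sup ub (ex_intro2 _ _ s1 _ erefl)); last by rewrite /= ss1.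
  by rewrite mulr_ge0 ?v0 ?expR_ge0// (le_trans s00).
have BK s : s0 <= s -> s <= A -> v s * expR (- (2 * B * (A - s))) <= e + K / 2.
  move=> ss sA; have s0' := le_trans s00 ss.
  pose g t := expR (2 * B * (A - t)) * \1_(`[0, A]%classic) t.
  have gS' := bounded_support_expR (2 * B) A.
  have tl : tail v s <= K * tail g s.
    rewrite -(tailZ K s0' gS'); apply: (le_tail s0' vS (bounded_supportZ K gS')) => t st.
    have t0 : 0 <= t by rewrite (le_trans s0')// ltW.
    have [tA|tA] := leP t A; last by rewrite va// /g indicE memNset ?mulr0//= in_itv/= t0/= leNgt tA.
    by rewrite /g indicE mem_set ?mulr1 ?vK// ?(le_trans ss) ?ltW//= in_itv/= t0.
  have := @tail_expR (2 * B) A s s0' sA; rewrite -/g => hg.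
  have : v s <= e + K / 2 * expR (2 * B * (A - s)).
    apply: (le_trans (vle s ss)); rewrite lerD2l.
    apply: (le_trans (ler_wpM2l B0 tl)).
    rewrite mulrCA -mulrA ler_wpM2l//; move: hg; rewrite -mulrA; lra.
  rewrite -(ler_pM2r (expR_gt0 (- (2 * B * (A - s))))) => h; apply: (le_trans h).
  have XY := expK s; set X := expR (- _) in XY *; set Y := expR _ in XY *.
  have -> : (e + K / 2 * Y) * X = e * X + K / 2 * (X * Y) by ring.
  rewrite XY mulr1 lerD2r.
  by rewrite ler_piMr// /X -[leRHS]expR0 ler_expR oppr_le0 !mulr_ge0// subr_ge0.
have Ke : K <= e + K / 2.
  by apply: ge_sup => // _ [s /= /andP[ss sA] <-]; exact: BK.
apply: (le_trans (vK s1 ss1 s1A)); rewrite ler_wpM2r ?expR_ge0//; lra.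
Qed.

End tail_integral.

(** * A priori bounds and stability for the cumulant equation *)

Section cumulant.
Variables (R : realType) (phi : R -> R) (b : R).
Hypotheses (phi0 : phi 0 = 0) (phi_ge : forall l, 0 <= l -> b * l <= phi l).
Hypothesis phi_lip : forall C, 0 <= C -> exists2 L, 0 <= L &
  forall l l', 0 <= l <= C -> 0 <= l' <= C -> `|phi l - phi l'| <= L * `|l - l'|.
Implicit Types (f u v : R -> R).

Lemma lipschitz_continuous (f : R -> R) (L : R) : 0 <= L ->
  (forall x y, `|f x - f y| <= L * `|x - y|) -> continuous f.
Proof.
move=> L0 fL x; apply/cvgrPdist_lt => e e0.
have d0 : 0 < e / (L + 1) by rewrite divr_gt0// ltr_wpDl.
near=> y; apply: (le_lt_trans (fL x y)).
have xy : `|x - y| < e / (L + 1) by near: y; exact: (nbhsx_ballx x _ d0).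
apply: (@le_lt_trans _ _ ((L + 1) * `|x - y|)); first by rewrite ler_wpM2r// lerDl.
by rewrite mulrC -ltr_pdivlMr// ltr_wpDl.
Unshelve. all: by end_near. Qed.

Lemma phi_comp C : 0 <= C -> exists2 L, 0 <= L &
  (forall l l', 0 <= l <= C -> 0 <= l' <= C -> `|phi l - phi l'| <= L * `|l - l'|) /\
  (forall a v, bounded_support C a v -> (forall s, 0 <= s -> 0 <= v s) ->
    bounded_support (L * C) a (phi \o v)).
Proof.
move=> C0; have [L L0 LP] := phi_lip C0; exists L => //; split => // a v [mv vC va] v0.
have vI s : 0 <= s -> 0 <= v s <= C.
  by move=> s0; rewrite v0//= (le_trans (ler_norm _))// vC.
split.
(* [phi] is controlled on [0,C] only; precomposed with the projection onto [0,C] it is Lipschitz on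
   the whole line, hence measurable. *)
- pose cl (x : R) := Num.max 0 (Num.min x C).
  have clI x : 0 <= cl x <= C by rewrite le_max lexx/= ge_max C0 ge_min lexx orbT.
  have clL x y : `|cl x - cl y| <= `|x - y|.
    wlog xy : x y / x <= y.
      by move=> W; have [/W//|/ltW/W] := leP x y; rewrite distrC (distrC y).
    rewrite distrC (distrC x) !ger0_norm ?subr_ge0//.
      rewrite /cl /Num.max /Num.min.
      by case: (ltP y C) => ?; case: (ltP x C) => ?; do ?[case: ltP => ?]; lra.
    by rewrite /cl ge_max !le_max lexx/= le_min !ge_min xy lexx !orbT.
  have cphi : continuous (phi \o cl).
    apply: (@lipschitz_continuous _ L) => // x y.
    by rewrite (le_trans (LP _ _ (clI x) (clI y)))// ler_wpM2l.
  apply: (@eq_measurable_fun _ _ _ _ _ ((phi \o cl) \o v)).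
    move=> s; rewrite inE/= in_itv/= andbT => /vI/andP[v1 v2].
    by rewrite /cl (min_idPl v2) (max_idPr v1).
  apply: measurableT_comp => //; exact: continuous_measurable_fun.
- move=> s s0 /=; have := LP (v s) 0 (vI s s0); rewrite lexx C0 => /(_ isT).
  rewrite phi0 !subr0 => h; rewrite (le_trans h)// ler_wpM2l//.
  exact: vC.
- by move=> s s0 sa /=; rewrite va.
Qed.

Section solution.
Variables (f u : R -> R) (Cf a : R).
Hypotheses (a0 : 0 <= a) (fS : bounded_support Cf a f).
Hypothesis uP : cumulant_solution phi f u.

Let u0 s : 0 <= s -> 0 <= u s.
Proof. by case: uP => -[_ + _ _] _; exact. Qed.

Let Cf0 : 0 <= Cf.
Proof. by have [_ fC _] := fS; exact: le_trans (fC 0 (lexx 0)). Qed.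

(** As [u >= 0], the linear lower bound [b l <= phi l] is enough for a linear integral inequality,
    whatever the growth of [phi]. *)
Let u_le C A s : bounded_support C A u -> 0 <= s -> u s <= tail f s + `|b| * tail u s.
Proof.
move=> uS s0; have C0 : 0 <= C by have [_ uC _] := uS; exact: le_trans (uC 0 (lexx 0)).
have [L L0 [_ phiS]] := phi_comp C0.
have := phiS A u uS u0 => pS.
have E : u s + tail (phi \o u) s = tail f s := proj2 uP s s0.
rewrite -E -addrA lerDl -(tailZ _ s0 uS) -lerBlDr sub0r.
rewrite -[leLHS]mulN1r -(tailZ _ s0 (bounded_supportZ `|b| uS)).
apply: (le_tail s0 (bounded_supportZ (-1) (bounded_supportZ `|b| uS)) pS) => t st.
have t0 : 0 <= t by rewrite (le_trans s0)// ltW.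
apply: le_trans (phi_ge (u0 t0)); rewrite mulrA ler_wpM2r ?u0//.
by rewrite mulN1r lerNl; rewrite -normrN ler_norm.
Qed.

(** Bound and support depend on [f] only through [Cf] and [a]. Gronwall's lemma is used twice:
    beyond [a] with [e = 0], so that [u] vanishes there, then on [0,a] with [e = Cf a]. *)
Lemma cumulant_bound : bounded_support (2 * (Cf * a) * expR (2 * `|b| * a)) a u.
Proof.
have [[mu _ [C1 uC1] [A1 uA1]] _] := uP.
pose A := Num.max A1 a; pose C := `|C1|.
have uS : bounded_support C A u.
  split => // s s0; first by rewrite ger0_norm ?u0// (le_trans (uC1 _ s0))// ler_norm.
  by rewrite gt_max => /andP[sA _]; exact: uA1.
have ua s : a <= s -> u s = 0.
  move=> sa; have s0 := le_trans a0 sa.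
  have [sA|sA] := leP s A; last by have [_ _ ->] := uS.
  apply/eqP; rewrite eq_le u0// andbT.
  have -> : 0 = 2 * 0 * expR (2 * `|b| * (A - s)) by rewrite mulr0 mul0r.
  apply: (@gronwall R u C A `|b| 0 a) => // t ta.
  rewrite add0r; apply: le_trans (u_le uS (le_trans a0 ta)) _.
  by rewrite (tail_eq0 (le_trans a0 ta) ta fS) add0r.
have uS' : bounded_support C a u.
  by have [_ uC _] := uS; split => // s s0 /ltW; exact: ua.
split => // s s0; last by move=> /ltW; exact: ua.
have e0 : 0 <= Cf * a by rewrite mulr_ge0.
have [sa|sa] := leP s a; last by rewrite (ua _ (ltW sa)) normr0 mulr_ge0 ?expR_ge0 ?mulr_ge0.
rewrite ger0_norm ?u0//.
apply: (le_trans (@gronwall R u C a `|b| (Cf * a) 0 uS' (lexx 0) (normr_ge0 _) e0 u0 _ s s0 sa)).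
  move=> t t0; apply: le_trans (u_le uS' t0) _; rewrite lerD2r.
  have [ta|ta] := leP t a; last by rewrite (tail_eq0 t0 (ltW ta) fS).
  apply: le_trans (ler_norm _) _; apply: (le_trans (tail_le t0 ta fS)).
  by rewrite ler_wpM2l// lerBlDr lerDl.
by rewrite ler_wpM2l ?mulr_ge0// ler_expR ler_wpM2l ?mulr_ge0// lerBlDr lerDl.
Qed.

Lemma cumulant_tail s : 0 <= s -> u s = tail (fun t => f t - phi (u t)) s.
Proof.
move=> s0; have uS := cumulant_bound.
have C0 : 0 <= 2 * (Cf * a) * expR (2 * `|b| * a) by rewrite !mulr_ge0 ?expR_ge0.
have [L L0 [_ phiS]] := phi_comp C0.
rewrite (tailB s0 fS (phiS _ _ uS u0)).
have E : u s + tail (phi \o u) s = tail f s := proj2 uP s s0.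
by rewrite -E addrK.
Qed.

(** [u] is the tail integral of a bounded function. This regularity turns test functions [f] into
    test functions [flow p q f]. *)
Lemma cumulant_lipschitz : exists2 K, 0 <= K &
  forall s t, 0 <= s -> 0 <= t -> `|u s - u t| <= K * `|s - t|.
Proof.
have uS := cumulant_bound.
have C0 : 0 <= 2 * (Cf * a) * expR (2 * `|b| * a) by rewrite !mulr_ge0 ?expR_ge0.
have [L L0 [_ phiS]] := phi_comp C0.
have dS := bounded_supportB fS (phiS _ _ uS u0).
eexists; last first.
  move=> s t s0 t0; rewrite (cumulant_tail s0) (cumulant_tail t0).
  wlog st : s t s0 t0 / s <= t.
    by move=> W; have [/W->//|/ltW/W] := leP s t; rewrite distrC (distrC s); exact.
  apply: (le_trans (tail_lipschitz s0 st dS)).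
  by rewrite distrC (ger0_norm (_ : 0 <= t - s)) ?subr_ge0.
by rewrite addr_ge0 ?mulr_ge0.
Qed.

End solution.

(** The uniform a priori bound [M] yields one Lipschitz constant of [phi] for all solutions. Then
    [|u_ k - u|] satisfies Gronwall's inequality with the integral of [|f_ k - f|] as its constant,
    which tends to 0. *)
Lemma cumulant_stable (C a : R) (f_ : nat -> R -> R) f (u_ : nat -> R -> R) u :
  0 <= a -> (forall k, bounded_support C a (f_ k)) ->
  (forall s, 0 <= s -> f_ k s @[k --> \oo] --> f s) ->
  (forall k, cumulant_solution phi (f_ k) (u_ k)) -> cumulant_solution phi f u ->
  forall s, 0 <= s -> u_ k s @[k --> \oo] --> u s.
Proof.
move=> a0 fS ff uP vP.
have gS : bounded_support C a f by exact: bounded_support_cvg ff.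
pose M := 2 * (C * a) * expR (2 * `|b| * a).
have C0 : 0 <= C by have [_ fC _] := gS; exact: le_trans (fC 0 (lexx 0)).
have M0 : 0 <= M by rewrite !mulr_ge0 ?expR_ge0.
have uS k : bounded_support M a (u_ k) by exact: cumulant_bound (uP k).
have vS : bounded_support M a u by exact: cumulant_bound vP.
have u0 k s : 0 <= s -> 0 <= u_ k s by have [[_ + _ _] _] := uP k; exact.
have v0 s : 0 <= s -> 0 <= u s by have [[_ + _ _] _] := vP; exact.
have [L L0 [LP phiS]] := phi_comp M0.
have uI k s : 0 <= s -> 0 <= u_ k s <= M.
  by move=> s0; have [_ uC _] := uS k; rewrite u0//= (le_trans (ler_norm _))// uC.
have vI s : 0 <= s -> 0 <= u s <= M.
  by move=> s0; have [_ uC _] := vS; rewrite v0//= (le_trans (ler_norm _))// uC.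
pose e k := tail (fun t => `|f_ k t - f t|) 0.
have dfS k : bounded_support (C + C) a (fun t => `|f_ k t - f t|).
  by apply: bounded_support_norm; rewrite -[a]maxxx; exact: bounded_supportB.
have e0 k : 0 <= e k by apply: tail_ge0.
have ecvg : e k @[k --> \oo] --> 0.
  rewrite (_ : 0 = tail (fun=> 0) (0 : R)); last by rewrite /tail Rintegral_cst// mul0r.
  apply: (@lebesgue_bounded_support_cvg _ _ (C + C) a (fun k t => `|f_ k t - f t|)) => //.
    by move=> t; rewrite /= !in_itv/= !andbT => /ltW.
  apply: aeW => t; rewrite /= in_itv/= andbT => /ltW t0.
  rewrite -(normr0 R) -(subrr (f t)); apply: cvg_norm.
  by apply: cvgB; [exact: ff|exact: cvg_cst].
have key k s : 0 <= s -> s <= a -> `|u_ k s - u s| <= 2 * e k * expR (2 * L * (a - s)).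
  move=> s0 sa.
  have dS : bounded_support (M + M) a (fun t => `|u_ k t - u t|).
    by apply: bounded_support_norm; rewrite -[a]maxxx; exact: bounded_supportB.
  apply: (@gronwall R (fun t => `|u_ k t - u t|) (M + M) a L (e k) 0) => // t t0.
  rewrite (cumulant_tail a0 (fS k) (uP k) t0) (cumulant_tail a0 gS vP t0).
  have S1 := bounded_supportB (fS k) (phiS _ _ (uS k) (u0 k)).
  have S2 := bounded_supportB gS (phiS _ _ vS v0).
  rewrite -(tailB t0 S1 S2).
  have S12 := bounded_supportB S1 S2.
  apply: (le_trans (ler_norm_tail t0 S12)).
  have S3 := bounded_supportD (dfS k) (bounded_supportZ L dS).
  apply: (@le_trans _ _ (tail (fun x => `|f_ k x - f x| + L * `|u_ k x - u x|) t)).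
    apply: (le_tail t0 (bounded_support_norm S12) S3) => x tx /=.
    have x0 : 0 <= x by rewrite (le_trans t0)// ltW.
    rewrite (_ : _ - _ - _ = f_ k x - f x - (phi (u_ k x) - phi (u x))); last by ring.
    apply: (le_trans (ler_normB _ _)); rewrite lerD2l.
    exact: LP (uI k x x0) (vI x x0).
  rewrite (tailD t0 (dfS k) (bounded_supportZ L dS)) (tailZ _ t0 dS) lerD2r.
  exact: (tail_mono (lexx 0) t0 (dfS k)).
move=> s s0; have [sa|sa] := leP s a; last first.
  have [_ _ va] := vS; rewrite va//; apply: cvg_near_cst; apply: nearW => k.
  by have [_ _ ua] := uS k; rewrite ua.
apply/cvgrPdist_le => d d0.
have K0 : 0 < 2 * expR (2 * L * (a - s)) by rewrite mulr_gt0 ?expR_gt0.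
have d1 : 0 < d / (2 * expR (2 * L * (a - s))) by rewrite divr_gt0.
near=> k; rewrite distrC (le_trans (key k s s0 sa))// mulrAC mulrC -ler_pdivlMr//.
apply: le_trans (ler_norm _) _; rewrite -normrN -[X in `|X|]sub0r ltW//.
by near: k; move/cvgrPdist_lt: ecvg => /(_ _ d1).
Unshelve. all: by end_near. Qed.

End cumulant.

(** * Laplace functionals *)

Lemma pushforward_probability d d' (X : measurableType d) (Y : measurableType d')
    (R : realType) (P : probability X R) (f : X -> Y) : measurable_fun setT f ->
  exists Q : probability Y R, (forall B, Q B = P (f @^-1` B)) /\
    forall g : Y -> R, measurable_fun setT g -> (forall y, 0 <= g y) ->
      \int[Q]_y g y = \int[P]_x g (f x).
Proof.
move=> mf; pose F : {mfun X >-> Y} := HB.pack f (isMeasurableFun.Build _ _ _ _ f mf).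
exists (distribution P F); split => // g mg g0.
rewrite /Rintegral ge0_integral_distribution//; last exact/measurable_EFinP.
Qed.

(** * The limit law on the Loeb space *)

Section laplace_limit.
Variables (R : realType) (K : nat -> probability (radon R) R) (L : (R -> R) -> R).
Hypothesis K_cvg : forall f, vague_test f -> (forall s, 0 <= s -> 0 <= f s) ->
  \int[K n]_nu expR (- pairing nu f) @[n --> \oo] --> L f.
Hypothesis L_cvg : forall C a (f_ : nat -> R -> R) f, 0 <= a ->
  (forall k, bounded_support C a (f_ k)) -> (forall k s, 0 <= s -> 0 <= f_ k s) ->
  (forall s, 0 <= s -> f_ k s @[k --> \oo] --> f s) -> L (f_ k) @[k --> \oo] --> L f.

Let ell f (nu : radon R) := expR (- pairing nu f).
Let G f : loeb_space (radon R) -> R := loeb_lift (ell f).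
Let mu : probability (loeb_space (radon R)) R := loeb_measure K.

Let ell01 f : bounded_positive_compact f -> forall nu, 0 <= ell f nu <= 1.
Proof. by move=> fB nu; exact: expR_pairing01. Qed.

Let mG f : bounded_positive_compact f -> measurable_fun setT (G f).
Proof.
by move=> fB; apply: measurable_loeb_lift; [exact: measurable_expR_pairing|exact: ell01].
Qed.

Let G_cvg f w : bounded_positive_compact f -> ell f (w n) @[n --> nat_ultra] --> G f w.
Proof. by move=> fB; apply: cvg_loeb_lift; exact: ell01. Qed.

Let G01 f w : bounded_positive_compact f -> 0 <= G f w <= 1.
Proof.
move=> fB; have c : cvg (ell f (w n) @[n --> nat_ultra]).
  by apply/cvg_ex; exists (G f w); exact: G_cvg.
apply/andP; split.
  by apply: limr_ge => //; apply: filterE => n; have /andP[] := ell01 fB (w n).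
by apply: limr_le => //; apply: filterE => n; have /andP[] := ell01 fB (w n).
Qed.

Let Rintegral_G f : vague_test f -> (forall s, 0 <= s -> 0 <= f s) ->
  \int[mu]_w G f w = L f.
Proof.
move=> fT f0; have fB := bounded_positive_compact_test fT f0.
apply: (etrans (Rintegral_loeb_lift K (measurable_expR_pairing fB) (ell01 fB))).
by apply: (@cvg_lim _ (@Rhausdorff R)); apply: cvg_ultra; exact: K_cvg.
Qed.

Let c (x : R) (k : nat) (s : R) := x * cutoff k%:R s.

Let c_test x k : vague_test (c x k).
Proof. by apply: (@vague_test_cutoff R (fun=> x)) => ?; exact: cvg_cst. Qed.

Let c_ge0 x k s : 0 <= x -> 0 <= s -> 0 <= c x k s.
Proof. by move=> x0 _; have /andP[? _] := cutoff01 (k%:R : R) s; rewrite mulr_ge0. Qed.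

Let c_support (x : R) k : 0 <= x -> x <= 1 -> bounded_support 1 (k%:R + 1) (c x k).
Proof.
by move=> x0 x1; apply: (@bounded_support_cutoff _ (fun=> x)) => // s; rewrite ger0_norm.
Qed.

Let c_bpc x k : 0 <= x -> bounded_positive_compact (c x k).
Proof. by move=> x0; apply: bounded_positive_compact_test => // s; exact: c_ge0. Qed.

Let L0 : L (fun=> 0) = 1.
Proof.
have zT : vague_test (fun=> 0 : R).
  by split; [apply: continuous_subspaceT => ?; exact: cvg_cst|exists 0].
have := K_cvg zT (fun _ _ => lexx 0).
have E n : \int[K n]_nu expR (- pairing nu (fun=> 0)) = 1.
  rewrite (@eq_Rintegral _ _ _ _ _ (cst 1)) => [|nu _]; last first.
    by rewrite /pairing Rintegral_cst// mul0r oppr0 expR0.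
  by rewrite Rintegral_cst// mul1r; have /= -> := @probability_setT _ _ _ (K n).
under eq_fun do rewrite E.
move=> h; apply: (@cvg_unique _ (@Rhausdorff R) _ _ _ _ h); exact: cvg_cst.
Qed.

(** [G (c 1 k) w] is positive exactly when the pairings of [w n] with the cutoff at [k] have a
    finite ultralimit: [good] is local boundedness of the sequence along the ultrafilter. *)
Let good : set (loeb_space (radon R)) := \bigcap_(k in [set: nat]) [set w | 0 < G (c 1 k) w].

Let m_good_at k : measurable [set w | 0 < G (c 1 k) w].
Proof.
rewrite (_ : [set w | _] = G (c 1 k) @^-1` `]0, +oo[%classic); last first.
  by apply/seteqP; split => w /=; rewrite in_itv/= andbT.
by rewrite -[X in measurable X]setTI; apply: mG => //; exact: c_bpc.
Qed.

Let m_good : measurable good.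
Proof. exact: bigcap_measurable. Qed.

(** For every [x = 1/(j+1)], [G (c x k)] vanishes where [G (c 1 k)] does, so it is at most the
    indicator of the set [A] where the latter is positive. Integration gives [L (c x k) <= mu A],
    and the left side tends to [L 0 = 1]. *)
Let good_negligible : mu.-negligible (~` good).
Proof.
rewrite setC_bigcap; apply: negligible_bigcup => k.
set A := [set w | 0 < G (c 1 k) w].
have mA : measurable A by exact: m_good_at.
exists (~` A); split; [exact: measurableC| |by []].
apply: (etrans (probability_setC mu mA)); suff -> : mu A = 1%E by rewrite subee.
apply/eqP; rewrite eq_le probability_le1//= -Rintegral_indic// lee_fin.
pose x (j : nat) : R := j.+1%:R^-1.
have x0 j : 0 <= x j by rewrite invr_ge0.
have x1 j : x j <= 1 by rewrite invf_le1// ler1n.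
have Lx : L (c (x j) k) @[j --> \oo] --> (1 : R).
  rewrite -L0; apply: (@L_cvg 1 (k%:R + 1)) => [|j|j s s0|s s0].
  - by rewrite addr_ge0.
  - exact: c_support.
  - exact: c_ge0.
  - rewrite -(mul0r (cutoff k%:R s)); apply: cvgMl; exact: cvg_harmonic.
rewrite -(cvg_lim _ Lx)//; apply: limr_le; first by apply/cvg_ex; exists 1.
apply: nearW => j; rewrite -Rintegral_G//; last by move=> s; exact: c_ge0.
have cB : bounded_positive_compact (c (x j) k) by exact: c_bpc.
apply: le_Rintegral => //.
- apply: (@bounded_integrable _ _ _ _ _ _ 1) => //; first exact: mG.
  by move=> w _; have /andP[? ?] := G01 w cB; rewrite ger0_norm.
- apply: (@bounded_integrable _ _ _ _ _ _ 1) => //.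
  by move=> w _; rewrite indicE ger0_norm ?ler0n// lern1 leq_b1.
move=> w _; rewrite indicE; case: (boolP (w \in A)) => [_|]; first by have /andP[] := G01 w cB.
rewrite notin_setE /A/= => /negP; rewrite -leNgt => Gw.
(* [G (c 1 k) w] is the power of order [j.+1] of [G (c (x j) k) w]: both vanish together. *)
have GE : G (c 1 k) w = G (c (x j) k) w ^+ j.+1.
  have h : ell (c (x j) k) (w n) ^+ j.+1 @[n --> nat_ultra] --> G (c (x j) k) w ^+ j.+1.
    apply: (@continuous_cvg _ _ _ _ _ (fun n => ell (c (x j) k) (w n)) (fun y : R => y ^+ j.+1)); last exact: G_cvg.
    exact: (@exprn_continuous R j.+1).
  apply: etrans (cvg_lim (@Rhausdorff R) h); congr (lim (_ @ nat_ultra)).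
  apply/funext => n; rewrite /ell -expRM_natl mulrN.
  rewrite -(pairingZ _ _ (c_support k (x0 j) (x1 j))); congr (expR (- _)).
  by apply: eq_pairing => s s0; rewrite /c mulrA mulfV ?mul1r// pnatr_eq0.
have /andP[G0 _] := G01 w (c_bpc k ler01).
have : G (c 1 k) w == 0 by rewrite eq_le Gw.
by rewrite GE expf_eq0 => /andP[_ /eqP ->].
Qed.

(** The value off [good] is fixed so that composites of the chosen map with Laplace exponentials are
    measurable. *)
Let lim_spec (w : loeb_space (radon R)) (nu : radon R) :=
  (good w -> forall f, vague_test f -> pairing (w n) f @[n --> nat_ultra] --> pairing nu f)
  /\ (~ good w -> nu = point).

Let lim_exists w : exists nu, lim_spec w nu.
Proof.
have [gw|gw] := pselect (good w); last by exists point; split.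
have [k|nu nuP] := @vague_ultralimit R w; last by exists nu; split.
have Gk : 0 < G (c 1 k) w by exact: gw.
(* Along the ultrafilter the exponential of minus the pairing exceeds half of its positive limit. *)
exists (- ln (G (c 1 k) w / 2)).
have /cvgrPdist_lt/(_ (G (c 1 k) w / 2)) := @G_cvg _ w (c_bpc k ler01).
rewrite divr_gt0// => /(_ isT) h; near=> n.
apply: (@le_trans _ _ (pairing (w n) (c 1 k))).
  apply: (le_pairing _ (bounded_support_below (lexx k%:R)) (c_support k ler01 (lexx 1))).
  move=> s s0; rewrite belowE// /c mul1r; have /andP[? ?] := cutoff01 (k%:R : R) s.
  by case: (ltP s k%:R) => // /ltW sk; rewrite cutoff1.
rewrite lerNr -ler_expR lnK ?posrE ?divr_gt0//.
have : `|G (c 1 k) w - ell (c 1 k) (w n)| < G (c 1 k) w / 2 by near: n.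
rewrite /ell => /ltr_normlP[]; lra.
Unshelve. all: by end_near. Qed.

Let limit : loeb_space (radon R) -> radon R := projT1 (choice lim_exists).

Let limit_cvg w f : good w -> vague_test f ->
  pairing (w n) f @[n --> nat_ultra] --> pairing (limit w) f.
Proof. by move=> gw; have [+ _] := projT2 (choice lim_exists) w; apply. Qed.

Let limit_bad w : ~ good w -> limit w = point.
Proof. by have [_] := projT2 (choice lim_exists) w. Qed.

Let limitE f w : vague_test f -> (forall s, 0 <= s -> 0 <= f s) -> good w ->
  ell f (limit w) = G f w.
Proof.
move=> fT f0 gw; have fB := bounded_positive_compact_test fT f0.
apply/esym/(cvg_lim (@Rhausdorff R)).
apply: (@continuous_cvg _ _ _ _ _ (fun n => - pairing (w n) f) (@expR R)).
  exact: continuous_expR.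
by apply: cvgN; exact: limit_cvg.
Qed.

Let limit_test f : vague_test f -> (forall s, 0 <= s -> 0 <= f s) ->
  measurable_fun setT (ell f \o limit) /\ \int[mu]_w ell f (limit w) = L f.
Proof.
move=> fT f0; have fB := bounded_positive_compact_test fT f0.
have m_lim : measurable_fun setT (ell f \o limit).
  rewrite (_ : _ \o _ = (fun w => G f w * \1_good w + ell f point * \1_(~` good) w)).
    apply: measurable_funD; apply: measurable_funM => //; first exact: mG.
    by apply: measurable_indic; exact: measurableC.
  apply/funext => w /=; rewrite !indicE in_setC; have [gw|gw] := pselect (good w).
    by rewrite mem_set//= mulr1 mulr0 addr0 limitE.
  by rewrite memNset//= mulr0 mulr1 add0r limit_bad.
split => //; rewrite -Rintegral_G// /Rintegral; congr fine.
apply: ae_eq_integral => //.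
- by apply/measurable_EFinP.
- by apply/measurable_EFinP; exact: mG.
- by apply: negligibleS good_negligible => w /= h gw; apply: h => _; rewrite limitE.
Qed.

(** [Borel_extension] ranges over signed functions on the whole line; this map, continuous for
    pointwise convergence, makes them positive with bounded support and fixes the values of [f] on
    [0,oo). *)
Let pos_part (g : R -> R) a s := (g s + `|g s|) / 2 * cutoff a s.

Let pos_part_ge0 g a s : 0 <= pos_part g a s.
Proof.
have /andP[? _] := cutoff01 a s; rewrite mulr_ge0// divr_ge0//.
by have := ler_norm (- g s); rewrite normrN; lra.
Qed.

Let pos_part_support (g : R -> R) (a M : R) : measurable_fun setT g -> (forall s, `|g s| <= M) ->
  bounded_support M (a + 1) (pos_part g a).
Proof.
move=> mg gM; apply: (@bounded_support_cutoff _ (fun s => (g s + `|g s|) / 2)) => [|s].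
  apply: measurable_funM => //; apply: measurable_funD => //.
  exact: measurableT_comp.
rewrite normrM (ger0_norm (_ : 0 <= 2^-1))// ler_pdivrMr//.
by rewrite (le_trans (ler_normD _ _))// normr_id; have := gM s; lra.
Qed.

Let limit_positive f : bounded_positive_compact f ->
  measurable_fun setT (ell f \o limit) /\ \int[mu]_w ell f (limit w) = L f.
Proof.
move=> fB; have /bounded_positive_compactP[[C [a1 fS1]] f0] := fB.
pose a := Num.max 0 a1; have a0 : 0 <= a by rewrite le_max lexx.
have fS : bounded_support C a f by apply: bounded_support_le fS1; rewrite // le_max lexx orbT.
pose D : set R := `[0, +oo[%classic; pose f' := f \_ D.
have mf' : measurable_fun setT f'.
  by apply/(measurable_restrictT _ _).1; [exact: measurable_itv|have [] := fS].
have f'E s : 0 <= s -> f' s = f s.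
  by move=> s0; rewrite /f' patchE mem_set// /D/= in_itv/= s0.
have C0 : 0 <= C by have [_ fC _] := fS; exact: le_trans (fC 0 (lexx 0)).
have f'C s : `|f' s| <= C.
  rewrite /f' patchE; case: ifPn => [|_]; last by rewrite normr0.
  by rewrite inE /D/= in_itv/= andbT; have [_ + _] := fS; exact.
have fE s : 0 <= s -> f s = pos_part f' a s.
  move=> s0; rewrite /pos_part f'E// (ger0_norm (f0 s s0)).
  have [sa|sa] := leP s a; last by have [_ _ ->] := fS; rewrite // addr0 mul0r mul0r.
  by rewrite cutoff1// mulr1; field.
(* That [L] sees only values on [0,oo) follows from its continuity, applied to a constant
   sequence. *)
have LE : L f = L (pos_part f' a).
  have h := @L_cvg C a (fun=> f) (pos_part f' a) a0 (fun=> fS) (fun=> f0).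
  rewrite -[RHS](cvg_lim (@Rhausdorff R) (h _)); first by rewrite lim_cst.
  by move=> s s0; rewrite -fE//; exact: cvg_cst.
have ellE nu : ell f nu = ell (pos_part f' a) nu.
  by rewrite /ell; congr (expR (- _)); exact: eq_pairing.
suff [_ [m1 E1]] : [set g | measurable_fun setT g /\
    (measurable_fun setT (ell (pos_part g a) \o limit) /\
     \int[mu]_w ell (pos_part g a) (limit w) = L (pos_part g a))] f'.
  have -> : ell f = ell (pos_part f' a) by exact/funext.
  by rewrite LE.
apply: Borel_extension => //; last by exists C.
- move=> g_ g M Hg gM gg; have mg k : measurable_fun setT (g_ k) by have [] := Hg k.
  have mgl : measurable_fun setT g by exact: (measurable_fun_cvg mg).
  have pS k : bounded_support M (a + 1) (pos_part (g_ k) a) by exact: pos_part_support.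
  have pc s : pos_part (g_ k) a s @[k --> \oo] --> pos_part g a s.
    apply: cvgMl; apply: cvgMl; apply: cvgD; first exact: gg.
    by apply: cvg_norm; exact: gg.
  have p0 k s : 0 <= s -> 0 <= pos_part (g_ k) a s by move=> _; exact: pos_part_ge0.
  have ec nu : ell (pos_part (g_ k) a) nu @[k --> \oo] --> ell (pos_part g a) nu.
    apply: (@continuous_cvg _ _ _ _ _ (fun k => - pairing nu (pos_part (g_ k) a)) (@expR R)).
      exact: continuous_expR.
    by apply: cvgN; apply: (@pairing_cvg _ nu _ _ _ _ pS) => s _; exact: pc.
  have mk k : measurable_fun setT (ell (pos_part (g_ k) a) \o limit) by have [_ []] := Hg k.
  have Ek k : \int[mu]_w ell (pos_part (g_ k) a) (limit w) = L (pos_part (g_ k) a).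
    by have [_ []] := Hg k.
  split => //; split; first by apply: (measurable_fun_cvg mk) => w _; exact: ec.
  have pB k : bounded_positive_compact (pos_part (g_ k) a).
    by apply/bounded_positive_compactP; split; [exists M, (a + 1)|exact: p0].
  have hi := @bounded_Rintegral_cvg _ _ _ mu _ (ell (pos_part g a) \o limit) 1 mk _
    (fun w => ec (limit w)).
  rewrite -(cvg_lim (@Rhausdorff R) (hi _)) => [|k w]; last first.
    by have /andP[? ?] := ell01 (pB k) (limit w); rewrite ger0_norm.
  under eq_fun do rewrite Ek.
  apply: (cvg_lim (@Rhausdorff R)); apply: (@L_cvg M (a + 1)) => //; first by rewrite addr_ge0.
- move=> v cv [M vM]; split; first exact: continuous_measurable_fun.
  apply: limit_test => [|s _]; last exact: pos_part_ge0.
  apply: (@vague_test_cutoff _ (fun s => (v s + `|v s|) / 2)) => s.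
  apply: cvgMl; apply: cvgD; first exact: cv.
  by apply: cvg_norm; exact: cv.
Qed.

Lemma laplace_limit : exists Q : probability (radon R) R,
  forall f, bounded_positive_compact f -> \int[Q]_nu expR (- pairing nu f) = L f.
Proof.
have mlim : measurable_fun setT limit.
  move=> _ B mB; rewrite setTI.
  suff h : measurable_fun setT ((\1_B : radon R -> R) \o limit).
    rewrite (_ : limit @^-1` B = ((\1_B : radon R -> R) \o limit) @^-1` [set 1]).
      by rewrite -[X in measurable X]setTI; exact: h.
    apply/seteqP; split => w /=; rewrite indicE => Bw; first by rewrite mem_set.
    by move: Bw; case: (boolP (_ \in B)) => [/set_mem//|_ /eqP]; rewrite eq_sym oner_eq0.
  suff : [set g : radon R -> R | measurable_fun setT (g \o limit)] \1_B by [].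
  apply: radon_monotone_class => //.
  - move=> k g h mg mh; apply: measurable_funD => //; exact: measurable_funM.
  - move=> g_ g M mg gM gg; apply: (measurable_fun_cvg mg) => w _; exact: gg.
  - by move=> f /limit_positive[].
  - by exists 1 => nu; rewrite indicE ger0_norm ?ler0n// lern1 leq_b1.
have [Q [_ QE]] := pushforward_probability mu mlim.
exists Q => f fB; have [_ <-] := limit_positive fB.
by rewrite QE//; exact: measurable_expR_pairing.
Qed.

End laplace_limit.

(** * Composition and uniqueness of laws *)

Section kernel_probability.
Context d d' (X : measurableType d) (Y : measurableType d') (R : realType).
Variables (k : R.-pker X ~> Y) (x : X).

Definition kernel_probability : set Y -> \bar R := k x.

HB.instance Definition _ := Measure.on kernel_probability.

HB.instance Definition _ := Measure_isProbability.Build _ _ _ kernel_probability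
  (@prob_kernel _ _ _ _ _ k x).

Lemma Rintegral_kernel_probability (g : Y -> R) :
  \int[kernel_probability]_y g y = \int[k x]_y g y.
Proof. by []. Qed.

Lemma integral_kernel_probability (g : Y -> R) (C : R) : measurable_fun setT g ->
  (forall y, `|g y| <= C) -> (\int[k x]_y (g y)%:E = (\int[k x]_y g y)%:E)%E.
Proof.
move=> mg gC; rewrite /Rintegral fineK//.
have := @bounded_integrable _ _ _ kernel_probability setT g C measurableT mg (fun y _ => gC y).
exact: integrable_fin_num.
Qed.

End kernel_probability.

(** The functions [g] whose integrals under [N] and under [M] followed by [k] agree form a class to
    which [radon_monotone_class] applies; measurability of the inner integral is carried along for
    the limits. It gives the Chapman-Kolmogorov equation and, with the Dirac kernel, uniqueness. *)
Lemma laplace_compose (R : realType) (N M : probability (radon R) R)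
    (k : R.-pker (radon R) ~> (radon R)) :
  (forall f, bounded_positive_compact f ->
    \int[N]_nu expR (- pairing nu f) = \int[M]_y \int[k y]_nu expR (- pairing nu f)) ->
  forall B, measurable B -> N B = (\int[M]_y k y B)%E.
Proof.
move=> NM B mB.
pose P y : probability (radon R) R := kernel_probability k y.
pose bounded (g : radon R -> R) := exists M : R, forall nu, `|g nu| <= M.
pose H := [set g : radon R -> R | [/\ measurable_fun setT g, bounded g,
  measurable_fun setT (fun y => \int[P y]_nu g nu) &
  \int[N]_nu g nu = \int[M]_y \int[P y]_nu g nu]].
have Pint (Q : probability (radon R) R) g : measurable_fun setT g -> bounded g ->
    Q.-integrable setT (EFin \o g).
  by move=> mg [C gC]; apply: (@bounded_integrable _ _ _ _ _ _ C).
have Pbnd (g : radon R -> R) (C : R) : measurable_fun setT g -> (forall nu, `|g nu| <= C) ->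
    forall y, `|\int[P y]_nu g nu| <= C.
  move=> mg gC y; have gi := Pint (P y) g mg (ex_intro _ C gC).
  apply: (le_trans (le_normr_Rintegral _ gi)) => //.
  have -> : C = \int[P y]_nu (cst C nu : R).
    by rewrite Rintegral_cst//; have /= -> := @probability_setT _ _ _ (P y); rewrite mulr1.
  apply: le_Rintegral => //; first by apply: Pint; [exact: measurableT_comp|
    exists C => nu; rewrite normr_id].
  by apply: Pint => //; exists `|C|.
have : H \1_B.
  apply: radon_monotone_class => //.
  - move=> l g h [mg bg Pg Eg] [mh bh Ph Eh].
    have [C gC] := bg; have [D hD] := bh.
    have mlg : measurable_fun setT (fun x => l * g x) by exact: measurable_funM.
    have blg : bounded (fun x => l * g x).
      by exists (`|l| * C) => x; rewrite normrM ler_wpM2l.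
    have E (Q : probability (radon R) R) :
        \int[Q]_nu (l * g nu + h nu) = l * \int[Q]_nu g nu + \int[Q]_nu h nu.
      by rewrite (RintegralD measurableT (Pint _ _ mlg blg) (Pint _ _ mh bh))
        (RintegralZl _ measurableT (Pint _ _ mg bg)).
    have EP : (fun y => \int[P y]_nu (l * g nu + h nu)) =
        (fun y => l * \int[P y]_nu g nu + \int[P y]_nu h nu) by apply/funext => y.
    have mlP : measurable_fun setT (fun y => l * \int[P y]_nu g nu) by exact: measurable_funM.
    split.
    + exact: measurable_funD.
    + by exists (`|l| * C + D) => x; rewrite (le_trans (ler_normD _ _))// lerD// normrM ler_wpM2l.
    + by rewrite EP; exact: measurable_funD.
    + rewrite E EP Eg Eh.
      have b1 : bounded (fun y => \int[P y]_nu g nu) by exists C; exact: Pbnd.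
      have b2 : bounded (fun y => \int[P y]_nu h nu) by exists D; exact: Pbnd.
      have b3 : bounded (fun y => l * \int[P y]_nu g nu).
        by exists (`|l| * C) => y; rewrite normrM ler_wpM2l// Pbnd.
      by rewrite (RintegralD measurableT (Pint _ _ mlP b3) (Pint _ _ Ph b2))
        (RintegralZl _ measurableT (Pint _ _ Pg b1)).
  - move=> g_ g C Hg gC gg.
    have mg k0 : measurable_fun setT (g_ k0) by have [] := Hg k0.
    have mPg k0 : measurable_fun setT (fun y => \int[P y]_nu g_ k0 nu) by have [] := Hg k0.
    have Pc y := @bounded_Rintegral_cvg _ _ _ (P y) _ _ _ mg gC gg.
    split.
    + exact: (measurable_fun_cvg mg).
    + exists C => x; rewrite -(cvg_lim _ (cvg_norm (gg x)))//; apply: limr_le.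
        by apply/cvg_ex; exists `|g x|; exact: (cvg_norm (gg x)).
      exact: nearW.
    + by apply: (measurable_fun_cvg mPg) => y _; exact: Pc.
    + have h1 := @bounded_Rintegral_cvg _ _ _ N _ _ _ mg gC gg.
      have h2 := @bounded_Rintegral_cvg _ _ _ M _ _ _ mPg (fun k0 => Pbnd _ _ (mg k0) (gC k0)) Pc.
      rewrite -(cvg_lim _ h1)// -(cvg_lim _ h2)//.
      rewrite (_ : (fun k0 => \int[N]_x g_ k0 x) = (fun k0 => \int[M]_y \int[P y]_nu g_ k0 nu))//.
      by apply/funext => k0; have [] := Hg k0.
  - move=> f fB; have b1 nu : `|expR (- pairing nu f)| <= 1.
      by have /andP[? ?] := expR_pairing01 nu fB; rewrite ger0_norm.
    have me := measurable_expR_pairing fB.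
    split; [by []|by exists 1| |exact: NM].
    have me' : measurable_fun setT (fun y => \int[k y]_nu (expR (- pairing nu f))%:E)%E.
      apply: (measurable_fun_integral_kernel (fun U mU => measurable_kernel k U mU)).
        by move=> z; rewrite lee_fin expR_ge0.
      exact/measurable_EFinP.
    apply/measurable_EFinP; apply: eq_measurable_fun me' => y _.
    by rewrite (integral_kernel_probability k y me b1).
  - by exists 1 => nu; rewrite indicE ger0_norm ?ler0n// lern1 leq_b1.
move=> [_ _ mPB E]; rewrite -Rintegral_indic// E.
have b1 y : `|\int[P y]_nu (\1_B nu : R)| <= 1.
  by apply: Pbnd => // nu; rewrite indicE ger0_norm ?ler0n// lern1 leq_b1.
rewrite /Rintegral fineK; last first.
  by apply: integrable_fin_num => //; apply: Pint => //; exists 1.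
apply: eq_integral => y _; rewrite -[RHS](Rintegral_indic (P y) mB).
by rewrite /Rintegral.
Qed.

Lemma laplace_unique (R : realType) (P Q : probability (radon R) R) :
  (forall f, bounded_positive_compact f ->
    \int[P]_nu expR (- pairing nu f) = \int[Q]_nu expR (- pairing nu f)) ->
  forall B, measurable B -> P B = Q B.
Proof.
move=> PQ B mB.
rewrite (@laplace_compose _ P Q (kdirac (@measurable_id _ (radon R) setT)))//.
  by rewrite /kdirac/= [LHS]integral_indic ?setIT.
move=> f fB; rewrite PQ//; apply: eq_Rintegral => y _.
rewrite /Rintegral /kdirac integral_dirac//; first by rewrite diracT mul1e.
by apply/measurable_EFinP; exact: measurable_expR_pairing.
Qed.

(** * The transition kernels *)

Section flow.
Variables (R : realType) (T : set R) (phi : R -> R -> R) (b : R -> R).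
Variable u : R -> (R -> R) -> R -> R.
Hypothesis phi0 : forall q, T q -> phi q 0 = 0.
Hypothesis phi_ge : forall q l, T q -> 0 <= l -> b q * l <= phi q l.
Hypothesis phi_lip : forall q C, T q -> 0 <= C -> exists2 L, 0 <= L &
  forall l l', 0 <= l <= C -> 0 <= l' <= C -> `|phi q l - phi q l'| <= L * `|l - l'|.
Hypothesis phi_decr : forall l p q, 0 <= l -> T p -> T q -> p <= q ->
  phi q l <= phi p l.
Hypothesis uP : forall q f, T q -> bounded_positive_compact f ->
  unique_cumulant_solution (phi q) f (u q f).
Implicit Types (f g : R -> R).

(** The [upq] of the theorem, for any family [phi] with the properties assumed in this section. *)
Definition flow p q f s : R := f s + (phi p (u q f s) - phi q (u q f s)).

Let bpcP C a f : bounded_support C a f -> (forall s, 0 <= s -> 0 <= f s) ->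
  bounded_positive_compact f.
Proof. by move=> fS f0; apply/bounded_positive_compactP; split => //; exists C, a. Qed.

Let u_ge0 q f s : T q -> bounded_positive_compact f -> 0 <= s -> 0 <= u q f s.
Proof. by move=> Tq fB s0; have [[[_ + _ _] _] _] := uP Tq fB; exact. Qed.

Let u_bound q f C a : T q -> 0 <= a -> bounded_support C a f ->
  (forall s, 0 <= s -> 0 <= f s) ->
  bounded_support (2 * (C * a) * expR (2 * `|b q| * a)) a (u q f).
Proof.
move=> Tq a0 fS f0; have [uS _] := uP Tq (bpcP fS f0).
apply: (cumulant_bound (phi0 Tq) _ _ a0 fS uS) => [l|D]; [exact: phi_ge|exact: phi_lip].
Qed.

Lemma cumulant_cvg q C a (f_ : nat -> R -> R) f s : T q -> 0 <= a ->
  (forall k, bounded_support C a (f_ k)) -> (forall k s, 0 <= s -> 0 <= f_ k s) ->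
  bounded_positive_compact f ->
  (forall s, 0 <= s -> f_ k s @[k --> \oo] --> f s) -> 0 <= s ->
  u q (f_ k) s @[k --> \oo] --> u q f s.
Proof.
move=> Tq a0 fS f0 fB ff s0.
have uk k : cumulant_solution (phi q) (f_ k) (u q (f_ k)).
  by have [] := uP Tq (bpcP (fS k) (f0 k)).
have [ul _] := uP Tq fB.
exact: (cumulant_stable (phi0 Tq) (fun l => @phi_ge q l Tq)
  (fun D => @phi_lip q D Tq) a0 fS ff uk ul s0).
Qed.

(** [C'] comes before [f]: a bound common to a whole sequence is what dominated convergence
    needs. *)
Lemma flow_support p q C a : T p -> T q -> 0 <= a -> 0 <= C -> exists C',
  forall f, bounded_support C a f -> (forall s, 0 <= s -> 0 <= f s) ->
    bounded_support C' a (flow p q f).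
Proof.
move=> Tp Tq a0 C0; set M := 2 * (C * a) * expR (2 * `|b q| * a).
have M0 : 0 <= M by rewrite mulr_ge0 ?expR_ge0 ?mulr_ge0.
have [Lp _ [_ pS]] := phi_comp (phi0 Tp) (fun D => @phi_lip p D Tp) M0.
have [Lq _ [_ qS]] := phi_comp (phi0 Tq) (fun D => @phi_lip q D Tq) M0.
exists (C + (Lp * M + Lq * M)) => f fS f0.
have uS := u_bound Tq a0 fS f0.
have u0 s : 0 <= s -> 0 <= u q f s by apply: u_ge0 => //; exact: bpcP fS f0.
have := bounded_supportD fS (bounded_supportB (pS _ _ uS u0) (qS _ _ uS u0)).
by rewrite !maxxx.
Qed.

Lemma flow_ge0 p q f s : T p -> T q -> p <= q -> bounded_positive_compact f ->
  0 <= s -> 0 <= flow p q f s.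
Proof.
move=> Tp Tq pq fB s0; have [_ f0 _ _] := fB.
by rewrite addr_ge0 ?f0// subr_ge0 phi_decr// u_ge0.
Qed.

Let bpc_support f : bounded_positive_compact f -> exists C a,
  [/\ 0 <= C, 0 <= a, bounded_support C a f & forall s, 0 <= s -> 0 <= f s].
Proof.
move=> /bounded_positive_compactP[[C [a fS]] f0].
exists C, (Num.max 0 a); split => //.
- by have [_ /(_ 0 (lexx 0)) + _] := fS; apply: le_trans.
- by rewrite le_max lexx.
- by apply: bounded_support_le fS => //; rewrite le_max lexx orbT.
Qed.

Lemma flow_positive p q f : T p -> T q -> p <= q -> bounded_positive_compact f ->
  bounded_positive_compact (flow p q f).
Proof.
move=> Tp Tq pq fB; have [C [a [C0 a0 fS f0]]] := bpc_support fB.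
have [C' gS] := flow_support Tp Tq a0 C0.
by apply: (bpcP (gS f fS f0)) => s; exact: flow_ge0.
Qed.

Lemma flow_cvg p q C a (f_ : nat -> R -> R) f s : T p -> T q -> 0 <= a ->
  (forall k, bounded_support C a (f_ k)) -> (forall k s, 0 <= s -> 0 <= f_ k s) ->
  bounded_positive_compact f ->
  (forall s, 0 <= s -> f_ k s @[k --> \oo] --> f s) -> 0 <= s ->
  flow p q (f_ k) s @[k --> \oo] --> flow p q f s.
Proof.
move=> Tp Tq a0 fS f0 fB ff s0.
have C0 : 0 <= C by have [_ /(_ 0 (lexx 0)) + _] := fS 0; apply: le_trans.
set M := 2 * (C * a) * expR (2 * `|b q| * a).
have M0 : 0 <= M by rewrite mulr_ge0 ?expR_ge0 ?mulr_ge0.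
have uu := cumulant_cvg Tq a0 fS f0 fB ff s0.
have uI k : 0 <= u q (f_ k) s <= M.
  rewrite u_ge0//=; last exact: bpcP (fS k) (f0 k).
  by have [_ h _] := u_bound Tq a0 (fS k) (f0 k); rewrite (le_trans (ler_norm _))// h.
have vI : 0 <= u q f s <= M.
  rewrite u_ge0//= -(cvg_lim _ uu)//; apply: limr_le; first by apply/cvg_ex; exists (u q f s).
  by apply: nearW => k; have /andP[] := uI k.
have pcvg r : T r -> phi r (u q (f_ k) s) @[k --> \oo] --> phi r (u q f s).
  move=> Tr; have [L L0 LP] := phi_lip Tr M0.
  apply/cvgrPdist_le => e e0.
  have d0 : 0 < e / (L + 1) by rewrite divr_gt0// ltr_wpDl.
  near=> k; apply: (le_trans (LP _ _ vI (uI k))).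
  have h : `|u q f s - u q (f_ k) s| <= e / (L + 1).
    by near: k; move/cvgrPdist_le: uu => /(_ _ d0).
  apply: (@le_trans _ _ ((L + 1) * `|u q f s - u q (f_ k) s|)).
    by rewrite ler_wpM2r// lerDl.
  by rewrite mulrC -ler_pdivlMr// ltr_wpDl.
by apply: cvgD; [exact: ff|apply: cvgB; exact: pcvg].
Unshelve. all: by end_near. Qed.

Lemma flow_test p q f : T p -> T q -> vague_test f ->
  (forall s, 0 <= s -> 0 <= f s) -> vague_test (flow p q f).
Proof.
move=> Tp Tq fT f0; have fB := bounded_positive_compact_test fT f0.
have [C [a [C0 a0 fS _]]] := bpc_support fB.
have [C' gS] := flow_support Tp Tq a0 C0.
split; last by have [_ _ ga] := gS f fS f0; exists a.
have M0 : 0 <= 2 * (C * a) * expR (2 * `|b q| * a) by rewrite mulr_ge0 ?expR_ge0 ?mulr_ge0.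
have [_ uC _] := u_bound Tq a0 fS f0.
have [uS _] := uP Tq fB.
have [K K0 uK] := cumulant_lipschitz (phi0 Tq) (fun l => @phi_ge q l Tq)
  (fun D => @phi_lip q D Tq) a0 fS uS.
have uI s : 0 <= s -> 0 <= u q f s <= 2 * (C * a) * expR (2 * `|b q| * a).
  by move=> s0; rewrite u_ge0//= (le_trans (ler_norm _))// uC.
have pc r : T r -> {within `[0, +oo[%classic, continuous (fun s => phi r (u q f s))}.
  move=> Tr; have [L L0 LP] := phi_lip Tr M0.
  (* The absolute value turns a Lipschitz estimate on [0,oo) into one on the line, without changing
     the function on [0,oo). *)
  have cabs : continuous (fun s : R => phi r (u q f `|s|)).
    apply: (@lipschitz_continuous R _ (L * K)) => [|s t]; first exact: mulr_ge0.
    apply: (le_trans (LP _ _ (uI _ (normr_ge0 s)) (uI _ (normr_ge0 t)))).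
    rewrite -mulrA ler_wpM2l// (le_trans (uK _ _ (normr_ge0 s) (normr_ge0 t)))//.
    by rewrite ler_wpM2l// ler_dist_dist.
  apply: (@subspace_eq_continuous _ _ _ (fun s : R => phi r (u q f `|s|))).
    by move=> s; rewrite /= inE/= in_itv/= andbT => s0; rewrite ger0_norm.
  exact: continuous_subspaceT.
move=> s; apply: cvgD; first exact: fT.1.
by apply: cvgB; exact: pc.
Qed.

(** Adding the tail integral of [phi r (u q f) - phi q (u q f)] to both sides of the equation of
    [u q f] gives the equation for [phi r] with right side [flow r q f]; uniqueness concludes. *)
Lemma cumulant_flow r q f s : T r -> T q -> r <= q -> bounded_positive_compact f ->
  0 <= s -> u r (flow r q f) s = u q f s.
Proof.
move=> Tr Tq rq fB s0; have [_ gU] := uP Tr (flow_positive Tr Tq rq fB).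
apply/esym/gU => //; have [[uB uE] _] := uP Tq fB; split => // t t0.
have [C [a [C0 a0 fS f0]]] := bpc_support fB.
have M0 : 0 <= 2 * (C * a) * expR (2 * `|b q| * a) by rewrite mulr_ge0 ?expR_ge0 ?mulr_ge0.
have uS := u_bound Tq a0 fS f0.
have u0 x : 0 <= x -> 0 <= u q f x by exact: u_ge0.
have [Lr _ [_ /(_ _ _ uS u0) rS]] := phi_comp (phi0 Tr) (fun D => @phi_lip r D Tr) M0.
have [Lq _ [_ /(_ _ _ uS u0) qS]] := phi_comp (phi0 Tq) (fun D => @phi_lip q D Tq) M0.
have E := tailD t0 fS (bounded_supportB rS qS).
rewrite (tailB t0 rS qS) in E.
apply: etrans (esym E).
have := uE t t0; rewrite -/(tail f t) => <-.
rewrite -[X in _ + X + _]/(tail (phi q \o u q f) t).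
rewrite -[X in _ + X]/(tail (phi r \o u q f) t).
by ring.
Qed.

Lemma flow_flow p r q f s : T p -> T r -> T q -> r <= q ->
  bounded_positive_compact f -> 0 <= s ->
  flow p r (flow r q f) s = flow p q f s.
Proof.
by move=> Tp Tr Tq rq fB s0; rewrite {1}/flow cumulant_flow// /flow; ring.
Qed.

Lemma flow_refl p f s : flow p p f s = f s.
Proof. by rewrite /flow subrr addr0. Qed.

Lemma exists_flow_kernel p q (c : R) (P : R.-pker (cadlag R) ~> (cadlag R)) :
  T p -> T q -> p <= q ->
  (forall rho f, bounded_positive_compact f ->
    (\int[P rho]_w
       (expR (- \int[@lebesgue_measure R]_(s in `[0, +oo[) (f s * w s))%R)%:E =
     (expR (- (c * u q f 0) - \int[@lebesgue_measure R]_(s in `[0, +oo[)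
        (flow p q f s * rho s))%R)%:E)%E) ->
  exists Q : R.-pker (radon R) ~> (radon R),
    forall eta f, bounded_positive_compact f -> \int[Q eta]_nu expR (- pairing nu f) =
      expR (- (c * u q f 0) - pairing eta (flow p q f)).
Proof.
move=> Tp Tq pq PE.
have fB f : bounded_positive_compact f -> bounded_positive_compact (flow p q f).
  exact: flow_positive.
have PE' rho f : bounded_positive_compact f ->
    \int[P rho]_w expR (- pairing (radon_of_path w) f) =
    expR (- (c * u q f 0) - pairing (radon_of_path rho) (flow p q f)).
  move=> fB'; have /bounded_positive_compactP[[C [a fS]] f0] := fB'.
  have /bounded_positive_compactP[[C' [a' gS]] _] := fB _ fB'.
  rewrite /Rintegral; under eq_integral do rewrite (pairing_radon_of_path _ fS).
  by rewrite PE// (pairing_radon_of_path _ gS).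
pose L eta f := expR (- (c * u q f 0) - pairing eta (flow p q f)).
have exQ eta : exists Q : probability (radon R) R,
    forall f, bounded_positive_compact f -> \int[Q]_nu expR (- pairing nu f) = L eta f.
  have pushE n : exists K : probability (radon R) R, forall f, bounded_positive_compact f ->
      \int[K]_nu expR (- pairing nu f) = L (radon_of_path (step_density eta n)) f.
    have [K [_ KE]] := pushforward_probability
      (kernel_probability P (step_density eta n)) (@measurable_radon_of_path R).
    exists K => f fB'; rewrite KE//; last exact: measurable_expR_pairing.
    exact: PE'.
  have [K KE] := @choice _ _ (fun n (K : probability (radon R) R) =>
    forall f, bounded_positive_compact f ->
      \int[K]_nu expR (- pairing nu f) = L (radon_of_path (step_density eta n)) f) pushE.
  apply: (@laplace_limit R K) => [f fT f0|C a f_ f a0 fS f0 ff].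
    have fB' := bounded_positive_compact_test fT f0.
    under eq_fun do rewrite KE//.
    apply: (@continuous_cvg _ _ _ _ _ (fun n => - (c * u q f 0) -
      pairing (radon_of_path (step_density eta n)) (flow p q f)) (@expR R)).
      exact: continuous_expR.
    apply: cvgB; first exact: cvg_cst.
    apply: step_density_cvg.
    exact: flow_test.
  have gS : bounded_support C a f by exact: bounded_support_cvg ff.
  have g0 s : 0 <= s -> 0 <= f s.
    move=> s0; rewrite -(cvg_lim _ (ff s s0))//; apply: limr_ge.
      by apply/cvg_ex; exists (f s); exact: ff.
    by apply: nearW => k; exact: f0.
  have gB : bounded_positive_compact f.
    by apply/bounded_positive_compactP; split => //; exists C, a.
  have C0 : 0 <= C by have [_ fC _] := gS; exact: le_trans (fC 0 (lexx 0)).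
  have [C' FS] := flow_support Tp Tq a0 C0.
  apply: (@continuous_cvg _ _ _ _ _ (fun k => - (c * u q (f_ k) 0) -
    pairing eta (flow p q (f_ k))) (@expR R)).
    exact: continuous_expR.
  apply: cvgB.
    apply: cvgN; apply: cvgMr.
    exact: (cumulant_cvg Tq a0 fS f0 gB ff (lexx 0)).
  apply: (@pairing_cvg _ eta _ _ _ _ (fun k => FS _ (fS k) (f0 k))) => s s0.
  exact: (flow_cvg Tp Tq a0 fS f0 gB ff s0).
have [Q QE] := @choice _ _ (fun eta (Q : probability (radon R) R) =>
  forall f, bounded_positive_compact f -> \int[Q]_nu expR (- pairing nu f) = L eta f) exQ.
(* The laws were chosen separately for each [eta]; measurability in [eta] is recovered from the
   explicit Laplace functional. *)
have mQ f : bounded_positive_compact f ->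
    measurable_fun setT (fun eta => \int[Q eta]_nu expR (- pairing nu f)).
  move=> fB'; under eq_fun do rewrite QE//.
  have /bounded_positive_compactP[[C' [a' gS]] _] := fB _ fB'.
  apply: measurableT_comp => //; apply: measurable_funB => //.
  exact: measurable_pairing gS.
by exists (laplace_kernel mQ) => eta f fB'; rewrite -/(L eta f) -QE.
Qed.

End flow.

Theorem theorem4p5 (R : realType) (T : set R) (sigma : R) (b : R -> R)
    (m : R -> {measure set R -> \bar R}) (beta : R -> R)
    (n : R -> {measure set R -> \bar R}) (mu : R -> R)
    (u : R -> (R -> R) -> R -> R) (P : R -> R -> R.-pker (cadlag R) ~> (cadlag R)) :
  let phi q := branching_mechanism (b q) sigma (m q) in
  let upq p q f s := f s + (phi p (u q f s) - phi q (u q f s)) in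
  is_interval T ->
  admissible T sigma b m beta n ->
  right_continuous_increasing T mu ->
  (forall q f, T q -> bounded_positive_compact f ->
     unique_cumulant_solution (phi q) f (u q f)) ->
  transition_semigroup T P ->
  (forall p q rho f, T p -> T q -> p <= q -> bounded_positive_compact f ->
     (\int[P p q rho]_w
        (expR (- \int[@lebesgue_measure R]_(s in `[0, +oo[) (f s * w s))%R)%:E =
      (expR (- ((mu q - mu p) * u q f 0) -
             \int[@lebesgue_measure R]_(s in `[0, +oo[)
               (upq p q f s * rho s))%R)%:E)%E) ->
  exists Q : R -> R -> R.-pker (radon R) ~> (radon R),
    [/\ transition_semigroup T Q,
        forall p q (rho : cadlag R) B, T p -> T q -> p <= q -> measurable B ->
          Q p q (radon_of_path rho) B = P p q rho (@radon_of_path R @^-1` B) &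
        forall p q eta f, T p -> T q -> p <= q -> bounded_positive_compact f ->
          (\int[Q p q eta]_nu (expR (- pairing nu f)%R)%:E =
           (expR (- ((mu q - mu p) * u q f 0) - pairing eta (upq p q f))%R)%:E)%E].
Proof.
move=> phi upq _ adm _ uP _ PE.
have phi0 q : T q -> phi q 0 = 0 by move=> _; exact: branching_mechanism0.
have mfin := admissible_m adm.
have phi_ge q l : T q -> 0 <= l -> b q * l <= phi q l.
  by move=> /mfin h; exact: branching_mechanism_ge.
have phi_lip q C : T q -> 0 <= C -> exists2 L, 0 <= L & forall l l',
    0 <= l <= C -> 0 <= l' <= C -> `|phi q l - phi q l'| <= L * `|l - l'|.
  by move=> /mfin h; exact: branching_mechanism_lipschitz.
have phi_decr := admissible_decreasing adm.
have exQ pq : exists Q : R.-pker (radon R) ~> (radon R),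
    T pq.1 -> T pq.2 -> pq.1 <= pq.2 ->
    forall eta f, bounded_positive_compact f -> \int[Q eta]_nu expR (- pairing nu f) =
      expR (- ((mu pq.2 - mu pq.1) * u pq.2 f 0) - pairing eta (flow phi u pq.1 pq.2 f)).
  have [[Tp Tq pq12]|npq] := pselect [/\ T pq.1, T pq.2 & pq.1 <= pq.2]; last first.
    (* Any kernel serves as default for pairs outside the range of the formula. *)
    by exists (kdirac (@measurable_id _ (radon R) setT)) => Tp Tq pq12; case: npq; split.
  have [Q QE] := exists_flow_kernel phi0 phi_ge phi_lip phi_decr uP Tp Tq pq12
    (fun rho f => @PE pq.1 pq.2 rho f Tp Tq pq12).
  by exists Q.
have [Q_ QE_] := @choice _ _ (fun pq (Q : R.-pker (radon R) ~> (radon R)) =>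
    T pq.1 -> T pq.2 -> pq.1 <= pq.2 ->
    forall eta f, bounded_positive_compact f -> \int[Q eta]_nu expR (- pairing nu f) =
      expR (- ((mu pq.2 - mu pq.1) * u pq.2 f 0) -
            pairing eta (flow phi u pq.1 pq.2 f))) exQ.
pose Q p q := Q_ (p, q).
have QE p q eta f : T p -> T q -> p <= q -> bounded_positive_compact f ->
    \int[Q p q eta]_nu expR (- pairing nu f) =
    expR (- ((mu q - mu p) * u q f 0) - pairing eta (flow phi u p q f)).
  by move=> Tp Tq pq; exact: (QE_ (p, q)).
have exp1 f (nu : radon R) : bounded_positive_compact f -> `|expR (- pairing nu f)| <= 1.
  by move=> fB; have /andP[? ?] := expR_pairing01 nu fB; rewrite ger0_norm.
exists Q; split.
- split => [p eta A Tp mA|p r q eta A Tp Tr Tq pr rq mA].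
    apply: (@laplace_unique _ (kernel_probability (Q p p) eta) (\d_eta : probability _ R)) => // f fB.
    rewrite Rintegral_kernel_probability QE// subrr mul0r oppr0 add0r.
    rewrite /Rintegral integral_dirac//; last first.
      by apply/measurable_EFinP; exact: measurable_expR_pairing.
    by rewrite diracT mul1e/=; congr (expR (- _)); apply: eq_pairing => s _; exact: flow_refl.
  have pq : p <= q by exact: le_trans rq.
  apply: (@laplace_compose _ (kernel_probability (Q p q) eta)
    (kernel_probability (Q p r) eta) (Q r q)) => // f fB.
  have gB := flow_positive phi0 phi_ge phi_lip phi_decr uP Tr Tq rq fB.
  rewrite !Rintegral_kernel_probability QE//.
  (* The inner integral is a constant times the Laplace exponential of [flow r q f], to which the
     formula for [Q p r] applies. By [cumulant_flow] at 0 both immigration factors involve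
     [u q f 0], so the increments of [mu] add up. *)
  under eq_Rintegral do rewrite QE// expRD.
  rewrite RintegralZl//; last first.
    apply: (@bounded_integrable _ _ _ (kernel_probability (Q p r) eta) _ _ 1) => //.
      exact: measurable_expR_pairing.
    by move=> y _; exact: exp1.
  rewrite QE// -expRD; congr expR.
  rewrite (cumulant_flow phi0 phi_ge phi_lip phi_decr uP Tr Tq rq fB (lexx 0)).
  rewrite (eq_pairing eta (fun s s0 => flow_flow phi0 phi_ge phi_lip phi_decr uP Tp Tr Tq rq fB s0)).
  by ring.
- move=> p q rho B Tp Tq pq mB.
  (* [N] is the image of [P p q rho] under the embedding; its Laplace functional is that of [Q p q]
     started from [rho(s) ds]. *)
  have [N [NE NI]] := pushforward_probability (kernel_probability (P p q) rho)
    (@measurable_radon_of_path R).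
  rewrite -[RHS]NE; apply: (@laplace_unique _ (kernel_probability (Q p q) (radon_of_path rho)) N) => // f fB.
  have /bounded_positive_compactP[[C [a fS]] _] := fB.
  have /bounded_positive_compactP[[C' [a' gS]] _] :=
    flow_positive phi0 phi_ge phi_lip phi_decr uP Tp Tq pq fB.
  rewrite Rintegral_kernel_probability QE// NI//; last exact: measurable_expR_pairing.
  rewrite Rintegral_kernel_probability /Rintegral.
  under eq_integral do rewrite (pairing_radon_of_path _ fS).
  by rewrite PE// (pairing_radon_of_path _ gS).
- move=> p q eta f Tp Tq pq fB.
  rewrite (integral_kernel_probability _ _ (measurable_expR_pairing fB) (fun nu => exp1 f nu fB)).
  by rewrite QE.
Qed.
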